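(* Let $a<b$ be real, $\Omega=(a,b)$, and $1\le p<\infty$. For each $\epsilon>0$ define $F_\epsilon:L^p(\Omega)\to[-\infty,\infty]$ by $$F_\epsilon(u):=\begin{cases}\int_\Omega\epsilon^{-1}(u^2-1)^2+\epsilon^3|u''|^2\,dx,& u\in W^{2,p}(\Omega),\\ +\infty,&\text{otherwise.}\end{cases}$$ Let $(\epsilon_n)$ be positive reals with $\epsilon_n\to0^+$. Then, with respect to strong convergence in $L^p(\Omega)$, $F_{\epsilon_n}$ Gamma-converges to $$F(u)=\begin{cases}\alpha\operatorname{essVar}_\Omega u,& u\in BPV(\Omega;\{-1,1\}),\\ +\infty,&\text{otherwise.}\end{cases}$$
   Context: For an interval $I$ and $v:I\to\mathbb{R}$, $\operatorname{Var}_I v:=\sup\{\sum_{i=1}^n|v(x_i)-v(x_{i-1})|: x_0<\dots<x_n\text{ in }I\}$; for $u\in L^1_{loc}(I)$, $\operatorname{essVar}_I u:=\inf\{\operatorname{Var}_I\tilde u:\tilde u\text{ a representative of }u\}$. $BPV(\Omega;\{-1,1\})$ is the set of $u\in L^p(\Omega)$ with $u\in\{-1,1\}$ a.e. and $\operatorname{essVar}_\Omega u<\infty$. For $w\in W^{2,p}(0,1)$ (identified with its $C^1$ representative, with one-sided endpoint limits $w(0_+)$, $w'(0_+)$ etc.), $\Phi(w):=\left(\int_0^1(w^2-1)^2dy\right)^{3/4}\left(\int_0^1|w''|^2dy\right)^{1/4}$; $\mathscr{J}:=\{w\in W^{2,p}(0,1): w(0_+)=-1,\ w(1_-)=1,\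 w'(0_+)=w'(1_-)=0\}$; $\alpha:=\frac{2}{3^{3/4}}\inf_{w\in\mathscr{J}}\Phi(w)$. Gamma convergence in a metric space $X$: $f_n$ Gamma-converges to $f$ if for every $x\in X$, $\liminf_n f_n(x_n)\ge f(x)$ for every sequence $x_n\to x$, and $\limsup_n f_n(x_n)\le f(x)$ for some sequence $x_n\to x$. *)

(* Defs.v *)
From HB Require Import structures.
From mathcomp Require Import all_boot all_order all_algebra.
From mathcomp Require Import all_classical all_reals all_analysis.
Set Implicit Arguments. Unset Strict Implicit. Unset Printing Implicit Defensive.
Import Order.TTheory GRing.Theory Num.Theory numFieldNormedType.Exports.
Local Open Scope classical_set_scope.
Local Open Scope ring_scope.

Section Defs.
Variable R : realType.
Local Notation leb := (@lebesgue_measure R).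

Definition inLp (a b p : R) (u : R -> R) : Prop :=
  measurable_fun `]a, b[ u /\
  (\int[leb]_(x in `]a, b[) ((`|u x| `^ p)%:E) < +oo)%E.

Definition Lpdist (a b p : R) (u v : R -> R) : \bar R :=
  poweR (\int[leb]_(x in `]a, b[) ((`|u x - v x| `^ p)%:E)) p^-1.

Definition test_fun (a b : R) (phi : R -> R) : Prop :=
  (forall (n : nat) (x : R), derivable (derive1n n phi) x 1) /\
  exists c d : R, a < c /\ c <= d /\ d < b /\
    (forall x, x < c \/ d < x -> phi x = 0).

Definition W2p_with (a b p : R) (u g1 g2 : R -> R) : Prop :=
  inLp a b p u /\ inLp a b p g1 /\ inLp a b p g2 /\
  forall phi, test_fun a b phi ->
    (\int[leb]_(x in `]a, b[) ((u x * derive1n 1 phi x)%:E) =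
       - \int[leb]_(x in `]a, b[) ((g1 x * phi x)%:E))%E /\
    (\int[leb]_(x in `]a, b[) ((u x * derive1n 2 phi x)%:E) =
       \int[leb]_(x in `]a, b[) ((g2 x * phi x)%:E))%E.

Definition W2p (a b p : R) (u : R -> R) : Prop :=
  exists g1 g2, W2p_with a b p u g1 g2.

(* F_eps; the weak derivatives are unique a.e., so the infimum below is
   taken over a set with a single element when u \in W^{2,p}, and is
   +oo (inf of the empty set) otherwise. *)
Definition Feps (a b p eps : R) (u : R -> R) : \bar R :=
  ereal_inf [set I | exists g1 g2, W2p_with a b p u g1 g2 /\
     I = (\int[leb]_(x in `]a, b[)
            ((eps^-1 * (u x ^+ 2 - 1) ^+ 2 + eps ^+ 3 * `|g2 x| ^+ 2)%:E))%E].

Definition Var (a b : R) (v : R -> R) : \bar R :=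
  ereal_sup [set s | exists (n : nat) (x : nat -> R),
    (forall i, (i <= n)%N -> a < x i < b) /\
    (forall i, (i < n)%N -> x i < x i.+1) /\
    s = ((\sum_(i < n) `|v (x i.+1) - v (x i)|)%:E)].

Definition essVar (a b : R) (u : R -> R) : \bar R :=
  ereal_inf [set Var a b v | v in
    [set v : R -> R | {ae leb, forall x, x \in `]a, b[ -> v x = u x}]].

Definition BPV (a b p : R) (u : R -> R) : Prop :=
  inLp a b p u /\
  {ae leb, forall x, x \in `]a, b[ -> u x = 1 \/ u x = -1} /\
  (essVar a b u < +oo)%E.

Definition Phi (p : R) (w : R -> R) : \bar R :=
  ereal_inf [set v | exists g1 g2, W2p_with 0%R 1%R p w g1 g2 /\
    v = (poweR (\int[leb]_(y in `]0%R, 1%R[) (((w y ^+ 2 - 1) ^+ 2)%:E))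
                (3 / 4) *
         poweR (\int[leb]_(y in `]0%R, 1%R[) ((`|g2 y| ^+ 2)%:E)) (1 / 4))%E].

Definition Jclass (p : R) (w : R -> R) : Prop :=
  W2p 0%R 1%R p w /\
  exists wt : R -> R,
    {ae leb, forall x, x \in `]0%R, 1%R[ -> wt x = w x} /\
    (forall x, x \in `]0%R, 1%R[ -> derivable wt x 1) /\
    {in `]0%R, 1%R[, continuous (derive1 wt)} /\
    wt x @[x --> (0:R)^'+] --> (-1 : R) /\
    wt x @[x --> (1:R)^'-] --> (1 : R) /\
    derive1 wt x @[x --> (0:R)^'+] --> (0 : R) /\
    derive1 wt x @[x --> (1:R)^'-] --> (0 : R).

Definition alpha (p : R) : \bar R :=
  ((2 / (3 `^ (3 / 4)))%:E * ereal_inf [set Phi p w | w in Jclass p])%E.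

Definition Flim (a b p : R) (u : R -> R) : \bar R :=
  if `[< BPV a b p u >] then (alpha p * essVar a b u)%E else +oo%E.

(* Gamma-convergence on L^p(]a,b[) (strong topology), elements of L^p
   being represented by measurable functions with finite p-th moment *)
Definition Gamma_conv_Lp (a b p : R) (Fn : nat -> (R -> R) -> \bar R)
    (F : (R -> R) -> \bar R) : Prop :=
  forall u, inLp a b p u ->
    (forall un : nat -> R -> R, (forall n, inLp a b p (un n)) ->
       Lpdist a b p (un n) u @[n --> \oo] --> 0%E ->
       (F u <= limn_einf (fun n => Fn n (un n)))%E) /\
    (exists un : nat -> R -> R, (forall n, inLp a b p (un n)) /\
       Lpdist a b p (un n) u @[n --> \oo] --> 0%E /\
       (limn_esup (fun n => Fn n (un n)) <= F u)%E).

End Defs.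

(* Main.v *)
(* Let W be the well term and B the bending term of a rescaled transition of length L.
   Its cost L W + L^-3 B is at least 4 3^(-3/4) W^(3/4) B^(1/4) by the weighted AM-GM
   inequality, with equality for the best L; hence a clean transition from -1 to 1 costs
   at least 2 alpha, and 2 alpha is the infimum of the cost.

   Lower bound: if u takes the values 1 and -1 alternately n + 1 times, then on each of
   the corresponding sets of positive measure an approximating function of bounded energy
   has a cell of length eps of small energy. There it is close to the right well with small
   scaled slope, and gluing in Hermite cubics makes it start and end exactly in the wells at
   a small extra cost, so each of the n transitions costs nearly 2 alpha.

   Upper bound: a limit of finite variation is piecewise constant; replace each jump by a
   nearly optimal profile rescaled to length eps L, then extract a diagonal sequence. *)

(* Weak derivatives are met only when entering and leaving [Feps] and [Phi]: a function of W^{2,p}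
   is traded for two integral identities, [prim a b V U] and [prim a b g V], by a du Bois-Reymond
   argument. Afterwards restriction, rescaling and gluing are manipulations of integrals. For
   general p neither of g in L^p and g in L^2 implies the other, so both are carried through every
   construction.

   Elements of L^p have no pointwise values, so the lower bound compares measures: if no cell were
   close to the well s, the measure of the set u = s would have to be paid by eps times the energy
   or by the L^p error. This works for every large index, and no subsequence is extracted. The
   length eps is the scale at which the energy of one cell alone controls U and eps U'.

   That u has finitely many jumps must be known before u is known to have bounded variation; it
   follows from alpha > 0, which is proved by a cruder cell argument. Finiteness of alpha is never
   established: the value +oo is a separate case in both bounds. *)
Require Import Defs.
From HB Require Import structures.
From mathcomp Require Import all_boot all_order all_algebra.
From mathcomp Require Import all_classical all_reals all_analysis.
From mathcomp Require Import measurable_realfun.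
From mathcomp Require Import ring lra.
Import Order.TTheory GRing.Theory Num.Theory numFieldNormedType.Exports.
Local Open Scope classical_set_scope.
Local Open Scope ring_scope.
Set Implicit Arguments. Unset Strict Implicit. Unset Printing Implicit Defensive.

(** * Real-valued integrals over open intervals *)

Section Interval.
Context {R : realType}.
Notation mu := (@lebesgue_measure R).
Implicit Types (a b c k : R) (f g : R -> R).

Definition L1 a b f := mu.-integrable `]a, b[ (EFin \o f).
Definition Int a b f : R := (\int[mu]_(x in `]a, b[) f x)%R.

Lemma eq_Int a b f g : (forall x, a < x < b -> f x = g x) -> Int a b f = Int a b g.
Proof.
move=> fg; apply: eq_Rintegral => x; rewrite inE/= in_itv/= => xab.
exact: fg.
Qed.

Lemma eq_L1 a b f g : (forall x, a < x < b -> f x = g x) -> L1 a b f -> L1 a b g.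
Proof.
move=> fg; apply: eq_integrable => // x; rewrite inE/= in_itv/= => xab.
by rewrite /= fg.
Qed.

Lemma L1_meas a b f : L1 a b f -> measurable_fun `]a, b[ f.
Proof. by move=> /(measurable_int mu)/measurable_EFinP. Qed.

Lemma L1_sub a b a' b' f : a <= a' -> b' <= b -> L1 a b f -> L1 a' b' f.
Proof.
move=> aa bb; apply: integrableS => //.
by apply: subset_itv; rewrite bnd_simp.
Qed.

Lemma Int_ge a b f : b <= a -> Int a b f = 0.
Proof.
move=> ba; rewrite /Int set_itv_ge ?Rintegral_set0// bnd_simp -leNgt//.
Qed.

Lemma itv_split a b c : a < c -> c < b ->
  `]a, b[%classic = `]a, c[%classic `|` `[c, b[%classic :> set R.
Proof.
move=> ac cb; rewrite -itv_bndbnd_setU// bnd_simp//; exact: ltW.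
Qed.

Lemma integrable_co a b f : L1 a b f -> mu.-integrable `[a, b[ (EFin \o f).
Proof.
move=> /integrableP[mf lf]; apply/integrableP; split.
  by apply/emeasurable_fun_itv_obnd_cbndP.
rewrite -integral_itv_obnd_cbnd//; exact: measurableT_comp.
Qed.

Lemma integrable_oc a b f : L1 a b f -> mu.-integrable `]a, b] (EFin \o f).
Proof.
move=> /integrableP[mf lf]; apply/integrableP; split.
  by apply/emeasurable_fun_itv_bndo_bndcP.
rewrite -integral_itv_bndo_bndc//; exact: measurableT_comp.
Qed.

Lemma L1_cat a b c f : L1 a c f -> L1 c b f -> L1 a b f.
Proof.
have [ac|ca] := ltP a c; last by move=> _; apply: L1_sub.
have [cb|bc] := ltP c b; last by move=> + _; apply: L1_sub.
move=> /integrableP[m1 l1] /integrable_co/integrableP[m2 l2].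
rewrite /L1 (itv_split ac cb); apply/integrableP; split.
  by apply/measurable_funU.
rewrite ge0_integral_setU//=; first by rewrite lte_add_pinfty.
  have := measurableT_comp (@abse_measurable R _) ((measurable_funU _ _ _).2 (conj m1 m2)); exact.
apply/disj_setPS => x /= [] ; rewrite !in_itv/= => /andP[_ xc] /andP[cx _].
by move: cx; rewrite leNgt xc.
Qed.

Lemma Int_cat a b c f : a <= c -> c <= b -> L1 a b f ->
  Int a b f = Int a c f + Int c b f.
Proof.
rewrite le_eqVlt => /orP[/eqP <- _ _|ac]; first by rewrite (@Int_ge a a)// add0r.
rewrite le_eqVlt => /orP[/eqP <- _|cb lf]; first by rewrite (@Int_ge c c)// addr0.
rewrite /Int [X in \int[mu]_(x in X) _ = _](itv_split ac cb) Rintegral_setU//.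
- by congr (_ + _); rewrite [RHS](Rintegral_itv_obnd_cbnd (L1_sub (ltW ac) (lexx b) lf)).
- by rewrite -(itv_split ac cb).
- apply/disj_setPS => x /= [] ; rewrite !in_itv/= => /andP[_ xc] /andP[cx _].
  by move: cx; rewrite leNgt xc.
Qed.

Lemma L1_cst a b k : L1 a b (fun=> k).
Proof.
apply: measurable_bounded_integrable => //.
  rewrite /= lebesgue_measure_itv/=; case: ifP => // _; exact: ltry.
by exists `|k|; split; [exact: num_real|move=> M kM x _/=; exact: ltW].
Qed.

Lemma Int_cst a b k : a <= b -> Int a b (fun=> k) = k * (b - a).
Proof.
rewrite le_eqVlt => /orP[/eqP <-|ab]; first by rewrite Int_ge// subrr mulr0.
by rewrite /Int Rintegral_cst//= lebesgue_measure_itv/= lte_fin ab.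
Qed.

Lemma L1D a b f g : L1 a b f -> L1 a b g -> L1 a b (fun x => f x + g x).
Proof. 
move=> lf lg; rewrite /L1 (_ : EFin \o _ = (EFin \o f) \+ (EFin \o g))%E//.
exact: integrableD. Qed.

Lemma L1Z a b k f : L1 a b f -> L1 a b (fun x => k * f x).
Proof. 
move=> lf; rewrite /L1 (_ : EFin \o _ = (fun x => k%:E * (EFin \o f) x))%E//.
exact: integrableZl. Qed.

Lemma L1N a b f : L1 a b f -> L1 a b (fun x => - f x).
Proof. by move=> lf; exact: (integrableN lf). Qed.

Lemma L1B a b f g : L1 a b f -> L1 a b g -> L1 a b (fun x => f x - g x).
Proof. by move=> lf lg; apply: L1D => //; exact: L1N. Qed.

Lemma L1_norm a b f : L1 a b f -> L1 a b (fun x => `|f x|).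
Proof. by move=> lf; apply: integrable_norm. Qed.

Lemma IntD a b f g : L1 a b f -> L1 a b g ->
  Int a b (fun x => f x + g x) = Int a b f + Int a b g.
Proof. by move=> lf lg; apply: RintegralD. Qed.

Lemma IntB a b f g : L1 a b f -> L1 a b g ->
  Int a b (fun x => f x - g x) = Int a b f - Int a b g.
Proof. by move=> lf lg; apply: RintegralB. Qed.

Lemma IntZ a b k f : L1 a b f -> Int a b (fun x => k * f x) = k * Int a b f.
Proof. by move=> lf; apply: RintegralZl. Qed.

Lemma le_Int a b f g : L1 a b f -> L1 a b g ->
  (forall x, a < x < b -> f x <= g x) -> Int a b f <= Int a b g.
Proof.
move=> lf lg fg; apply: le_Rintegral => // x /=; rewrite in_itv/=; exact: fg.
Qed.

Lemma Int_ge0 a b f : (forall x, a < x < b -> 0 <= f x) -> 0 <= Int a b f.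
Proof. by move=> f0; apply: Rintegral_ge0 => x /=; rewrite in_itv/=; exact: f0. Qed.

Lemma normr_Int a b f : L1 a b f -> `|Int a b f| <= Int a b (fun x => `|f x|).
Proof. by move=> lf; apply: le_normr_Rintegral. Qed.

Lemma Int_EFin a b f : L1 a b f ->
  (\int[mu]_(x in `]a, b[) (f x)%:E = (Int a b f)%:E)%E.
Proof. by move=> lf; rewrite /Int /Rintegral fineK//; exact: integrable_fin_num. Qed.

Lemma le_L1 a b f g : measurable_fun `]a, b[ f -> L1 a b g ->
  (forall x, a < x < b -> `|f x| <= g x) -> L1 a b f.
Proof.
move=> mf lg fg; apply: le_integrable lg => //; first exact/measurable_EFinP.
by move=> x /=; rewrite in_itv/= => /fg h; rewrite lee_fin (le_trans h)// ler_norm.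
Qed.

Lemma L1_ge0 a b f : measurable_fun `]a, b[ f -> (forall x, a < x < b -> 0 <= f x) ->
  (\int[mu]_(x in `]a, b[) (f x)%:E < +oo)%E -> L1 a b f.
Proof.
move=> mf f0 foo; apply/integrableP; split; first exact/measurable_EFinP.
rewrite (_ : (\int[mu]_(x in `]a, b[) _)%E = (\int[mu]_(x in `]a, b[) (f x)%:E)%E)//.
apply: eq_integral => x; rewrite inE/= in_itv/= => /f0 h.
by rewrite ger0_norm.
Qed.

Definition ae_on a b (P : R -> Prop) := {ae mu, forall x, x \in `]a, b[ -> P x}.

Lemma Int_ae a b f g : measurable_fun `]a, b[ f -> measurable_fun `]a, b[ g ->
  ae_on a b (fun x => f x = g x) -> Int a b f = Int a b g.
Proof.
move=> mf mg fg; rewrite /Int /Rintegral; congr fine.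
apply: ae_eq_integral => //; [exact/measurable_EFinP|exact/measurable_EFinP|].
move: fg; rewrite /ae_on; apply: filterS; first exact: (ae_filter_ringOfSetsType mu).
by move=> x /= h xab; rewrite h.
Qed.

Lemma L1_ae a b f g : measurable_fun `]a, b[ g -> L1 a b f ->
  ae_on a b (fun x => f x = g x) -> L1 a b g.
Proof.
move=> mg lf fg; have mf := L1_meas lf.
move/integrableP : lf => [_ lf]; apply/integrableP; split; first exact/measurable_EFinP.
rewrite (_ : (\int[mu]_(x in _) _)%E = (\int[mu]_(x in `]a, b[) `|(EFin \o f) x|)%E)//.
apply: ae_eq_integral => //.
- apply: measurableT_comp => //; exact/measurable_EFinP.
- apply: measurableT_comp => //; exact/measurable_EFinP.
- move: fg; rewrite /ae_on; apply: filterS; first exact: (ae_filter_ringOfSetsType mu).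
by move=> x /= h xab; rewrite h.
Qed.

Lemma L1_bounded a b f k : measurable_fun `]a, b[ f ->
  (forall x, a < x < b -> `|f x| <= k) -> L1 a b f.
Proof. by move=> mf fk; apply: (le_L1 mf (L1_cst a b k)). Qed.

End Interval.

(** * Affine change of variables *)

Section Affine.
Context {R : realType}.
Notation mu := (@lebesgue_measure R).
Implicit Types (a b c k : R) (f g : R -> R).

Let aff k c : measurableTypeR R -> measurableTypeR R := fun x => k * x + c.

Let maff k c : measurable_fun setT (aff k c).
Proof. by apply: measurable_funD => //; apply: measurable_funM. Qed.

Lemma preimage_affine_itv k c a b (x y : bool) : 0 < k ->
  (fun t => k * t + c) @^-1` [set` Interval (BSide x (k * a + c)) (BSide y (k * b + c))] =
  [set` Interval (BSide x a) (BSide y b)] :> set R.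
Proof.
by move=> k0; apply/seteqP; case: x; case: y; split => t /=;
rewrite !in_itv/= ?lerD2r ?ltrD2r ?ler_pM2l ?ltr_pM2l// ?lerD2r ?ltrD2r ?ler_pM2l ?ltr_pM2l.
Qed.

Let maffine k c : 0 < k -> {measure set (measurableTypeR R) -> \bar R}.
Proof.
move=> k0; exact (mscale (NngNum (ltW k0)) (measure_function_pushforward__canonical__measure_function_Measure mu (maff k c))).
Defined.

(** Lebesgue measure is determined by its values on half-open intervals, and there the factor k
    undoes the shrinking of the preimage under t |-> k t + c. *)
Let maffineE k c (k0 : 0 < k) A : measurable A -> mu A = maffine c k0 A.
Proof.
apply: lebesgue_measure_unique => // _ [[a b]] _ <- /=.
rewrite /mscale/= /pushforward.
have ha x : x = k * (k^-1 * (x - c)) + c.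
  by rewrite mulrA mulfV ?gt_eqF// mul1r subrK.
rewrite (ha a) (ha b) preimage_affine_itv// !lebesgue_measure_itv /= !lte_fin.
rewrite ltrD2r !ltr_pM2l// ?invr_gt0// ltrD2r; case: ifP; rewrite ?mule0// => _.
by rewrite -EFinM; congr EFin; ring.
Qed.

Lemma ge0_integral_affine k c a b (F : R -> \bar R) : 0 < k ->
  measurable_fun `]k * a + c, k * b + c[ F ->
  (forall x, k * a + c < x < k * b + c -> (0 <= F x)%E) ->
  (\int[mu]_(x in `](k * a + c)%R, (k * b + c)%R[) F x =
   k%:E * \int[mu]_(x in `]a, b[) F (k * x + c)%R)%E.
Proof.
move=> k0 mF F0.
transitivity (\int[maffine c k0]_(x in `](k * a + c)%R, (k * b + c)%R[) F x)%E.
  by apply: eq_measure_integral => A mA _; exact: maffineE.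
rewrite /maffine ge0_integral_mscale//=.
rewrite ge0_integral_pushforward//.
  by rewrite (preimage_affine_itv c a b false true k0).
by move=> x; rewrite inE/= in_itv/=; exact: F0.
Qed.

Lemma measurable_affine k c a b f : 0 < k ->
  measurable_fun `]k * a + c, k * b + c[ f ->
  measurable_fun `]a, b[ (fun x => f (k * x + c)).
Proof.
move=> k0 mf.
apply: (@measurable_comp _ _ _ _ _ _ (`]k * a + c, k * b + c[%classic) f _ (aff k c)) => //.
  move=> _ [x + <-] /=; rewrite !in_itv/= => xab.
  by rewrite /aff ltrD2r ltr_pM2l// ltrD2r ltr_pM2l.
exact: measurable_funS (maff k c).
Qed.

Lemma L1_affine k c a b f : 0 < k -> L1 (k * a + c) (k * b + c) f ->
  L1 a b (fun x => f (k * x + c)).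
Proof.
move=> k0 lf; have mf := L1_meas lf.
apply/integrableP; split; first by apply/measurable_EFinP; exact: measurable_affine.
move/integrableP: lf => [_].
rewrite ge0_integral_affine//; last by apply/measurable_EFinP; exact: measurableT_comp.
by move=> h; rewrite -(@lte_pmul2l _ k%:E)// ?gt0_muley ?lte_fin.
Qed.

Lemma Int_affine k c a b f : 0 < k -> L1 (k * a + c) (k * b + c) f ->
  Int (k * a + c) (k * b + c) f = k * Int a b (fun x => f (k * x + c)).
Proof.
move=> k0.
have pos g : (forall x, 0 <= g x) -> L1 (k * a + c) (k * b + c) g ->
    Int (k * a + c) (k * b + c) g = k * Int a b (fun x => g (k * x + c)).
  move=> g0 lg; apply: EFin_inj; rewrite -Int_EFin// EFinM -Int_EFin; last exact: L1_affine.
  rewrite ge0_integral_affine//; last by move=> x _; rewrite lee_fin.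
  exact: measurable_int lg.
(* The formula is known for nonnegative integrands only, so f is written as (|f| + f) - |f|. *)
move=> lf; have lf1 : L1 (k * a + c) (k * b + c) (fun x => `|f x| + f x).
  by apply: L1D => //; exact: L1_norm.
have lf2 := L1_norm lf.
rewrite (@eq_Int _ _ _ f (fun x => (`|f x| + f x) - `|f x|)); last by move=> x _; ring.
rewrite [in RHS](@eq_Int _ _ _ _ (fun x => (`|f (k * x + c)| + f (k * x + c)) - `|f (k * x + c)|)); last by move=> x _; ring.
rewrite IntB// IntB; first last.
- exact: (L1_affine k0 lf2).
- exact: (L1_affine k0 lf1).
rewrite (pos _ _ lf1) ?(pos _ _ lf2) ?mulrBr// => x.
by rewrite -lerBlDr sub0r -normrN ler_norm.
Qed.

End Affine.

(** * Absolutely continuous functions as primitives *)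

Section Prim.
Context {R : realType}.
Notation mu := (@lebesgue_measure R).
Implicit Types (a b c k : R) (f g F G : R -> R).

(** Absolute continuity of F on the closed interval with F' = f, in integrated form. The endpoints
    are included so that boundary values [F a], [F b] make sense and can be matched in gluing. *)
Definition prim a b f F :=
  L1 a b f /\ forall x y, a <= x -> x <= y -> y <= b -> F y - F x = Int x y f.

Lemma prim_L1 a b f F : prim a b f F -> L1 a b f.
Proof. by case. Qed.

Lemma prim_Int a b f F x : prim a b f F -> a <= x <= b -> F x = F a + Int a x f.
Proof.
by move=> [_ h] /andP[ax xb]; rewrite -(h a x)// addrC subrK.
Qed.

Lemma prim_sub a b a' b' f F : a <= a' -> b' <= b -> prim a b f F -> prim a' b' f F.
Proof.
move=> aa bb [lf h]; split; first exact: L1_sub lf.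
move=> x y ax xy yb; apply: h => //; [exact: le_trans ax|exact: le_trans bb].
Qed.

Lemma prim_cat a b c f F : prim a c f F -> prim c b f F -> prim a b f F.
Proof.
move=> [l1 h1] [l2 h2]; have lf := L1_cat l1 l2; split => // x y ax xy yb.
have [yc|cy] := leP y c; first exact: h1.
have [cx|xc] := leP c x; first exact: h2.
rewrite (@Int_cat _ x y c) ?(ltW xc) ?(ltW cy)//; last exact: L1_sub lf.
by rewrite -h1 ?(ltW xc)// -h2 ?(ltW cy)//; ring.
Qed.

Lemma eq_prim a b f g F G : (forall x, a < x < b -> f x = g x) ->
  (forall x, a <= x <= b -> F x = G x) -> prim a b f F -> prim a b g G.
Proof.
move=> fg FG [lf h]; split; first exact: eq_L1 lf.
move=> x y ax xy yb; rewrite -!FG ?h ?ax ?yb ?(le_trans xy)//; last by rewrite (le_trans ax).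
apply: eq_Int => t /andP[xt ty]; apply: fg.
by rewrite (le_lt_trans ax)//= (lt_le_trans ty).
Qed.

Lemma prim_cst a b k : prim a b (fun=> 0) (fun=> k).
Proof.
split; first exact: L1_cst.
by move=> x y _ xy _; rewrite Int_cst// mul0r subrr.
Qed.

Lemma primD a b f g F G : prim a b f F -> prim a b g G ->
  prim a b (fun x => f x + g x) (fun x => F x + G x).
Proof.
move=> [lf hf] [lg hg]; split; first exact: L1D.
move=> x y ax xy yb; rewrite IntD; [|exact: L1_sub lf|exact: L1_sub lg].
by rewrite -hf// -hg//; ring.
Qed.

Lemma primZ a b k f F : prim a b f F -> prim a b (fun x => k * f x) (fun x => k * F x).
Proof.
move=> [lf hf]; split; first exact: L1Z.
by move=> x y ax xy yb; rewrite IntZ -?hf ?mulrBr//; exact: L1_sub lf.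
Qed.

Lemma prim_affine k c a b f F : 0 < k -> prim (k * a + c) (k * b + c) f F ->
  prim a b (fun x => k * f (k * x + c)) (fun x => F (k * x + c)).
Proof.
move=> k0 [lf hf].
have le x y : x <= y -> k * x + c <= k * y + c by rewrite lerD2r ler_pM2l.
have lf' := L1_affine k0 lf; split; first exact: L1Z.
move=> x y ax xy yb; rewrite hf ?le// IntZ ?Int_affine//; last exact: L1_sub lf'.
by apply: L1_sub lf; exact: le.
Qed.

Lemma prim_self a b k f : L1 a b f -> prim a b f (fun x => k + Int a x f).
Proof.
move=> lf; split => // x y ax xy yb.
by rewrite (@Int_cat _ a y x)//; [ring|exact: L1_sub lf].
Qed.

Lemma prim_bounded a b f F x : prim a b f F -> a <= x <= b ->
  `|F x| <= `|F a| + Int a b (fun x => `|f x|).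
Proof.
move=> pF xab; have [ax xb] := andP xab; rewrite (prim_Int pF xab).
have lf := prim_L1 pF; have lfx : L1 a x f by exact: L1_sub lf.
rewrite (le_trans (ler_normD _ _))// lerD2l (le_trans (normr_Int lfx))//.
rewrite [leRHS](@Int_cat _ a b x)//; last exact: L1_norm.
by rewrite lerDl Int_ge0.
Qed.

Lemma prim_continuous a b f F : a <= b -> prim a b f F -> {within `[a, b], continuous F}.
Proof.
move=> ab pF; have lf := prim_L1 pF.
have lf' : mu.-integrable `[a, b] (EFin \o f).
  have /integrableP[mf loo] := integrable_oc lf; apply/integrableP; split.
    by apply/emeasurable_fun_itv_obnd_cbndP.
  by rewrite -integral_itv_obnd_cbnd//; exact: measurableT_comp.
have h := parameterized_integral_continuous ab lf'.
apply: (@subspace_eq_continuous _ _ _ (fun x => parameterized_integral mu a x f + F a)).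
  move=> x /=; rewrite inE/= in_itv/= => xab; have /andP[ax xb] := xab.
  rewrite addrC -[RHS]/(F x) (prim_Int pF xab); congr (_ + _).
  rewrite /parameterized_integral /Int.
  rewrite Rintegral_itv_bndo_bndc; last exact: L1_sub lf.
  rewrite Rintegral_itv_obnd_cbnd//; exact/integrable_oc/(L1_sub (lexx a) xb).
by move=> x; apply: cvgD; [exact: h|exact: cvg_cst].
Qed.

Lemma continuous_L1 a b f : {within `[a, b], continuous f} -> L1 a b f.
Proof.
move=> cf; apply: (@integrableS _ _ _ mu `[a, b]%classic) => //.
  exact: subset_itv_oo_cc.
apply: continuous_compact_integrable => //; exact: segment_compact.
Qed.

Lemma prim_C1 a b f F : (forall x, derivable F x 1) -> (forall x, derive1 F x = f x) ->
  continuous f -> prim a b f F.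
Proof.
move=> dF F'f cf; split.
  by apply: continuous_L1; exact: continuous_subspaceT.
move=> x y ax; rewrite le_eqVlt => /orP[/eqP <- _|xy yb]; first by rewrite subrr Int_ge.
have cF : continuous F by move=> z; apply/differentiable_continuous/derivable1_diffP.
apply: EFin_inj; rewrite -Int_EFin; last first.
  by apply: continuous_L1; exact: continuous_subspaceT.
rewrite EFinB -(@continuous_FTC2 _ f F)//.
- rewrite -integral_itv_obnd_cbnd ?integral_itv_bndo_bndc//.
  + by apply/measurable_EFinP/measurable_funTS; exact: continuous_measurable_fun.
  + by apply/measurable_EFinP/measurable_funTS; exact: continuous_measurable_fun.
- exact: continuous_subspaceT.
- split; [by move=> z _; exact: dF| |].
  + exact/cvg_at_right_filter/cF.
  + exact/cvg_at_left_filter/cF.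
Qed.

Lemma prim_derive a b f F x : prim a b f F -> a < x < b -> {for x, continuous f} ->
  derivable F x 1 /\ derive1 F x = f x.
Proof.
move=> pF /andP[ax xb] cf; have lf := prim_L1 pF.
pose c := (x + b) / 2; have /andP[xc cb] : x < c < b by rewrite /c; lra.
have lc : mu.-integrable `]a, c] (EFin \o f).
  by apply: integrable_oc; apply: L1_sub lf => //; exact: ltW.
have [] := @continuous_FTC1 R f (BRight a) x c xc lc _ cf.
  by rewrite lte_fin.
set H := (fun y => _) => dH H'.
have eqH : \forall y \near x, F y = F a + H y.
  near=> y; have ay : a < y by near: y; exact: lt_nbhsr.
  have yb : y < b by near: y; exact: lt_nbhsl.
  rewrite (@prim_Int a b f F y)// ?(ltW ay) ?(ltW yb)//; congr (_ + _).
  by rewrite /H /Int Rintegral_itv_bndo_bndc//; apply: L1_sub lf => //; exact: ltW.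
clearbody H.
have isH : is_derive x (1 : R) H (f x) by rewrite -H' derive1E; exact: DeriveDef.
have isC := is_deriveD (is_derive_cst (F a) x (1 : R)) isH.
have isF : is_derive x (1 : R) F (0 + f x).
  by apply: near_eq_is_derive isC; apply: filterS eqH => y ->.
by split; [exact: ex_derive|rewrite derive1E derive_val add0r].
Unshelve. all: by end_near. Qed.
End Prim.

(** * Calculus of infinitely differentiable functions *)

Section Smooth.
Context {R : realType}.
Implicit Types (f g : R -> R) (P Q : {poly R}).

Definition smooth f := forall n (x : R), derivable (derive1n n f) x 1.

Lemma smooth_derive1 f : smooth f -> smooth (derive1 f).
Proof. by move=> sf n x; rewrite -derive1Sn; exact: sf. Qed.

Lemma smooth_derivable f x : smooth f -> derivable f x 1.
Proof. by move=> /(_ 0%N x); rewrite derive1n0. Qed.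

Lemma smooth_continuous f : smooth f -> continuous f.
Proof.
by move=> sf x; apply/differentiable_continuous/derivable1_diffP; exact: smooth_derivable.
Qed.

Lemma smooth_eq f g : f =1 g -> smooth f -> smooth g.
Proof. by move=> /funext ->. Qed.

Lemma smoothS f f' : (forall x : R, is_derive x 1 f (f' x)) -> smooth f' -> smooth f.
Proof.
move=> df sf' [|n] x; first by rewrite derive1n0; exact: ex_derive.
rewrite derive1Sn (_ : derive1 f = f') //.
by apply/funext => y; rewrite derive1E; apply: derive_val.
Qed.

(** A graded form of [smooth] that peels off the first derivative and keeps all lower orders. The
    Leibniz rule can then be iterated by induction on n, since the product rule needs f itself and
    its derivative at the same order. *)
Fixpoint Cn n f := (forall x : R, derivable f x 1) /\
  if n is m.+1 then Cn m (derive1 f) else True.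

Lemma CnP f : smooth f <-> forall n, Cn n f.
Proof.
split=> [sf n|].
  elim: n f sf => [|n ih] f sf /=; split => //; try by move=> x; exact: smooth_derivable.
  exact/ih/smooth_derive1.
move=> cf n; elim: n f cf => [|n ih] f cf x; first by rewrite derive1n0; exact: (cf 0%N).1.
by rewrite derive1Sn; apply: ih => m; exact: (cf m.+1).2.
Qed.

Lemma CnW n f : Cn n.+1 f -> Cn n f.
Proof. by elim: n f => [|n ih] f /= [df cf]; split => //; exact: ih. Qed.

Lemma is_derive_derive1 f (x : R) : derivable f x 1 -> is_derive x 1 f (derive1 f x).
Proof. by move=> df; rewrite derive1E; exact: DeriveDef. Qed.

Lemma CnD n f g : Cn n f -> Cn n g -> Cn n (f + g).
Proof.
elim: n f g => [|n ih] f g /= [df cf] [dg cg];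
  have h x := is_deriveD (is_derive_derive1 (df x)) (is_derive_derive1 (dg x));
  (split; [by move=> x; have := h x => ?; exact: ex_derive|]); first exact: I.
rewrite (_ : derive1 _ = derive1 f + derive1 g); first exact: ih.
by apply/funext => x; rewrite derive1E; have := h x => ?; rewrite derive_val.
Qed.

Lemma CnM n f g : Cn n f -> Cn n g -> Cn n (f * g).
Proof.
elim: n f g => [|n ih] f g cf cg;
  have h x := is_deriveM (is_derive_derive1 (cf.1 x)) (is_derive_derive1 (cg.1 x));
  (split; [by move=> x; have := h x => ?; exact: ex_derive|]); first exact: I.
rewrite (_ : derive1 _ = f * derive1 g + g * derive1 f).
  by apply: CnD; apply: ih; [exact: CnW|exact: cg.2|exact: CnW|exact: cf.2].
by apply/funext => x; rewrite derive1E; have := h x => ?; rewrite derive_val.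
Qed.

Lemma smoothM f g : smooth f -> smooth g -> smooth (f * g).
Proof. by move=> /CnP cf /CnP cg; apply/CnP => n; exact: CnM. Qed.

Lemma smooth_cst (k : R) : smooth (fun=> k).
Proof.
have s0 : smooth (fun=> 0).
  have h n : derive1n n (fun=> (0:R)) = (fun=> (0:R)) :> (R -> R).
    elim: n => [|n ih]; first by rewrite derive1n0.
    by rewrite derive1nS ih; apply/funext => x; rewrite derive1_cst.
  by move=> n x; rewrite h.
exact: (smoothS (fun x => is_derive_cst k x 1) s0).
Qed.

Lemma Cn_cst n (k : R) : Cn n (fun=> k).
Proof. exact: ((CnP (fun=> k)).1 (@smooth_cst k) n). Qed.

Lemma smoothB f g : smooth f -> smooth g -> smooth (fun x => f x - g x).
Proof.
move=> sf sg.
have : smooth (f + (fun=> -1) * g).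
  apply/CnP => n; apply: CnD; first exact: (CnP f).1.
  by apply: CnM; [exact: Cn_cst|exact: (CnP g).1].
by apply: smooth_eq => x /=; rewrite /GRing.mul /GRing.add /= mulN1r.
Qed.

Lemma is_derive_affine (k c : R) f df (x : R) : is_derive (k * x + c) 1 f df ->
  is_derive x 1 (fun y => f (k * y + c)) (k * df).
Proof.
move=> hf; have hg : is_derive x 1 (fun y => k * y + c) k.
  have h := is_deriveD (is_deriveZ k (is_derive_id x (1 : R))) (is_derive_cst c x (1 : R)).
  by have := h; rewrite addr0 /GRing.scale /= mulr1.
by have := @is_derive1_comp R f (fun y => k * y + c) x df k hf hg; rewrite mulrC.
Qed.

Lemma smooth_affine (k c : R) f : smooth f -> smooth (fun x => f (k * x + c)).
Proof.
move=> /CnP sf; apply/CnP => n; elim: n f {sf}(sf n) => [|n ih] f sf.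
  split => // x; have := is_derive_affine (is_derive_derive1 (sf.1 (k * x + c))).
  by move=> h; exact: ex_derive.
have h x := is_derive_affine (is_derive_derive1 (sf.1 (k * x + c))).
split; first by move=> x; have := h x => ?; exact: ex_derive.
rewrite (_ : derive1 _ = (fun=> k) * (fun x => derive1 f (k * x + c))).
  by apply: CnM; [exact: Cn_cst|exact/ih/sf.2].
by apply/funext => x; rewrite derive1E; have := h x => ?; rewrite derive_val.
Qed.

End Smooth.

(** * The flat functions P(1/t) exp(-1/t) *)

Section Bump.
Context {R : realType}.
Implicit Types (f g : R -> R) (P Q : {poly R}) (x t c d : R).

(** Monomial by monomial: exp x >= x^i / i!, so x^i exp(-x) <= i!. With x = 1/t this gives the
    flatness at 0 of the functions below. *)
Lemma poly_expRN_bounded P : exists C : R, 0 <= C /\ forall x, 0 <= x -> `|P.[x] * expR (- x)| <= C.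
Proof.
exists (\sum_(i < size P) `|P`_i| * i`!%:R); split.
  by apply: sumr_ge0 => i _; rewrite mulr_ge0.
move=> x x0; rewrite horner_coef mulr_suml (le_trans (ler_norm_sum _ _ _))//.
apply: ler_sum => i _; rewrite -mulrA normrM ler_wpM2l// ger0_norm; last first.
  by rewrite mulr_ge0 ?exprn_ge0// expR_ge0.
rewrite expRN ler_pdivrMr ?expR_gt0// mulrC -ler_pdivrMr ?ltr0n ?fact_gt0//.
case: (nat_of_ord i) => [|n]; first by rewrite expr0 fact0 divr1 -expR0 ler_expR.
by apply: le_trans (expR_ge1Dxn n x0); rewrite lerDr.
Qed.

(** Serves for differentiability at the gluing point 0 of [bump], where the rules of calculus do not
    apply. *)
Lemma is_derive_quad f (x l C : R) :
  (forall h, `|f (x + h) - f x - l * h| <= C * h ^+ 2) -> is_derive x (1 : R) f l.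
Proof.
move=> hf.
have C0 : 0 <= C.
  by have := hf 1; rewrite expr1n [C * 1]mulr1; apply: le_trans; exact: normr_ge0.
have cv : h^-1 *: ((f \o shift x) (h *: (1 : R)) - f x) @[h --> (0 : R)^'] --> l.
  apply/cvgrPdist_le => e e0; near=> h.
  have h0 : h != 0 by near: h; exact: nbhs_dnbhs_neq.
  have he : `|h| <= e / (C + 1).
    by near: h; apply: dnbhs0_le; rewrite divr_gt0// ltr_wpDl.
  rewrite /= /GRing.scale /= mulr1.
  have -> : l - h^-1 * (f (h + x) - f x) = - (h^-1 * (f (x + h) - f x - l * h)).
    by rewrite [h + x]addrC; field.
  rewrite normrN normrM normfV ler_pdivrMl ?normr_gt0//.
  apply: (le_trans (hf h)); rewrite -real_normK ?num_real// expr2 mulrCA ler_wpM2l// mulrC.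
  move: he; rewrite ler_pdivlMr ?ltr_wpDl//; apply: le_trans.
  by rewrite ler_wpM2l// lerDl.
apply: DeriveDef; first by apply/cvg_ex; exists l.
exact/cvg_lim.
Unshelve. all: by end_near. Qed.

(** The polynomial factor makes the family stable under differentiation, through P |-> X^2 (P - P'),
    so that smoothness is an induction on the order. *)
Definition bump P t : R := if 0 < t then P.[t^-1] * expR (- t^-1) else 0.

Lemma is_derive_bump P t : is_derive t 1 (bump P) (bump ('X^2 * (P - P^`())) t).
Proof.
have [t0|t0|->] := ltrgtP t 0.
- rewrite /bump ltNge (ltW t0) /=.
  apply: near_eq_is_derive (is_derive_cst (0 : R) t (1 : R)).
  by near=> y; rewrite ifF//; apply/negbTE; rewrite -leNgt ltW//; near: y; exact: lt_nbhsl.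
- rewrite /bump t0.
  have tn0 : t != 0 by rewrite gt_eqF.
  have dV := is_deriveV tn0 (is_derive_id t (1 : R)).
  have dP := @is_derive1_comp R (horner P) (fun y => y^-1) t _ _ (is_derive_poly P t^-1) dV.
  have dE := @is_derive1_comp R expR (fun y => - y^-1) t _ _ (is_derive_expR (- t^-1)) (is_deriveN dV).
  have dM := is_deriveM dP dE.
  apply: (@is_derive_eq _ _ _ _ _ _ _ _ (near_eq_is_derive _ dM)).
    by near=> y; rewrite ifT//; near: y; exact: lt_nbhsr.
  rewrite /= /GRing.scale /= hornerM hornerXn hornerD hornerN; field => //.
- rewrite {2}/bump ltxx.
  (* The additional factor X^2 turns boundedness into |bump P h| <= C h^2, hence derivative 0 at the
     origin. *)
  have [C [C0 hC]] := poly_expRN_bounded ('X^2 * P).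
  apply: (@is_derive_quad _ _ _ C) => h.
  rewrite add0r mul0r subr0 {2}/bump ltxx subr0 /bump.
  case: ifPn => h0; last by rewrite normr0 mulr_ge0// sqr_ge0.
  have /ltW/hC : 0 < h^-1 by rewrite invr_gt0.
  rewrite hornerM hornerXn exprVn -mulrA normrM ger0_norm; last first.
    by rewrite invr_ge0 sqr_ge0.
  by rewrite ler_pdivrMl ?exprn_gt0// [C * _]mulrC.
Unshelve. all: by end_near. Qed.

Lemma smooth_bump P : smooth (bump P).
Proof.
have h n : exists Q, derive1n n (bump P) = bump Q.
  elim: n => [|n [Q ih]]; first by exists P; rewrite derive1n0.
  exists ('X^2 * (Q - Q^`())); rewrite derive1nS ih; apply/funext => x.
  by rewrite derive1E; apply: derive_val; exact: is_derive_bump.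
move=> n x; have [Q ->] := h n.
by have := is_derive_bump Q x => ?; exact: ex_derive.
Qed.

End Bump.

(** * Product rule for absolutely continuous functions *)

Section ProductRule.
Context {R : realType}.
Implicit Types (a b c k K C : R) (f g F G : R -> R).

Lemma prim_measurable a b f F : prim a b f F -> measurable_fun `]a, b[ F.
Proof.
have [ab|ba] := leP a b; last first.
  by move=> _; rewrite set_itv_ge ?bnd_simp -?leNgt ?(ltW ba)//; exact: measurable_fun_set0.
move=> /(prim_continuous ab) cF.
apply: (@measurable_funS _ _ _ _ `[a, b]%classic) => //; first exact: subset_itv_oo_cc.
exact: subspace_continuous_measurable_fun.
Qed.

Lemma prim_bound a b f F : prim a b f F ->
  exists2 K, 0 <= K & forall x, a <= x <= b -> `|F x| <= K.
Proof.
move=> pF; exists (`|F a| + Int a b (fun x => `|f x|)).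
  by rewrite addr_ge0// Int_ge0.
by move=> x; exact: prim_bounded.
Qed.

Lemma L1M_bounded a b K f g : L1 a b f -> measurable_fun `]a, b[ g ->
  (forall x, a < x < b -> `|g x| <= K) -> L1 a b (fun x => f x * g x).
Proof.
move=> lf mg gK; apply: (@le_L1 _ _ _ _ (fun x => K * `|f x|)).
- by apply: measurable_funM => //; exact: L1_meas.
- exact/L1Z/L1_norm.
- by move=> x xab; rewrite normrM mulrC ler_wpM2r// gK.
Qed.

Lemma L1M_prim a b f g G : L1 a b f -> prim a b g G -> L1 a b (fun x => f x * G x).
Proof.
move=> lf pG; have [K _ hK] := prim_bound pG.
apply: (L1M_bounded lf (prim_measurable pG) (K := K)) => x /andP[ax xb].
by apply: hK; rewrite !ltW.
Qed.

Lemma L1_of_prim a b f F : prim a b f F -> L1 a b F.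
Proof.
move=> pF; have [K _ hK] := prim_bound pF.
apply: (L1_bounded (prim_measurable pF) (k := K)) => x /andP[ax xb].
by apply: hK; rewrite !ltW.
Qed.

(* Subdividing [a, b] into N equal pieces bounds |H b - H a| by a multiple of 1/N. *)
Lemma eq_of_superlinear a b C (H T : R -> R) : a <= b ->
  (forall x y, a <= x -> x <= y -> y <= b -> `|H y - H x| <= C * (y - x) * (T y - T x)) ->
  H b = H a.
Proof.
move=> ab h; apply/eqP; rewrite -subr_eq0 -normr_le0; apply/ler_addgt0Pl => e e0.
rewrite addr0; set M := C * (b - a) * (T b - T a).
have [N hN] : exists N, M / N.+1%:R <= e.
  exists (Num.truncn (M / e)); rewrite ler_pdivrMr ?ltr0n// -ler_pdivrMl//.
  by rewrite mulrC ltW// truncnS_gt.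
apply: le_trans hN; pose d := (b - a) / N.+1%:R; pose x (k : nat) := a + k%:R * d.
have d0 : 0 <= d by rewrite divr_ge0// subr_ge0.
have xS (k : nat) : x k.+1 = x k + d by rewrite /x -natr1 mulrDl mul1r addrA.
have nn : N.+1%:R != 0 :> R by rewrite pnatr_eq0.
have xN : x N.+1 = b by rewrite /x /d mulrC divfK// addrC subrK.
have xb (k : nat) : (k <= N.+1)%N -> a <= x k <= b.
  move=> kN; rewrite -xN /x lerDl mulr_ge0//= lerD2l ler_wpM2r// ler_nat//.
have ind (k : nat) : (k <= N.+1)%N -> `|H (x k) - H a| <= C * d * (T (x k) - T a).
  elim: k => [_|k ih kN]; first by rewrite /x mul0r addr0 !subrr normr0 mulr0.
  have -> : H (x k.+1) - H a = (H (x k.+1) - H (x k)) + (H (x k) - H a) by ring.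
  rewrite (le_trans (ler_normD _ _))//.
  have /andP[h1 _] := xb k (ltnW kN); have /andP[_ h2] := xb _ kN.
  have h3 : x k <= x k.+1 by rewrite xS lerDl.
  have := lerD (h _ _ h1 h3 h2) (ih (ltnW kN)); move/le_trans; apply.
  by rewrite xS; lra.
have := ind _ (leqnn _); rewrite xN; congr (_ <= _); rewrite /M /d; ring.
Qed.

(** The defect H of the identity changes over [s, t] by at most 2 K (t - s) times the integral of
    |f|, a superlinear bound that forces H to be constant. This avoids Fubini and differentiation
    almost everywhere. The bound on g is harmless, because G will be a test function. *)
Lemma primM a b K f g F G : prim a b f F -> prim a b g G ->
  (forall x, a < x < b -> `|g x| <= K) ->
  prim a b (fun x => f x * G x + g x * F x) (fun x => F x * G x).
Proof.
move=> pF pG gK; have [lf hF] := pF; have [lg hG] := pG.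
have lfG := L1M_prim lf pG; have lgF := L1M_prim lg pF.
split=> [|x y ax xy yb]; first exact: L1D.
have xs : a <= x /\ y <= b by [].
pose T z := Int x z (fun t => `|f t|).
pose H z := F z * G z - Int x z (fun t => f t * G t + g t * F t).
suff : H y = H x by rewrite /H (@Int_ge _ x x)// subr0 => <-; ring.
have [->|xy'] := eqVneq x y; first by [].
have K0 : 0 <= K.
  by apply: le_trans (gK ((x + y) / 2) _); [exact: normr_ge0|lra].
apply: (@eq_of_superlinear x y (2 * K) H T xy) => s t xs1 st ty.
have as1 : a <= s by exact: le_trans xs1.
have tb : t <= b by exact: le_trans yb.
have sub e : L1 a b e -> L1 s t e by apply: L1_sub.
have l1 : L1 s t (fun z => f z * (G t - G z)).
  apply: (eq_L1 (f := fun z => G t * f z - f z * G z)); first by move=> z _; ring.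
  by apply: L1B; [apply: L1Z|]; exact: sub.
have l2 : L1 s t (fun z => g z * (F s - F z)).
  apply: (eq_L1 (f := fun z => F s * g z - g z * F z)); first by move=> z _; ring.
  by apply: L1B; [apply: L1Z|]; exact: sub.
have lsum := L1D lfG lgF.
have lxt : L1 x t (fun t => f t * G t + g t * F t) by apply: L1_sub lsum.
have -> : H t - H s = Int s t (fun z => f z * (G t - G z)) + Int s t (fun z => g z * (F s - F z)).
  rewrite /H (@Int_cat _ x t s)//.
  rewrite (@eq_Int _ _ _ (fun z => f z * (G t - G z)) (fun z => G t * f z - f z * G z)); last by move=> z _; ring.
  rewrite (@eq_Int _ _ _ (fun z => g z * (F s - F z)) (fun z => F s * g z - g z * F z)); last by move=> z _; ring.
  rewrite (IntB (L1Z (G t) (sub _ lf)) (sub _ lfG)) (IntB (L1Z (F s) (sub _ lg)) (sub _ lgF)).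
  rewrite (IntD (sub _ lfG) (sub _ lgF)) (IntZ (G t) (sub _ lf)) (IntZ (F s) (sub _ lg)).
  by rewrite -hF// -hG//; ring.
have -> : T t - T s = Int s t (fun z => `|f z|).
  by rewrite /T (@Int_cat _ x t s)//; [ring|apply: L1_norm; apply: L1_sub lf].
set I := Int s t (fun z => `|f z|); have lfn : L1 s t (fun z => `|f z|) by exact/L1_norm/sub.
have I0 : 0 <= I by exact: Int_ge0.
have dG z w : s <= z -> z <= w -> w <= t -> `|G w - G z| <= K * (t - s).
  move=> sz zw wt; have lzw : L1 z w g by apply: L1_sub (sub _ lg).
  rewrite hG//; [|exact: le_trans sz|exact: le_trans tb].
  rewrite (le_trans (normr_Int lzw))//; apply: (@le_trans _ _ (Int z w (fun=> K))).
    apply: le_Int; [exact: L1_norm|exact: L1_cst|] => r /andP[zr rw]; apply: gK.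
    by rewrite (le_lt_trans _ zr) ?(lt_le_trans rw)//; [exact: le_trans tb|exact: le_trans sz].
  by rewrite Int_cst// ler_wpM2l// lerB.
have dF z : s <= z -> z <= t -> `|F s - F z| <= I.
  move=> sz zt; have lsz : L1 s z f by apply: L1_sub (sub _ lf).
  rewrite distrC hF//; last exact: le_trans tb.
  rewrite (le_trans (normr_Int lsz))// /I (@Int_cat _ s t z)// lerDl.
  exact: Int_ge0.
have b1 : `|Int s t (fun z => f z * (G t - G z))| <= K * (t - s) * I.
  rewrite (le_trans (normr_Int l1))// /I -IntZ//; apply: le_Int; [exact: L1_norm|exact: L1Z|].
  move=> z /andP[sz zt]; rewrite normrM mulrC ler_wpM2r//; apply: dG => //; exact: ltW.
have b2 : `|Int s t (fun z => g z * (F s - F z))| <= K * I * (t - s).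
  rewrite (le_trans (normr_Int l2))//; apply: (@le_trans _ _ (Int s t (fun=> K * I))).
    apply: le_Int; [exact: L1_norm|exact: L1_cst|].
    move=> z /andP[sz zt]; rewrite normrM ler_pM//.
      by apply: gK; rewrite (le_lt_trans as1 sz) (lt_le_trans zt tb).
    by apply: dF; exact: ltW.
  by rewrite Int_cst.
rewrite (le_trans (ler_normD _ _))// (le_trans (lerD b1 b2))//.
by rewrite le_eqVlt; apply/orP; left; apply/eqP; ring.
Qed.

End ProductRule.

(** * The du Bois-Reymond lemma and the description of W^{2,p} by primitives *)

Section DuBoisReymond.
Context {R : realType}.
Notation mu := (@lebesgue_measure R).
Implicit Types (a b c d r k K C : R) (f g F G : R -> R).

Lemma Int_dct a b (fn : nat -> R -> R) f g :
  (forall n, measurable_fun `]a, b[ (fn n)) -> measurable_fun `]a, b[ f ->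
  L1 a b g -> (forall n x, a < x < b -> `|fn n x| <= g x) ->
  (forall x, a < x < b -> fn n x @[n --> \oo] --> f x) ->
  Int a b (fn n) @[n --> \oo] --> Int a b f.
Proof.
move=> mfn mf lg fg cvf.
have [] := @dominated_convergence _ _ R mu `]a, b[%classic _ (fun n => EFin \o fn n) (EFin \o f) (EFin \o g).
- by [].
- by move=> n; apply/measurable_EFinP; exact: mfn.
- by apply/measurable_EFinP; exact: mf.
- apply: aeW => x /=; rewrite in_itv/= => /cvf h.
  by apply: cvg_EFin h; near=> n.
- exact: lg.
- by apply: aeW => x n /=; rewrite in_itv/= => /(fg n) h; rewrite lee_fin.
move=> lf _.
have -> : (\int[mu]_(x in `]a, b[) (EFin \o f) x)%E = (Int a b f)%:E by exact: Int_EFin.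
by move=> /fine_cvg.
Unshelve. all: by end_near. Qed.

Lemma Int_vanish a b f : (forall t, a < t < b -> f t = 0) -> L1 a b f /\ Int a b f = 0.
Proof.
move=> h; split; first by apply: (eq_L1 (f := fun=> 0)) (L1_cst _ _ _) => t /h.
have [xy|yx] := leP a b; last by rewrite Int_ge// ltW.
by rewrite (@eq_Int _ _ _ _ (fun=> 0))// Int_cst// mul0r.
Qed.

Lemma L1_patch a b c d f : c <= d -> L1 c d f ->
  L1 a b (fun x => if c < x < d then f x else 0).
Proof.
move=> cd lf; set g := fun x => _.
have e : forall x, c < x < d -> f x = g x by move=> x xcd; rewrite /g xcd.
apply: (@L1_sub _ (Num.min a c) (Num.max b d)); rewrite ?ge_min ?le_max ?lexx//.
apply: (@L1_cat _ _ _ c).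
  by apply: (Int_vanish _).1 => t /andP[_ tc]; rewrite /g ltNge (ltW tc).
apply: (@L1_cat _ _ _ d); first exact: (eq_L1 e).
by apply: (Int_vanish _).1 => t /andP[dt _]; rewrite /g [t < d]ltNge (ltW dt) andbF.
Qed.

Lemma Int_patch a b c d f : a <= c -> c <= d -> d <= b -> L1 c d f ->
  Int a b (fun x => if c < x < d then f x else 0) = Int c d f.
Proof.
move=> ac cd db lf; have lg := L1_patch a b cd lf; set g := fun x => _.
rewrite (@Int_cat _ a b d) ?(le_trans ac)// (@Int_cat _ a d c)//; last exact: L1_sub lg.
rewrite (Int_vanish _).2; last by move=> t /andP[_ tc]; rewrite /g ltNge (ltW tc).
rewrite [X in _ + X](Int_vanish _).2; last first.
  by move=> t /andP[dt _]; rewrite /g [t < d]ltNge (ltW dt) andbF.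
by rewrite add0r addr0; apply: eq_Int => x xcd; rewrite /g xcd.
Qed.

Lemma test_fun_prim a b phi lo hi : test_fun a b phi ->
  prim lo hi (derive1 phi) phi /\ prim lo hi (derive1 (derive1 phi)) (derive1 phi).
Proof.
move=> [sp _]; have sp' : smooth (derive1 phi) by exact: smooth_derive1.
split; apply: prim_C1 => //.
- by move=> x; exact: smooth_derivable.
- exact: smooth_continuous.
- by move=> x; exact: smooth_derivable.
- exact/smooth_continuous/smooth_derive1.
Qed.

Lemma test_fun_derive1 a b phi : test_fun a b phi -> test_fun a b (derive1 phi).
Proof.
move=> [sp [c [d [ac [cd [db phi0]]]]]]; split; first exact: smooth_derive1.
exists c, d; do 3 split => //; move=> x xcd.
suff h : is_derive x (1 : R) phi 0 by rewrite derive1E; exact: derive_val.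
apply: near_eq_is_derive (is_derive_cst (0 : R) x (1 : R)).
case: xcd => h; near=> y; rewrite phi0//; [left|right];
  near: y; [exact: lt_nbhsl|exact: lt_nbhsr].
Unshelve. all: by end_near. Qed.

Lemma test_fun_ends a b phi : test_fun a b phi -> phi a = 0 /\ phi b = 0.
Proof.
by move=> [sp [c [d [ac [cd [db phi0]]]]]]; split; apply: phi0; [left|right].
Qed.

Lemma prim_test a b phi f F : a <= b -> prim a b f F -> test_fun a b phi ->
  Int a b (fun x => F x * derive1 phi x) = - Int a b (fun x => f x * phi x).
Proof.
move=> ab pF tp; have [p1 p2] := test_fun_prim a b tp.
have [K _ hK] := prim_bound p2.
have [|lM hM] := @primM R a b K _ _ _ _ pF p1.
  by move=> x /andP[ax xb]; apply: hK; rewrite !ltW.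
have [fa fb] := test_fun_ends tp.
have := hM a b (lexx a) ab (lexx b); rewrite fa fb !mulr0 subr0 IntD; first last.
- apply: (eq_L1 (f := fun x => F x * derive1 phi x)); first by move=> x _; exact: mulrC.
  by apply: L1M_prim p2; exact: L1_of_prim pF.
- by apply: L1M_prim p1; exact: prim_L1 pF.
move=> /esym/eqP; rewrite addrC addr_eq0 => /eqP <-.
by apply: eq_Int => x _; exact: mulrC.
Qed.

(** A smooth approximation of the indicator of ]c, c + r[: two flat functions rising from c and
    falling to c + r, each steepened by n + 1. It vanishes outside the interval for every n and
    tends to 1 inside. *)
Definition window c r (n : nat) (x : R) : R :=
  bump 1 (n.+1%:R * x + - (n.+1%:R * c)) * bump 1 (- n.+1%:R * x + n.+1%:R * (c + r)).

Lemma smooth_window c r n : smooth (window c r n).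
Proof.
have := @smoothM _ (fun x => bump 1 (n.+1%:R * x + - (n.+1%:R * c)))
  (fun x => bump 1 (- n.+1%:R * x + n.+1%:R * (c + r))).
by apply; apply: smooth_affine; exact: smooth_bump.
Qed.

Lemma bump1_ge0_le1 (t : R) : 0 <= bump 1 t <= 1.
Proof.
rewrite /bump; case: ifPn => [t0|_]; last by rewrite lexx ler01.
by rewrite hornerC mul1r expR_ge0/= -expR0 ler_expR oppr_le0 invr_ge0 ltW.
Qed.

Lemma window_norm c r n x : `|window c r n x| <= 1.
Proof.
rewrite /window normrM; have /andP[a0 a1] := bump1_ge0_le1 (n.+1%:R * x + - (n.+1%:R * c)).
have /andP[b0 b1] := bump1_ge0_le1 (- n.+1%:R * x + n.+1%:R * (c + r)).
by rewrite !ger0_norm// -[leRHS]mulr1 ler_pM.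
Qed.

Lemma window_out c r n x : ~~ (c < x < c + r) -> window c r n x = 0.
Proof.
rewrite negb_and -!leNgt => /orP[xc|cx]; rewrite /window /bump.
  rewrite (_ : 0 < _ = false) ?mul0r// -mulrBr pmulr_rgt0// subr_gt0.
  by apply/negbTE; rewrite -leNgt.
rewrite (_ : 0 < - n.+1%:R * x + _ = false) ?mulr0// mulNr addrC -mulrBr pmulr_rgt0// subr_gt0.
by apply/negbTE; rewrite -leNgt.
Qed.

Lemma window_translate c d r n x : window d r n (1 * x + (d - c)) = window c r n x.
Proof. by rewrite /window; congr (bump _ _ * bump _ _); ring. Qed.

Lemma bump1_cvg (s : R) : 0 < s -> bump 1 (n.+1%:R * s) @[n --> \oo] --> (1 : R).
Proof.
move=> s0; suff : bump 1 (n.+1%:R * s) @[n --> \oo] --> expR (- 0 : R).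
  by rewrite oppr0 expR0.
rewrite (_ : (fun n => _) = (fun n => expR (- (s^-1 * n.+1%:R^-1)))).
  apply: continuous_cvg; first exact: continuous_expR.
  apply: cvgN; rewrite -(mulr0 s^-1); apply: cvgMr.
  exact: cvg_harmonic.
apply/funext => n; rewrite /bump pmulr_rgt0 ?ltr0n// s0 hornerC mul1r.
by rewrite invfM [_ / s]mulrC.
Qed.

Lemma window_cvg c r x : c < x < c + r -> window c r n x @[n --> \oo] --> (1 : R).
Proof.
move=> /andP[cx xc]; rewrite -[X in _ --> X]mulr1; apply: cvgM.
  rewrite (_ : (fun n => _) = (fun n => bump 1 (n.+1%:R * (x - c)))).
    by apply: bump1_cvg; rewrite subr_gt0.
  by apply/funext => n; rewrite mulrBr.
rewrite (_ : (fun n => _) = (fun n => bump 1 (n.+1%:R * (c + r - x)))).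
  by apply: bump1_cvg; rewrite subr_gt0.
by apply/funext => n; congr bump; ring.
Qed.

(** [Int a y psi] is 0 for y <= a, which in general creates a kink at a. Vanishing of psi up to a
    point m beyond a removes it, so the primitive is differentiable on the whole line, as [test_fun]
    requires. *)
Lemma is_derive_Int a m psi x : a < m -> continuous psi -> (forall x, x < m -> psi x = 0) ->
  is_derive x (1 : R) (fun y => Int a y psi) (psi x).
Proof.
move=> am cp p0; have lp y z : L1 y z psi by apply: continuous_L1; exact: continuous_subspaceT.
have [ax|xa] := ltP a x.
  have := @prim_derive _ a (x + 1) _ _ x (prim_self 0 (lp a (x + 1))).
  rewrite (_ : (fun x0 => 0 + _) = (fun y => Int a y psi)); last first.
    by apply/funext => y; rewrite add0r.
  by rewrite ax ltrDl ltr01 => /(_ isT (cp x)) [d1 <-]; exact: is_derive_derive1.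
have xm := le_lt_trans xa am; rewrite p0//.
apply: near_eq_is_derive (is_derive_cst (0 : R) x (1 : R)).
near=> y; have ym : y < m by near: y; exact: lt_nbhsl.
have [ya|ay] := leP y a; first by rewrite Int_ge.
rewrite (@eq_Int _ _ _ _ (fun=> 0)) ?Int_cst ?mul0r// ?(ltW ay)//.
by move=> t /andP[_ ty]; rewrite p0// (lt_trans ty).
Unshelve. all: by end_near. Qed.

(** The two windows are translates, so they have equal mass and the primitive of their difference
    returns to 0 beyond both: it is compactly supported in ]a, b[. Steepening the windows by
    dominated convergence, with |h| as the majorant, replaces them by indicators. *)
Lemma cancel_window a b h c d r : a < c -> c + r < b -> a < d -> d + r < b -> 0 < r ->
  L1 a b h ->
  (forall phi, test_fun a b phi -> Int a b (fun x => h x * derive1 phi x) = 0) ->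
  Int c (c + r) h = Int d (d + r) h.
Proof.
move=> ac cb ad db r0 lh hz.
have cr : c <= c + r by rewrite lerDl ltW.
have dr : d <= d + r by rewrite lerDl ltW.
have cw e n : continuous (window e r n) by exact/smooth_continuous/smooth_window.
have lw e n x y : L1 x y (window e r n) by apply: continuous_L1; exact: continuous_subspaceT.
have mw e n : measurable_fun `]a, b[ (window e r n).
  exact: L1_meas.
have lhw e n : L1 a b (fun x => h x * window e r n x).
  by apply: (L1M_bounded lh (mw e n)) => x _; exact: window_norm.
pose psi n x := window c r n x - window d r n x.
have spsi n : smooth (psi n) by apply: smoothB; exact: smooth_window.
have [m [am mc md]] : exists m, [/\ a < m, m <= c & m <= d].
  by exists (Num.min c d); split; [rewrite lt_min ac|rewrite ge_min lexx|rewrite ge_min lexx orbT].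
have p0 n x : x < m -> psi n x = 0.
  by move=> xm; rewrite /psi !window_out ?subrr// negb_and -!leNgt (le_trans (ltW xm)).
have dpsi n x : is_derive x (1 : R) (fun y => Int a y (psi n)) (psi n x).
  by apply: (is_derive_Int x am) => [|y /p0->//]; exact: smooth_continuous.
have ztest n : test_fun a b (fun x => Int a x (psi n)).
  have [M [Mb cM dM]] : exists M, [/\ M < b, c + r <= M & d + r <= M].
    by exists (Num.max (c + r) (d + r)); split; [rewrite gt_max cb|rewrite le_max lexx|rewrite le_max lexx orbT].
  split; first exact: (smoothS (dpsi n)).
  exists m, M; split => //; split; first by rewrite (le_trans mc)// (le_trans cr).
  split => // x [xm|Mx].
    have [xa|ax] := leP x a; first by rewrite Int_ge.
    rewrite (@eq_Int _ _ _ _ (fun=> 0)) ?Int_cst ?mul0r ?(ltW ax)//.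
    by move=> t /andP[_ tx]; rewrite p0// (lt_trans tx).
  have tail e : a < e -> e + r <= M -> Int a x (window e r n) = Int e (e + r) (window e r n).
    move=> ae eM; have xer := le_lt_trans eM Mx.
    rewrite -(@Int_patch a x e (e + r)) ?ltW// ?ltrDl//.
    by apply: eq_Int => t _; case: ifPn => // h'; rewrite window_out.
  rewrite IntB// !tail//.
  have := @Int_affine _ 1 (d - c) c (c + r) (window d r n) ltr01.
  rewrite (_ : 1 * c + (d - c) = d); last by ring.
  rewrite (_ : 1 * (c + r) + (d - c) = d + r); last by ring.
  move=> -> //; rewrite mul1r; apply/eqP; rewrite subr_eq0; apply/eqP.
  by apply: eq_Int => t _; rewrite window_translate.
have eqw n : Int a b (fun x => h x * window c r n x) = Int a b (fun x => h x * window d r n x).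
  apply/eqP; rewrite -subr_eq0 -IntB//; apply/eqP; rewrite -[RHS](hz _ (ztest n)).
  apply: eq_Int => x _; rewrite -mulrBr; congr (_ * _).
  by rewrite derive1E; have ? := dpsi n x; rewrite derive_val.
have lim e : a < e -> e + r < b ->
    Int a b (fun x => h x * window e r n x) @[n --> \oo] --> Int e (e + r) h.
  move=> ae eb; have er : e <= e + r by rewrite lerDl ltW.
  have lhe : L1 e (e + r) h by apply: L1_sub lh; exact: ltW.
  rewrite -(@Int_patch a b e (e + r)) ?(ltW ae) ?(ltW eb)//.
  apply: (@Int_dct a b _ _ (fun x => `|h x|)).
  - by move=> n; apply: measurable_funM => //; exact: L1_meas.
  - by apply: L1_meas; exact: (L1_patch a b er lhe).
  - exact: L1_norm.
  - by move=> n x _; rewrite normrM ler_piMr// window_norm.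
  - move=> x _; case: ifPn => [xe|xe].
      by rewrite -[X in _ --> X]mulr1; apply: cvgMr; exact: window_cvg.
    rewrite (_ : (fun n => _) = (fun=> 0)); first exact: cvg_cst.
    by apply/funext => n; rewrite window_out// mulr0.
have l1 := lim c ac cb; have l2 := lim d ad db.
rewrite (_ : (fun n => _) = (fun n => Int a b (fun x => h x * window d r n x))) in l1.
  exact: cvg_unique l1 l2.
by apply/funext => n.
Qed.

(* The difference of two windows of the same width r is the derivative of a test
   function, so h has equal averages over all intervals of length r; let r tend to 0. *)
Lemma constant_of_weak_derivative0 a b h : L1 a b h ->
  (forall phi, test_fun a b phi -> Int a b (fun x => h x * derive1 phi x) = 0) ->
  exists k, ae_on a b (fun x => h x = k).
Proof.
move=> lh hz; pose hp := h \_ `]a, b[.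
have lhp : mu.-integrable setT (EFin \o hp).
  by move: lh; rewrite /L1 integrable_mkcond//= restrict_EFin.
have lhpy y : mu.-integrable [set` Interval (BRight a) (BRight y)] (EFin \o hp).
  by apply: integrableS lhp.
have hpE x : a < x < b -> hp x = h x.
  by move=> xab; rewrite /hp patchE mem_set//= in_itv.
have := FTC1 lhpy (integrable_locally (measurable_itv _) lh).
set G := fun x => \int[mu]_(t in [set` Interval _ (BRight x)]) hp t.
move=> good.
pose P x := a < x < b /\ derivable G x 1 /\ derive1 G x = hp x.
have PG x : P x -> (r^-1 * Int x (x + r) h) @[r --> (0:R)^'+] --> h x.
  move=> [xab [dG G']]; have [ax xb] := andP xab.
  move: G'; rewrite hpE// derive1E => G'.
  have cv : r^-1 * (G (r + x) - G x) @[r --> (0:R)^'] --> h x.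
    rewrite -G'; move/cvg_ex : (dG) => [l hl]; rewrite /derive (cvg_lim _ hl)//.
    rewrite (_ : (fun r => _) = (fun h => h^-1 *: ((G \o shift x) (h *: (1 : R)) - G x)))//.
    by apply/funext => r; rewrite /= /GRing.scale /= mulr1.
  have cv' : r^-1 * (G (r + x) - G x) @[r --> (0:R)^'+] --> h x.
    exact: cvg_dnbhs_at_right cv.
  apply: cvg_trans cv'; apply: near_eq_cvg; near=> r; congr (_ * _).
  have r0 : 0 < r by near: r; exact: nbhs_right_gt.
  have xr : r + x < b by rewrite -ltrBrDr; near: r; apply: nbhs_right_lt; rewrite subr_gt0.
  have lhx y : y < b -> L1 a y h by move=> yb; apply: L1_sub lh => //; exact: ltW.
  have GE y : a < y -> y < b -> G y = Int a y h.
    move=> ay yb; rewrite /G /Int Rintegral_itv_bndo_bndc; last exact: lhx.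
    apply: eq_Rintegral => t; rewrite inE /= in_itv/= => /andP[at' ty].
    by rewrite hpE// at' (le_lt_trans ty).
  rewrite !GE// ?(lt_trans ax) ?ltrDr// addrC [r + x]addrC.
  rewrite (@Int_cat _ a (x + r) x) ?(ltW ax) ?lerDl ?(ltW r0)//; first by ring.
  by apply: lhx; rewrite addrC.
have PP x y : P x -> P y -> h x = h y.
  move=> Px Py; have lx := PG x Px; have ly := PG y Py.
  have [[/andP[ax xb] _] [/andP[ay yb] _]] := (Px, Py).
  apply: (cvg_unique _ lx); first exact: Rhausdorff.
  apply: cvg_trans ly; apply: near_eq_cvg; near=> r; congr (_ * _).
  have r0 : 0 < r by near: r; exact: nbhs_right_gt.
  apply: (@cancel_window a b) => //.
  - by rewrite addrC -ltrBrDr; near: r; apply: nbhs_right_lt; rewrite subr_gt0.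
  - by rewrite addrC -ltrBrDr; near: r; apply: nbhs_right_lt; rewrite subr_gt0.
have [[x0 Px0]|noP] := pselect (exists x, P x).
  exists (h x0); move: good; apply: filterS; first exact: (ae_filter_ringOfSetsType mu).
  move=> x /= Hx; rewrite in_itv/= => xab; apply: (PP _ _ _ Px0); split => //.
  by have [|] := Hx; [rewrite lte_fin; case/andP: xab|].
(* Almost every point of ]a, b[ satisfies P, so when P is empty the claim is vacuous and any
   constant serves. *)
exists 0; move: good; apply: filterS; first exact: (ae_filter_ringOfSetsType mu).
move=> x /= Hx; rewrite in_itv/= => xab; exfalso; apply: noP; exists x; split => //.
by have [|] := Hx; [rewrite lte_fin; case/andP: xab|].
Unshelve. all: by end_near. Qed.

(** f minus a primitive of g has weak derivative 0, hence is constant almost everywhere; the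
    constant is absorbed into the primitive. *)
Lemma prim_of_weak_derivative a b f g : a <= b -> L1 a b f -> L1 a b g ->
  (forall phi, test_fun a b phi ->
    Int a b (fun x => f x * derive1 phi x) = - Int a b (fun x => g x * phi x)) ->
  exists F, prim a b g F /\ ae_on a b (fun x => f x = F x).
Proof.
move=> ab lf lg h; have pG := prim_self 0 lg; set G := (fun x => _) in pG.
have lG := L1_of_prim pG.
have [|phi tp|k hk] := @constant_of_weak_derivative0 a b (fun x => f x - G x).
- exact: L1B.
- have [p1 p2] := test_fun_prim a b tp.
  rewrite (@eq_Int _ _ _ _ (fun x => f x * derive1 phi x - G x * derive1 phi x)); last first.
    by move=> x _; rewrite mulrBl.
  rewrite IntB ?h ?(prim_test ab pG tp) ?subrr//; exact: L1M_prim p2.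
exists (fun x => k + Int a x g); split; first exact: prim_self.
move: hk; rewrite /ae_on; apply: filterS; first exact: (ae_filter_ringOfSetsType mu).
by move=> x /= hx xab; rewrite -(hx xab) /G add0r subrK.
Qed.

Lemma inLp_L1 a b p f : 1 <= p -> inLp a b p f -> L1 a b f.
Proof.
move=> p1 [mf fp].
have l1 : L1 a b (fun x => `|f x| `^ p).
  apply: L1_ge0 => //; first by apply: (measurableT_comp (measurable_powR p)); exact: measurableT_comp.
apply: (@le_L1 _ _ _ _ (fun x => 1 + `|f x| `^ p)) => //; first by apply: L1D => //; exact: L1_cst.
move=> x _; have [f1|f1] := leP `|f x| 1.
  by rewrite (le_trans f1)// lerDl powR_ge0.
rewrite (@le_trans _ _ (`|f x| `^ p))// ?lerDr//.
by rewrite -[leLHS]powRr1// ler_powR// ltW.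
Qed.

Lemma inLp_bounded a b p K f : 1 <= p -> measurable_fun `]a, b[ f ->
  (forall x, a < x < b -> `|f x| <= K) -> inLp a b p f.
Proof.
move=> p1 mf fK; split => //.
have l1 : L1 a b (fun x => `|f x| `^ p).
  apply: (@L1_bounded _ _ _ _ (K `^ p)).
    by apply: (measurableT_comp (measurable_powR p)); exact: measurableT_comp.
  move=> x xab; rewrite ger0_norm ?powR_ge0// ge0_ler_powR ?nnegrE//.
  - exact: le_trans p1.
  - exact: le_trans (fK _ xab).
  - exact: fK.
by rewrite Int_EFin// ltry.
Qed.

(** [W2p_with] links g2 to u only, through second derivatives of test functions. Since phi' is again
    a test function, the first-order identity for u turns this into the statement that g2 is the
    weak derivative of g1, and the first-order lemma applies twice. *)
Lemma W2p_prim a b p u g1 g2 : a <= b -> 1 <= p -> W2p_with a b p u g1 g2 ->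
  exists U V, [/\ prim a b V U, prim a b g2 V, ae_on a b (fun x => u x = U x) &
    ae_on a b (fun x => g1 x = V x)].
Proof.
move=> ab p1 [/(inLp_L1 p1) lu [/(inLp_L1 p1) l1 [/(inLp_L1 p1) l2 h]]].
have w1 phi : test_fun a b phi ->
    Int a b (fun x => u x * derive1 phi x) = - Int a b (fun x => g1 x * phi x).
  move=> tp; have [+ _] := h phi tp; have [q1 q2] := test_fun_prim a b tp.
  rewrite derive1n1 Int_EFin; last exact: L1M_prim q2.
  rewrite Int_EFin; last exact: L1M_prim q1.
  by move=> e; apply: EFin_inj; rewrite EFinN; exact: e.
have w2 phi : test_fun a b phi ->
    Int a b (fun x => g1 x * derive1 phi x) = - Int a b (fun x => g2 x * phi x).
  move=> tp; have [_ +] := h phi tp; have [q1 q2] := test_fun_prim a b tp.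
  have tp' := test_fun_derive1 tp; have [q3 q4] := test_fun_prim a b tp'.
  rewrite derive1nS derive1n1 Int_EFin; last exact: L1M_prim q4.
  rewrite Int_EFin; last exact: L1M_prim q1.
  move=> e; have <- : Int a b (fun x => u x * derive1 (derive1 phi) x) = Int a b (fun x => g2 x * phi x).
    by apply: EFin_inj; exact: e.
  by rewrite w1// opprK.
have [V [pV aeV]] := prim_of_weak_derivative ab l1 l2 w2.
have [U [pU aeU]] := prim_of_weak_derivative ab lu l1 w1.
exists U, V; split => //.
have lV := L1_of_prim pV; split => // x y ax xy yb.
have [_ hU] := pU; rewrite hU//.
have ly : forall f, L1 a b f -> L1 x y f by move=> f; exact: L1_sub.
apply: Int_ae; [exact: L1_meas (ly _ l1)|exact: L1_meas (ly _ lV)|].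
move: aeV; rewrite /ae_on; apply: filterS; first exact: (ae_filter_ringOfSetsType mu).
move=> z /= hz; rewrite in_itv/= => /andP[xz zy]; apply: hz; rewrite in_itv/=.
by rewrite (le_lt_trans ax) ?(lt_le_trans zy).
Qed.

Lemma prim_W2p a b p U V g : a <= b -> 1 <= p -> prim a b V U -> prim a b g V ->
  inLp a b p g -> W2p_with a b p U V g.
Proof.
move=> ab p1 pU pV Lg.
have bd F f : prim a b f F -> inLp a b p F.
  move=> pF; have [K _ hK] := prim_bound pF.
  apply: (inLp_bounded (K := K)) => //; first exact: prim_measurable pF.
  by move=> x /andP[ax xb]; apply: hK; rewrite !ltW.
split; first exact: bd pU.
split; first exact: bd pV.
split => // phi tp.
have tp' := test_fun_derive1 tp.
have [q1 q2] := test_fun_prim a b tp; have [q3 q4] := test_fun_prim a b tp'.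
have lU := L1_of_prim pU; have lV := L1_of_prim pV; have lg := prim_L1 pV.
rewrite -[derive1n 1 phi]/(derive1 phi) -[derive1n 2 phi]/(derive1 (derive1 phi)).
rewrite (Int_EFin (L1M_prim lU q2)) (Int_EFin (L1M_prim lV q1)).
rewrite (Int_EFin (L1M_prim lU q4)) (Int_EFin (L1M_prim lg q1)).
by rewrite (prim_test ab pU tp) (prim_test ab pU tp') (prim_test ab pV tp) opprK.
Qed.

End DuBoisReymond.

(** * Cells of length eps with small energy *)

Section Cell.
Context {R : realType}.
Implicit Types (a b c d x y z e eps tau : R) (f g F G U V : R -> R).

Definition dens eps U g x : R := eps^-1 * (U x ^+ 2 - 1) ^+ 2 + eps ^+ 3 * g x ^+ 2.

Lemma dens_ge0 eps U g x : 0 < eps -> 0 <= dens eps U g x.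
Proof.
move=> e0; rewrite addr_ge0// mulr_ge0 ?sqr_ge0// ?exprn_ge0 ?invr_ge0 ?ltW//.
Qed.

Lemma le_Int_sub a b c d f : a <= c -> d <= b -> L1 a b f ->
  (forall x, a < x < b -> 0 <= f x) -> Int c d f <= Int a b f.
Proof.
move=> ac db lf f0; have [dc|cd] := leP d c; first by rewrite Int_ge// Int_ge0.
have ad : a <= d by rewrite (le_trans ac)// ltW.
rewrite [leRHS](@Int_cat _ a b d)// (@Int_cat _ a d c) ?(ltW cd)//; last exact: L1_sub lf.
have h1 : 0 <= Int a c f.
  by apply: Int_ge0 => x /andP[ax xc]; apply: f0; rewrite ax (lt_le_trans xc)// (le_trans (ltW cd)).
have h2 : 0 <= Int d b f.
  by apply: Int_ge0 => x /andP[dx xb]; apply: f0; rewrite xb (le_lt_trans ad).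
lra.
Qed.

Lemma Int_cst_le a b k f : a <= b -> L1 a b f -> (forall x, a < x < b -> k <= f x) ->
  k * (b - a) <= Int a b f.
Proof. by move=> ab lf kf; rewrite -Int_cst//; apply: le_Int => //; exact: L1_cst. Qed.

Lemma Int_le_cst a b k f : a <= b -> L1 a b f -> (forall x, a < x < b -> f x <= k) ->
  Int a b f <= k * (b - a).
Proof. by move=> ab lf kf; rewrite -Int_cst//; apply: le_Int => //; exact: L1_cst. Qed.

Lemma prim_osc a b k f F x y : prim a b f F -> a <= x <= b -> a <= y <= b ->
  (forall t, a < t < b -> `|f t| <= k) -> `|F y - F x| <= k * `|y - x|.
Proof.
move=> [lf h]; wlog xy : x y / x <= y => [hw xab yab fk|].
  have [|/ltW yx] := leP x y; first by move=> xy; apply: hw.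
  by rewrite distrC [`|y - x|]distrC; apply: hw.
move=> /andP[ax xb] /andP[ay yb] fk; rewrite h// [`|y - x|]ger0_norm ?subr_ge0//.
have lxy : L1 x y f by apply: L1_sub lf.
rewrite (le_trans (normr_Int lxy))// Int_le_cst//; first exact: L1_norm.
by move=> t /andP[xt ty]; apply: fk; rewrite (le_lt_trans ax xt) (lt_le_trans ty yb).
Qed.

(** Pointwise Young inequality from (eps^2 |g| - tau)^2 >= 0. On an interval of length eps with
    energy at most tau^2 it bounds the oscillation of the scaled slope eps U' by tau. *)
Lemma Int_norm_dens eps tau x y U g : 0 < eps -> 0 < tau -> x <= y ->
  L1 x y g -> L1 x y (dens eps U g) ->
  2 * eps * Int x y (fun t => `|g t|) <=
    Int x y (dens eps U g) / tau + tau * ((y - x) / eps).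
Proof.
move=> eps0 t0 xy lg ld; set E := Int x y (dens _ _ _).
rewrite -IntZ; last exact: L1_norm.
have -> : E / tau + tau * ((y - x) / eps) =
    Int x y (fun t => tau^-1 * dens eps U g t + tau / eps).
  rewrite IntD; [|exact: L1Z|exact: L1_cst].
  by rewrite Int_cst// IntZ// -/E; field; rewrite !gt_eqF.
apply: le_Int; first exact/L1Z/L1_norm.
  by apply: L1D; [exact: L1Z|exact: L1_cst].
move=> t _; rewrite /dens.
have h1 : 0 <= tau^-1 * (eps^-1 * (U t ^+ 2 - 1) ^+ 2).
  by rewrite mulr_ge0 ?invr_ge0 ?(ltW t0)// mulr_ge0 ?sqr_ge0// invr_ge0 ltW.
rewrite mulrDr -addrA; apply: ler_wpDl => //.
have -> : g t ^+ 2 = `|g t| ^+ 2 by rewrite real_normK ?num_real.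
rewrite -subr_ge0.
have -> : tau^-1 * (eps ^+ 3 * `|g t| ^+ 2) + tau / eps - 2 * eps * `|g t| =
  (tau * eps)^-1 * (eps ^+ 2 * `|g t| - tau) ^+ 2.
  by field; rewrite !gt_eqF.
by rewrite mulr_ge0 ?sqr_ge0// invr_ge0 mulr_ge0 ?ltW.
Qed.

(** In u^2 - 1 = (u - 1)(u + 1) the factor of the farther well is at least 1 in absolute value. *)
Lemma sqr_sub1_near (u m : R) : (u ^+ 2 - 1) ^+ 2 <= m ^+ 2 -> 0 <= m ->
  exists2 s : R, s = 1 \/ s = -1 & `|u - s| <= m.
Proof.
move=> h m0; have h2 : `|u ^+ 2 - 1| <= m.
  by rewrite -(ler_pXn2r (n := 2))// ?nnegrE// real_normK ?num_real.
have e : u ^+ 2 - 1 = (u - 1) * (u + 1) by ring.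
rewrite e normrM in h2; have [u0|u0] := leP 0 u.
  exists 1; [by left|]; apply: le_trans h2; rewrite ler_peMr// ler_normr; apply/orP; left; lra.
exists (-1); [by right|]; rewrite opprK; apply: le_trans h2; rewrite ler_peMl// ler_normr; apply/orP; right; lra.
Qed.

Lemma pigeonhole3 (s1 s2 s3 : R) :
  s1 = 1 \/ s1 = -1 -> s2 = 1 \/ s2 = -1 -> s3 = 1 \/ s3 = -1 ->
  [\/ s1 = s2, s1 = s3 | s2 = s3].
Proof.
move=> [->|->] [->|->] [->|->]; by [constructor 1|constructor 2|constructor 3].
Qed.

(* Three well separated points where U is close to 1 or -1: two of them share the
   sign, which makes V small, hence U almost constant. *)
Lemma low_energy_cell eps tau x U V g : 0 < eps -> 0 < tau ->
  prim x (x + eps) V U -> prim x (x + eps) g V -> L1 x (x + eps) (dens eps U g) ->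
  Int x (x + eps) (dens eps U g) <= tau ^+ 2 ->
  exists2 s : R, s = 1 \/ s = -1 & forall z, x <= z <= x + eps ->
    `|U z - s| <= 32 * tau /\ eps * `|V z| <= 32 * tau.
Proof.
move=> e0 t0 pU pV ld hE.
have xe : x <= x + eps by rewrite lerDl ltW.
have xx : x <= x <= x + eps by rewrite lexx.
have lg := prim_L1 pV.
have hg : eps * Int x (x + eps) (fun t => `|g t|) <= tau.
  have := Int_norm_dens e0 t0 xe lg ld.
  rewrite (_ : (x + eps - x) / eps = 1); last by field; rewrite gt_eqF.
  have : Int x (x + eps) (dens eps U g) / tau <= tau by rewrite ler_pdivrMr// -expr2.
  lra.
have hV z : x <= z <= x + eps -> eps * `|V z - V x| <= tau.
  move=> /andP[xz ze]; apply: le_trans hg; rewrite ler_pM2l//.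
  have [_ h] := pV; rewrite h//.
  have l : L1 x z g by apply: L1_sub lg.
  rewrite (le_trans (normr_Int l))//; apply: le_Int_sub => //; exact: L1_norm.
have hU z w : x <= z <= x + eps -> x <= w <= x + eps ->
    eps * `|U z - U w - V x * (z - w)| <= tau * `|z - w|.
  move=> zc wc.
  (* Subtracting the line of slope V x leaves a derivative V - V x of size at most tau / eps. *)
  have p : prim x (x + eps) (fun t => V t - V x) (fun t => U t - V x * t).
    apply: (eq_prim _ _ (primD pU (primZ (- V x) (@prim_C1 _ x (x + eps) (fun=> 1) id _ _ _)))).
    - by move=> t _; rewrite mulr1.
    - by move=> t _ /=; rewrite mulNr.
    - by move=> t; exact: derivable_id.
    - by move=> t; rewrite derive1E derive_id.
    - by move=> t; exact: cvg_cst.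
  have := @prim_osc _ _ (tau / eps) _ _ w z p wc zc.
  rewrite (_ : U z - V x * z - (U w - V x * w) = U z - U w - V x * (z - w)); last by ring.
  move=> /(_ _)/le_trans h; rewrite mulrC -ler_pdivlMr// mulrAC; apply: h => //.
  move=> t /andP[xt te]; rewrite ler_pdivlMr// mulrC; apply: hV; by rewrite !ltW.
(* Were (U^2 - 1)^2 > 9 tau^2 on a whole subinterval of length eps / 8, the well term alone would
   cost at least 9/8 tau^2, more than the cell has. *)
have hpt c : x <= c -> c + eps / 8 <= x + eps -> exists z s, [/\ c <= z <= c + eps / 8,
    s = 1 \/ s = -1 & `|U z - s| <= 3 * tau].
  move=> xc ce; have ce' : c <= c + eps / 8 by rewrite lerDl divr_ge0 ?ltW.
  have [[z [zc hz]]|no] := pselect (exists z, c <= z <= c + eps / 8 /\ (U z ^+ 2 - 1) ^+ 2 <= (3 * tau) ^+ 2).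
    have [|s s1 hs] := sqr_sub1_near hz; first by rewrite mulr_ge0// ltW.
    by exists z, s.
  exfalso.
  have : eps^-1 * (3 * tau) ^+ 2 * (c + eps / 8 - c) <= Int c (c + eps / 8) (dens eps U g).
    apply: Int_cst_le => //; first by apply: L1_sub ld.
    move=> t /andP[ct tc]; rewrite /dens; apply: ler_wpDr.
      by rewrite mulr_ge0 ?sqr_ge0 ?exprn_ge0 ?ltW.
    rewrite ler_pM2l ?invr_gt0// leNgt; apply/negP => h; apply: no; exists t.
    by rewrite !ltW.
  apply/negP; rewrite -ltNge.
  apply: (@le_lt_trans _ _ (tau ^+ 2)).
    apply: le_trans hE; apply: le_Int_sub => // t _; exact: dens_ge0.
  have -> : eps^-1 * (3 * tau) ^+ 2 * (c + eps / 8 - c) = tau ^+ 2 * (9 / 8).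
    by field; rewrite gt_eqF.
  rewrite ltr_pMr ?exprn_gt0//; lra.
(* Two points near the same well at distance at least eps / 4 give |V x| eps / 4 <= 3 tau + 3 tau +
   tau, so eps |V x| <= 28 tau. Adding tau bounds eps |V|, and 3 tau + 28 tau + tau = 32 tau bounds
   the distance of U to the well. *)
have key z w s : x <= z <= x + eps -> x <= w <= x + eps -> eps / 4 <= `|z - w| ->
    `|U z - s| <= 3 * tau -> `|U w - s| <= 3 * tau -> s = 1 \/ s = -1 ->
  exists2 s : R, s = 1 \/ s = -1 & forall z, x <= z <= x + eps ->
    `|U z - s| <= 32 * tau /\ eps * `|V z| <= 32 * tau.
  move=> zc wc zw hz hw s1.
  have zwe : `|z - w| <= eps.
    by move: zc wc => /andP[? ?] /andP[? ?]; rewrite ler_norml; apply/andP; split; lra.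
  have Vx : eps * `|V x| <= 28 * tau.
    have h1 := hU z w zc wc.
    have h2 : `|V x| * `|z - w| <= `|U z - s| + `|U w - s| + `|U z - U w - V x * (z - w)|.
      rewrite -normrM; set D := U z - U w - _.
      rewrite (_ : V x * (z - w) = (U z - s) - (U w - s) - D); last by rewrite /D; ring.
      by rewrite (le_trans (ler_normB _ _))// lerD2r ler_normB.
    have h3 : `|V x| * (eps / 4) <= `|V x| * `|z - w| by rewrite ler_wpM2l.
    have h4 : `|U z - U w - V x * (z - w)| <= tau.
      by rewrite -(ler_pM2l e0) (le_trans h1)// mulrC ler_pM2r.
    lra.
  exists s => // r rc; split; last first.
    have := hV r rc; have : eps * `|V r| <= eps * `|V r - V x| + eps * `|V x|.
      by rewrite -mulrDr ler_pM2l// (le_trans _ (ler_normD _ _))// subrK.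
    lra.
  have h1 := hU r z rc zc.
  have rze : `|r - z| <= eps.
    by move: zc rc => /andP[? ?] /andP[? ?]; rewrite ler_norml; apply/andP; split; lra.
  have h4 : `|U r - U z - V x * (r - z)| <= tau.
    by rewrite -(ler_pM2l e0) (le_trans h1)// mulrC ler_pM2r.
  have h5 : `|V x * (r - z)| <= 28 * tau.
    by rewrite normrM (le_trans _ Vx)// mulrC ler_wpM2r.
  have : `|U r - s| <= `|U r - U z - V x * (r - z)| + `|V x * (r - z)| + `|U z - s|.
    set D := U r - U z - _.
    rewrite (_ : U r - s = D + V x * (r - z) + (U z - s)); last by rewrite /D; ring.
    by rewrite (le_trans (ler_normD _ _))// lerD2r ler_normD.
  lra.
(* The three subintervals begin at 0, 3/8 and 7/8 of the cell and have length 1/8, so points from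
   different ones are at least eps / 4 apart. *)
have [||z1 [s1 [/andP[z1l z1r] hs1 hz1]]] := hpt x; [lra..|].
have [||z2 [s2 [/andP[z2l z2r] hs2 hz2]]] := hpt (x + 3 * (eps / 8)); [lra..|].
have [||z3 [s3 [/andP[z3l z3r] hs3 hz3]]] := hpt (x + 7 * (eps / 8)); [lra..|].
have c1 : x <= z1 <= x + eps by apply/andP; split; lra.
have c2 : x <= z2 <= x + eps by apply/andP; split; lra.
have c3 : x <= z3 <= x + eps by apply/andP; split; lra.
case: (pigeonhole3 hs1 hs2 hs3) => es.
- by apply: (key z1 z2 s1) => //; [rewrite ler_normr; apply/orP; right; lra|rewrite es].
- by apply: (key z1 z3 s1) => //; [rewrite ler_normr; apply/orP; right; lra|rewrite es].
- by apply: (key z2 z3 s2) => //; [rewrite ler_normr; apply/orP; right; lra|rewrite es].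
Qed.

End Cell.

(** * The cost of a transition between exact wells *)

Section Transition.
Context {R : realType}.
Implicit Types (a b c d p x y z e eps tau A B L : R) (f g F G U V w : R -> R).

(** Trades real powers for integer powers of a fourth root, so that [field] and [ring] can handle
    the identities below. *)
Lemma quarter_powers A : 0 <= A -> exists q : R,
  [/\ 0 <= q, q ^+ 4 = A, A `^ (1 / 4) = q & A `^ (3 / 4) = q ^+ 3].
Proof.
move=> A0; exists (A `^ (1 / 4)); split=> //; first exact: powR_ge0.
  by rewrite -powR_mulrn ?powR_ge0// -powRrM -[RHS]powRr1//; congr powR; field.
by rewrite -powR_mulrn ?powR_ge0// -powRrM; congr powR; field.
Qed.

Lemma weighted_AMGM A B L : 0 <= A -> 0 <= B -> 0 < L ->
  4 / 3 `^ (3 / 4) * (A `^ (3 / 4) * B `^ (1 / 4)) <= L * A + L ^- 3 * B.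
Proof.
move=> A0 B0 L0; have [u [u0 <- _ ->]] := quarter_powers A0.
have [v [v0 <- -> _]] := quarter_powers B0.
have [l [l0 lL _ _]] := quarter_powers (ltW L0).
have three : (0 : R) <= 3 by [].
have [r [r0 r3 _ ->]] := quarter_powers three.
have rn : r != 0 by apply/eqP => r00; move: r3; rewrite r00 expr0n /= => /eqP; rewrite eq_sym pnatr_eq0.
have ln : l != 0 by apply/eqP => l00; move: L0; rewrite -lL l00 expr0n /= ltxx.
(* s and t are the fourth roots of L A / 3 and B / L^3. The claim becomes 4 s^3 t <= 3 s^4 + t^4,
   and the difference factors as (s - t)^2 (3 s^2 + 2 s t + t^2). *)
pose s := l * u / r; pose t := v / l ^+ 3.
have s0 : 0 <= s by rewrite /s !mulr_ge0// invr_ge0.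
have t0 : 0 <= t by rewrite /t mulr_ge0// invr_ge0 exprn_ge0.
have -> : 4 / r ^+ 3 * (u ^+ 3 * v) = 4 * (s ^+ 3 * t) by rewrite /s /t; field; rewrite rn ln.
have -> : L * u ^+ 4 + L ^- 3 * v ^+ 4 = 3 * s ^+ 4 + t ^+ 4.
  by rewrite -lL -r3 /s /t; field; rewrite rn ln.
rewrite -subr_ge0 (_ : _ - _ = (s - t) ^+ 2 * (3 * s ^+ 2 + 2 * s * t + t ^+ 2)); last by ring.
apply: mulr_ge0; first exact: sqr_ge0.
apply: addr_ge0; last exact: sqr_ge0.
by apply: addr_ge0; apply: mulr_ge0 => //; [exact: sqr_ge0|exact: mulr_ge0].
Qed.

Lemma inLpP a b p f :
  inLp a b p f <-> measurable_fun `]a, b[ f /\ L1 a b (fun x => `|f x| `^ p).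
Proof.
have mp g : measurable_fun `]a, b[ g -> measurable_fun `]a, b[ (fun x => `|g x| `^ p).
  by move=> mg; apply: (measurableT_comp (measurable_powR p)); exact: measurableT_comp.
split=> -[mf lf]; split => //; first by apply: L1_ge0 => //; exact: mp.
by rewrite Int_EFin// ltry.
Qed.

Lemma inLp_scale a b p k f : inLp a b p f -> inLp a b p (fun x => k * f x).
Proof.
move=> /inLpP[mf lf]; apply/inLpP; split; first exact: measurable_funM.
by apply: (eq_L1 (f := fun x => `|k| `^ p * `|f x| `^ p)); [move=> x _; rewrite normrM powRM|exact: L1Z].
Qed.

Lemma inLp_affine k c a b p f : 0 < k -> inLp (k * a + c) (k * b + c) p f ->
  inLp a b p (fun x => f (k * x + c)).
Proof.
move=> k0 /inLpP[mf lf]; apply/inLpP; split; first exact: measurable_affine.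
exact: (L1_affine k0 lf).
Qed.

Lemma prim_ends a b f F : a < b -> prim a b f F ->
  [/\ {in `]a, b[, continuous F}, F x @[x --> a^'+] --> F a & F x @[x --> b^'-] --> F b].
Proof. by move=> ab pF; apply/continuous_within_itvP => //; exact: prim_continuous (ltW ab) pF. Qed.

Lemma Jclass_prim p w v g : 1 <= p -> prim 0 1 v w -> prim 0 1 g v -> inLp 0 1 p g ->
  w 0 = -1 -> w 1 = 1 -> v 0 = 0 -> v 1 = 0 -> Jclass p w.
Proof.
move=> p1 pw pv lg w0 w1 v0 v1; split.
  by exists v, g; exact: prim_W2p.
have [cw w0' w1'] := prim_ends ltr01 pw; have [cv v0' v1'] := prim_ends ltr01 pv.
have dw x : x \in `]0, 1[ -> derivable w x 1 /\ derive1 w x = v x.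
  by move=> xi; apply: (prim_derive pw); [rewrite in_itv/= in xi|exact: cv].
exists w; split; first by apply: aeW.
split; first by move=> x /dw[].
split.
  move=> x xi; rewrite /continuous_at (dw x xi).2.
  apply: cvg_trans (cv x xi); apply: near_eq_cvg; near=> y.
  by rewrite (dw y _).2//; near: y; exact: near_in_itvoo.
split; first by move: w0'; rewrite w0.
split; first by move: w1'; rewrite w1.
rewrite v0 in v0'; rewrite v1 in v1'.
split; [apply: cvg_trans v0'|apply: cvg_trans v1'];
  apply: near_eq_cvg; near=> y; rewrite (dw y _).2// in_itv/=; apply/andP; split; near: y.
- exact: nbhs_right_gt.
- exact: nbhs_right_lt.
- exact: nbhs_left_gt.
- exact: nbhs_left_lt.
Unshelve. all: by end_near. Qed.

Definition well w (t : R) : R := (w t ^+ 2 - 1) ^+ 2.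

Lemma L1_well a b f F : prim a b f F -> L1 a b (well F).
Proof.
move=> pF; have [K K0 hK] := prim_bound pF.
apply: (@L1_bounded _ _ _ _ ((K ^+ 2 + 1) ^+ 2)).
  rewrite /well; have mF := prim_measurable pF.
  by apply: measurable_funX; apply: measurable_funB => //; exact: measurable_funX.
move=> x /andP[ax xb]; rewrite normrX ler_pXn2r// ?nnegrE ?addr_ge0 ?sqr_ge0//.
rewrite (le_trans (ler_normB _ _))// normr1 lerD2r normrX ler_pXn2r// ?nnegrE//.
by apply: hK; rewrite !ltW.
Qed.

Lemma densE eps U g : dens eps U g = (fun x => eps^-1 * well U x + eps ^+ 3 * g x ^+ 2).
Proof. by []. Qed.

Lemma L1_sqr_dens eps a b U V g : 0 < eps -> prim a b V U -> measurable_fun `]a, b[ g ->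
  L1 a b (dens eps U g) -> L1 a b (fun x => g x ^+ 2).
Proof.
move=> e0 pU mg ld; apply: (@le_L1 _ _ _ _ (fun x => eps ^- 3 * dens eps U g x)).
- exact: measurable_funX.
- exact: L1Z.
move=> x _; rewrite ger0_norm ?sqr_ge0// mulrDr [X in _ + X]mulrA mulVf ?mul1r ?expf_neq0 ?gt_eqF//.
by rewrite lerDr mulr_ge0 ?invr_ge0 ?exprn_ge0 ?(ltW e0)// mulr_ge0 ?sqr_ge0// invr_ge0 ltW.
Qed.

Lemma Int_dens eps a b U V g : prim a b V U -> L1 a b (fun x => g x ^+ 2) ->
  L1 a b (dens eps U g) /\ Int a b (dens eps U g) =
    eps^-1 * Int a b (well U) + eps ^+ 3 * Int a b (fun x => g x ^+ 2).
Proof.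
move=> pU lg; have lw := L1_well pU; rewrite densE.
by split; [apply: L1D; exact: L1Z|rewrite IntD ?IntZ//; exact: L1Z].
Qed.

Lemma Phi_le p w v g : 1 <= p -> prim 0 1 v w -> prim 0 1 g v -> inLp 0 1 p g ->
  L1 0 1 (fun x => g x ^+ 2) ->
  (Phi p w <= (Int 0 1 (well w) `^ (3 / 4) * Int 0 1 (fun x => (g x ^+ 2)) `^ (1 / 4))%:E)%E.
Proof.
move=> p1 pw pv lg lg2; apply: ereal_inf_lbound; exists v, g; split; first exact: prim_W2p.
rewrite EFinM -!poweR_EFin -(Int_EFin (L1_well pw)) -(Int_EFin lg2).
by congr (_ * poweR _ _)%E; apply: eq_integral => x _; rewrite real_normK ?num_real.
Qed.

Lemma alpha_le p w v g L : 1 <= p -> 0 < L -> prim 0 1 v w -> prim 0 1 g v -> inLp 0 1 p g ->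
  w 0 = -1 -> w 1 = 1 -> v 0 = 0 -> v 1 = 0 ->
  L1 0 1 (fun x => g x ^+ 2) ->
  (2%:E * alpha p <= (L * Int 0 1 (well w) + L ^- 3 * Int 0 1 (fun x => g x ^+ 2))%:E)%E.
Proof.
move=> p1 L0 pw pv lg w0 w1 v0 v1 lg2.
have Jw := Jclass_prim p1 pw pv lg w0 w1 v0 v1.
have A0 : 0 <= Int 0 1 (well w) by apply: Int_ge0 => x _; exact: sqr_ge0.
have B0 : 0 <= Int 0 1 (fun x => g x ^+ 2) by apply: Int_ge0 => x _; exact: sqr_ge0.
have := weighted_AMGM A0 B0 L0; rewrite -lee_fin; apply: le_trans.
rewrite /alpha muleA -EFinM [leRHS]EFinM (_ : 2 * (2 / 3 `^ (3 / 4)) = 4 / 3 `^ (3 / 4)); last first.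
  by rewrite mulrA; congr (_ / _); rewrite -natrM.
apply: lee_wpmul2l; first by rewrite lee_fin divr_ge0// powR_ge0.
apply: le_trans (Phi_le p1 pw pv lg lg2).
by apply: ereal_inf_lbound; exists w.
Qed.

(** Rescaling [x, y] to [0, 1] multiplies second derivatives by (y - x)^2 and turns the energy into
    L A + L^-3 B with L = (y - x) / eps, for the well and bending integrals A and B of the rescaled
    function. *)
Lemma exact_transition_cost p eps x y U V g : 1 <= p -> 0 < eps -> x < y ->
  prim x y V U -> prim x y g V -> inLp x y p g -> L1 x y (dens eps U g) ->
  U x = -1 -> U y = 1 -> V x = 0 -> V y = 0 ->
  (2%:E * alpha p <= (Int x y (dens eps U g))%:E)%E.
Proof.
move=> p1 e0 xy pU pV lg ld Ux Uy Vx Vy.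
pose l := y - x; have l0 : 0 < l by rewrite subr_gt0.
have ex : l * 0 + x = x by rewrite mulr0 add0r.
have ey : l * 1 + x = y by rewrite mulr1 /l subrK.
have lg2 : L1 x y (fun t => g t ^+ 2).
  by apply: L1_sqr_dens ld => //; [exact: pU|exact: L1_meas (prim_L1 pV)].
have [_ ->] := Int_dens eps pU lg2.
rewrite -ex -ey in pU pV lg lg2 Ux Uy Vx Vy *.
have pw := prim_affine l0 pU; have pv := primZ l (prim_affine l0 pV).
rewrite (Int_affine l0 (L1_well pU)) (Int_affine l0 lg2).
have lg' := inLp_scale l (inLp_scale l (inLp_affine l0 lg)).
have lg2' : L1 0 1 (fun t => (l * (l * g (l * t + x))) ^+ 2).
  apply: (eq_L1 (f := fun t => l ^+ 4 * g (l * t + x) ^+ 2)); first by move=> t _; ring.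
  exact: L1Z (L1_affine l0 lg2).
have L0 : 0 < l / eps by rewrite divr_gt0.
have := alpha_le p1 L0 pw pv lg' Ux Uy _ _ lg2'; rewrite /= Vx Vy mulr0.
move=> /(_ erefl erefl); congr (_ <= _%:E)%E; congr (_ + _).
  by rewrite /well; ring.
rewrite (@eq_Int _ _ _ (fun t => (l * (l * g (l * t + x))) ^+ 2) (fun t => l ^+ 4 * g (l * t + x) ^+ 2)); last first.
  by move=> t _; ring.
rewrite IntZ; last exact: (L1_affine l0 lg2).
by field; rewrite !gt_eqF.
Qed.

End Transition.

(** * Gluing and Hermite cubics *)

Section Gluing.
Context {R : realType}.
Implicit Types (a b c d p x y z e s eps tau sigma : R) (f g F G U V w : R -> R).

Definition glue c f g x : R := if x < c then f x else g x.

Lemma glue_lt c f g x : x < c -> glue c f g x = f x.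
Proof. by rewrite /glue => ->. Qed.

Lemma glue_ge c f g x : c <= x -> glue c f g x = g x.
Proof. by rewrite /glue ltNge => ->. Qed.

Lemma L1_glue a b c f g : L1 a c f -> L1 c b g -> L1 a b (glue c f g).
Proof.
move=> lf lg; apply: (@L1_cat _ _ _ c).
  by apply: eq_L1 lf => x /andP[_ xc]; rewrite glue_lt.
by apply: eq_L1 lg => x /andP[cx _]; rewrite glue_ge// ltW.
Qed.

Lemma Int_glue a b c f g : a <= c -> c <= b -> L1 a c f -> L1 c b g ->
  Int a b (glue c f g) = Int a c f + Int c b g.
Proof.
move=> ac cb lf lg; rewrite (@Int_cat _ a b c)//; last exact: L1_glue.
congr (_ + _); apply: eq_Int => x /andP[xl xr]; first by rewrite glue_lt.
by rewrite glue_ge// ltW.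
Qed.

Lemma prim_glue a b c f g F G : prim a c f F -> prim c b g G -> F c = G c ->
  prim a b (glue c f g) (glue c F G).
Proof.
move=> pF pG FG; apply: (@prim_cat _ _ _ c).
  apply: eq_prim pF => x /andP[_ xc]; first by rewrite glue_lt.
  by have [xc'|cx] := ltP x c; [rewrite glue_lt|rewrite (le_anti (introT andP (conj xc cx))) glue_ge].
by apply: eq_prim pG => x /andP[cx _]; rewrite glue_ge// ltW.
Qed.

Lemma inLp_glue a b c p f g : 1 <= p -> inLp a c p f -> inLp c b p g ->
  inLp a b p (glue c f g).
Proof.
move=> p1 Lf Lg; have lf := inLp_L1 p1 Lf; have lg := inLp_L1 p1 Lg.
move: Lf Lg => /inLpP[_ lf'] /inLpP[_ lg']; apply/inLpP; split.
  exact: L1_meas (L1_glue lf lg).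
apply: (eq_L1 (f := glue c (fun x => `|f x| `^ p) (fun x => `|g x| `^ p))).
  by move=> x _; rewrite /glue; case: ifP.
exact: L1_glue.
Qed.

Lemma dens_glue eps c U1 U2 g1 g2 :
  dens eps (glue c U1 U2) (glue c g1 g2) = glue c (dens eps U1 g1) (dens eps U2 g2).
Proof. by apply/funext => x; rewrite /dens /glue; case: ifP. Qed.

Lemma prim_poly lo hi (P : {poly R}) : prim lo hi (horner P^`()) (horner P).
Proof.
have cP (Q : {poly R}) : continuous (horner Q).
  move=> x; apply/differentiable_continuous/derivable1_diffP.
  exact: (@ex_derive _ _ _ _ _ _ _ (is_derive_poly Q x)).
apply: prim_C1 => // x; have h := is_derive_poly P x.
by rewrite derive1E; exact: (@derive_val _ _ _ _ _ _ _ h).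
Qed.

(** 164 = 64 + 100: since sigma <= 1, |P + s| <= 4, so the well term is at most (2 sigma)^2 4^2, and
    the bending term is at most (10 sigma)^2. At scale eps both densities carry a factor 1 / eps,
    which the length eps cancels. *)
Lemma poly_transition p eps x0 s sigma (P : {poly R}) : 1 <= p -> 0 < eps ->
  s = 1 \/ s = -1 -> 0 <= sigma -> sigma <= 1 ->
  (forall t : R, 0 <= t <= 1 -> `|P.[t] - s| <= 2 * sigma) ->
  (forall t : R, 0 <= t <= 1 -> `|P^`()^`().[t]| <= 10 * sigma) ->
  exists Q Q1 Q2 : R -> R, [/\ prim x0 (x0 + eps) Q1 Q, prim x0 (x0 + eps) Q2 Q1,
    inLp x0 (x0 + eps) p Q2,
    [/\ Q x0 = P.[0], Q (x0 + eps) = P.[1], eps * Q1 x0 = P^`().[0] &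
        eps * Q1 (x0 + eps) = P^`().[1]] &
    L1 x0 (x0 + eps) (dens eps Q Q2) /\
    Int x0 (x0 + eps) (dens eps Q Q2) <= 164 * sigma ^+ 2].
Proof.
move=> p1 e0 s1 sg0 sg1 hP hP2.
pose k := eps^-1; have k0 : 0 < k by rewrite invr_gt0.
pose c := - (eps^-1 * x0).
have E0 : k * x0 + c = 0 by rewrite /k /c subrr.
have E1 : k * (x0 + eps) + c = 1 by rewrite /k /c; field; rewrite gt_eqF.
have pQ (Q : {poly R}) := @prim_affine _ k c x0 (x0 + eps) _ _ k0 (prim_poly (k * x0 + c) (k * (x0 + eps) + c) Q).
have p0 := pQ P; have p2 := primZ k (pQ P^`()).
have rng z : x0 < z < x0 + eps -> 0 <= k * z + c <= 1.
  by move=> /andP[z1 z2]; rewrite -E1 -{1}E0 !lerD2r !ler_pM2l// !ltW.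
set Q := (fun x => P.[k * x + c]) in p0; set Q1 := (fun x => k * _) in p0.
set Q2 := (fun x => k * (k * _)) in p2.
have l2 := prim_L1 p2; have m2 := L1_meas l2.
have b2 z : x0 < z < x0 + eps -> `|Q2 z| <= k * (k * (10 * sigma)).
  move=> /rng hz; rewrite /Q2 !normrM gtr0_norm// !ler_pM2l//; exact: hP2.
have lsq : L1 x0 (x0 + eps) (fun x => Q2 x ^+ 2).
  apply: (@L1_bounded _ _ _ _ ((k * (k * (10 * sigma))) ^+ 2)); first exact: measurable_funX.
  by move=> z /b2 hz; rewrite normrX ler_pXn2r// nnegrE !mulr_ge0// ltW.
have [ld _] := Int_dens eps p0 lsq.
exists Q, Q1, Q2; split => //.
- by apply: (inLp_bounded (K := k * (k * (10 * sigma)))).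
- by rewrite /Q /Q1 E0 E1 /k !mulrA mulfV ?gt_eqF// !mul1r.
split => //.
have -> : 164 * sigma ^+ 2 = eps^-1 * (164 * sigma ^+ 2) * (x0 + eps - x0).
  by field; rewrite gt_eqF.
apply: Int_le_cst => //; first by rewrite lerDl ltW.
move=> z /rng hz; rewrite /dens /Q.
have h1 : (P.[k * z + c] ^+ 2 - 1) ^+ 2 <= 64 * sigma ^+ 2.
  have -> : P.[k * z + c] ^+ 2 - 1 = (P.[k * z + c] - s) * (P.[k * z + c] + s).
    by case: s1 => ->; ring.
  rewrite exprMn -real_normK ?num_real// -[(_ + s) ^+ 2]real_normK ?num_real//.
  have h1 := hP _ hz.
  have h2 : `|P.[k * z + c] + s| <= 4.
    have -> : P.[k * z + c] + s = (P.[k * z + c] - s) + 2 * s by ring.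
    rewrite (le_trans (ler_normD _ _))//.
    have : `|2 * s| = 2 by case: s1 => ->; rewrite ?mulrN1 ?normrN ?mulr1 ger0_norm.
    move=> ->; lra.
  rewrite (_ : 64 * sigma ^+ 2 = (2 * sigma) ^+ 2 * 4 ^+ 2); last by ring.
  by rewrite ler_pM ?sqr_ge0// ler_pXn2r// ?nnegrE ?mulr_ge0.
have h2 : eps ^+ 3 * Q2 z ^+ 2 <= eps^-1 * (100 * sigma ^+ 2).
  rewrite (_ : eps ^+ 3 * Q2 z ^+ 2 = eps^-1 * P^`()^`().[k * z + c] ^+ 2); last first.
    by rewrite /Q2 /k; field; rewrite gt_eqF.
  rewrite ler_pM2l ?invr_gt0// (_ : 100 * sigma ^+ 2 = (10 * sigma) ^+ 2); last by ring.
  rewrite -real_normK ?num_real// ler_pXn2r// ?nnegrE ?mulr_ge0//; exact: hP2.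
rewrite (_ : 164 = 64 + 100); last by rewrite -natrD.
by rewrite mulrDl mulrDr lerD// ler_pM2l// invr_gt0.
Qed.

Definition cubic (c0 c1 c2 c3 : R) : {poly R} :=
  c0%:P + c1 *: 'X + c2 *: 'X^2 + c3 *: 'X^3.

Lemma hornerE_cubic (c0 c1 c2 c3 t : R) :
  (cubic c0 c1 c2 c3).[t] = c0 + c1 * t + c2 * t ^+ 2 + c3 * t ^+ 3.
Proof. by rewrite /cubic !hornerE. Qed.

Lemma deriv_cubic (c0 c1 c2 c3 : R) :
  (cubic c0 c1 c2 c3)^`() = cubic c1 (2 * c2) (3 * c3) 0.
Proof.
rewrite /cubic !derivD derivC !derivZ derivX !derivXn /= add0r scale0r addr0.
by rewrite alg_polyC -[_ *+ 2]scaler_nat -[_ *+ 3]scaler_nat !scalerA [c2 * _]mulrC [c3 * _]mulrC.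
Qed.

Lemma lin_comb_le sigma e d x y a b : `|e| <= sigma -> `|d| <= sigma ->
  `|x| <= a -> `|y| <= b -> `|e * x + d * y| <= (a + b) * sigma.
Proof.
move=> he hd hx hy; rewrite (le_trans (ler_normD _ _))// !normrM mulrDl.
by rewrite lerD// [leRHS]mulrC ler_pM.
Qed.

(** These are the Hermite basis cubics on [0, 1] for, in order, the value at 1, the slope at 1, the
    value at 0 and the slope at 0. *)
Lemma unit_cubics (t : R) : 0 <= t <= 1 -> [/\ `|3 * t ^+ 2 - 2 * t ^+ 3| <= 1,
  `|t ^+ 3 - t ^+ 2| <= 1, `|1 - 3 * t ^+ 2 + 2 * t ^+ 3| <= 1 & `|t - 2 * t ^+ 2 + t ^+ 3| <= 1].
Proof.
move=> /andP[t0 t1]; have u0 : 0 <= 1 - t by rewrite subr_ge0.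
have a := mulr_ge0 t0 t0; have b := mulr_ge0 a t0; have c := mulr_ge0 a u0.
have e := mulr_ge0 (mulr_ge0 u0 u0) t0; have d := mulr_ge0 u0 u0; have f := mulr_ge0 t0 u0.
split; rewrite ler_norml !exprS !expr0 !mulr1; apply/andP; split; nra.
Qed.

(** The cubic is s + e (3 t^2 - 2 t^3) + d (t^3 - t^2): it leaves the well s with slope 0 and
    reaches s + e with slope d. Its second derivative e (6 - 12 t) + d (6 t - 2) explains the
    constant 10 = 6 + 4. [hermite_out] uses the other two basis cubics. *)
Lemma hermite_in p eps x0 s sigma e d : 1 <= p -> 0 < eps -> s = 1 \/ s = -1 ->
  sigma <= 1 -> `|e| <= sigma -> `|d| <= sigma ->
  exists Q Q1 Q2 : R -> R, [/\ prim x0 (x0 + eps) Q1 Q, prim x0 (x0 + eps) Q2 Q1,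
    inLp x0 (x0 + eps) p Q2,
    [/\ Q x0 = s, Q (x0 + eps) = s + e, Q1 x0 = 0 & eps * Q1 (x0 + eps) = d] &
    L1 x0 (x0 + eps) (dens eps Q Q2) /\
    Int x0 (x0 + eps) (dens eps Q Q2) <= 164 * sigma ^+ 2].
Proof.
move=> p1 e0 s1 sg1 he hd; have sg0 : 0 <= sigma := le_trans (normr_ge0 _) he.
have [||Q [Q1 [Q2 [pQ pQ1 lQ [b1 b2 b3 b4] [ld hd2]]]]] :=
  @poly_transition p eps x0 s sigma (cubic s 0 (3 * e - d) (d - 2 * e)) p1 e0 s1 sg0 sg1.
- move=> t /unit_cubics[c1 c2 _ _]; rewrite hornerE_cubic.
  have h := lin_comb_le he hd c1 c2; apply: (le_trans _ (le_trans h _)); last by lra.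
  by rewrite le_eqVlt; apply/orP; left; apply/eqP; congr `|_|; ring.
- move=> t /andP[t0 t1]; rewrite !deriv_cubic hornerE_cubic.
  have c1 : `|6 - 12 * t| <= 6 by rewrite ler_norml; apply/andP; split; lra.
  have c2 : `|6 * t - 2| <= 4 by rewrite ler_norml; apply/andP; split; lra.
  have h := lin_comb_le he hd c1 c2; apply: (le_trans _ (le_trans h _)); last by lra.
  by rewrite le_eqVlt; apply/orP; left; apply/eqP; congr `|_|; ring.
exists Q, Q1, Q2; split => //; split.
- by rewrite b1 hornerE_cubic; ring.
- by rewrite b2 hornerE_cubic; ring.
- move: b3; rewrite deriv_cubic hornerE_cubic => /eqP.
  by rewrite mul0r !expr0n /= !mulr0 !addr0 mulf_eq0 gt_eqF//= => /eqP.
- by rewrite b4 deriv_cubic hornerE_cubic; ring.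
Qed.

Lemma hermite_out p eps x0 s sigma e d : 1 <= p -> 0 < eps -> s = 1 \/ s = -1 ->
  sigma <= 1 -> `|e| <= sigma -> `|d| <= sigma ->
  exists Q Q1 Q2 : R -> R, [/\ prim x0 (x0 + eps) Q1 Q, prim x0 (x0 + eps) Q2 Q1,
    inLp x0 (x0 + eps) p Q2,
    [/\ Q x0 = s + e, Q (x0 + eps) = s, eps * Q1 x0 = d & Q1 (x0 + eps) = 0] &
    L1 x0 (x0 + eps) (dens eps Q Q2) /\
    Int x0 (x0 + eps) (dens eps Q Q2) <= 164 * sigma ^+ 2].
Proof.
move=> p1 e0 s1 sg1 he hd; have sg0 : 0 <= sigma := le_trans (normr_ge0 _) he.
have [||Q [Q1 [Q2 [pQ pQ1 lQ [b1 b2 b3 b4] [ld hd2]]]]] :=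
  @poly_transition p eps x0 s sigma (cubic (s + e) d (- 3 * e - 2 * d) (d + 2 * e)) p1 e0 s1 sg0 sg1.
- move=> t /unit_cubics[_ _ c1 c2]; rewrite hornerE_cubic.
  have h := lin_comb_le he hd c1 c2; apply: (le_trans _ (le_trans h _)); last by lra.
  by rewrite le_eqVlt; apply/orP; left; apply/eqP; congr `|_|; ring.
- move=> t /andP[t0 t1]; rewrite !deriv_cubic hornerE_cubic.
  have c1 : `|12 * t - 6| <= 6 by rewrite ler_norml; apply/andP; split; lra.
  have c2 : `|6 * t - 4| <= 4 by rewrite ler_norml; apply/andP; split; lra.
  have h := lin_comb_le he hd c1 c2; apply: (le_trans _ (le_trans h _)); last by lra.
  by rewrite le_eqVlt; apply/orP; left; apply/eqP; congr `|_|; ring.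
exists Q, Q1, Q2; split => //; split.
- by rewrite b1 hornerE_cubic; ring.
- by rewrite b2 hornerE_cubic; ring.
- by rewrite b3 deriv_cubic hornerE_cubic; ring.
- move: b4; rewrite deriv_cubic hornerE_cubic => b4.
  have /eqP : eps * Q1 (x0 + eps) = 0 by rewrite b4; ring.
  by rewrite mulf_eq0 gt_eqF//= => /eqP.
Qed.

End Gluing.

(** * Boundary values in the class J and a crude bound for transitions *)

Section AlphaPositive.
Context {R : realType}.
Notation mu := (@lebesgue_measure R).
Implicit Types (a b c d p x y z e s eps tau sigma : R) (f g F G U V w : R -> R).

Lemma ae_on_exists a b c d (P : R -> Prop) : a <= c -> c < d -> d <= b -> ae_on a b P ->
  exists x, c < x < d /\ P x.
Proof.
move=> ac cd db [A [mA A0 sub]]; apply: contrapT => no.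
have : (mu `]c, d[%classic <= mu A)%E.
  apply: le_measure; rewrite ?inE//= => x /=; rewrite in_itv/= => xcd.
  apply: sub => /= h; apply: no; exists x; split => //; apply: h.
  by rewrite in_itv/=; case/andP: xcd => cx xd; rewrite (le_lt_trans ac) ?(lt_le_trans xd).
rewrite A0 lebesgue_measure_itv/= lte_fin cd -EFinD lee_fin; lra.
Qed.

Lemma ae_onI a b (P Q : R -> Prop) : ae_on a b P -> ae_on a b Q ->
  ae_on a b (fun x => P x /\ Q x).
Proof.
rewrite /ae_on; apply: filterS2; first exact: (ae_filter_ringOfSetsType mu).
by move=> x /= hP hQ xab; split; [exact: hP|exact: hQ].
Qed.

Lemma ae_onS a b (P Q : R -> Prop) : (forall x, a < x < b -> P x -> Q x) ->
  ae_on a b P -> ae_on a b Q.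
Proof.
move=> PQ; rewrite /ae_on; apply: filterS; first exact: (ae_filter_ringOfSetsType mu).
by move=> x /= hP; rewrite in_itv/= => xab; apply: PQ => //; apply: hP; rewrite in_itv.
Qed.

Lemma ae_on_all a b (P : R -> Prop) : (forall x, a < x < b -> P x) -> ae_on a b P.
Proof. by move=> h; apply: aeW => x /=; rewrite in_itv/=; exact: h. Qed.

Lemma ae_on_sub a b c d (P : R -> Prop) : a <= c -> d <= b -> ae_on a b P -> ae_on c d P.
Proof.
move=> ac db; rewrite /ae_on; apply: filterS; first exact: (ae_filter_ringOfSetsType mu).
move=> x /= hP; rewrite in_itv/= => /andP[cx xd]; apply: hP.
by rewrite in_itv/= (le_lt_trans ac) ?(lt_le_trans xd).
Qed.

Lemma continuous_ae_eq a b f g x : {in `]a, b[, continuous f} -> {in `]a, b[, continuous g} ->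
  ae_on a b (fun x => f x = g x) -> a < x < b -> f x = g x.
Proof.
move=> cf cg fg xab; have xi : x \in `]a, b[ by rewrite in_itv.
apply/eqP; apply: contrapT => /negP fgx.
have d0 : 0 < `|f x - g x| / 3 by rewrite divr_gt0// normr_gt0 subr_eq0.
have /cvgrPdist_lt/(_ _ d0) h1 := cf x xi; have /cvgrPdist_lt/(_ _ d0) h2 := cg x xi.
have [e e0 he] : exists2 e, 0 < e & forall y, `|x - y| < e -> [/\ a < y < b,
    `|f x - f y| < `|f x - g x| / 3 & `|g x - g y| < `|f x - g x| / 3].
  have : \forall y \near x, [/\ a < y < b,
    `|f x - f y| < `|f x - g x| / 3 & `|g x - g y| < `|f x - g x| / 3].
    near=> y; split; [|by near: y|by near: y].
    have : y \in `]a, b[ by near: y; exact: near_in_itvoo.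
    by rewrite in_itv.
  by move=> /nbhs_ballP[e /= e0 he]; exists e => // y hy; exact: he.
have [/andP[ax1 _] _ _] : [/\ a < x - e / 2 < b, True & True].
  by have [] := he (x - e / 2); [rewrite opprB addrC subrK ger0_norm; lra|].
have [/andP[_ xb1] _ _] : [/\ a < x + e / 2 < b, True & True].
  by have [] := he (x + e / 2); [rewrite opprD addrA subrr add0r normrN ger0_norm; lra|].
have [] := @ae_on_exists a b (x - e / 2) (x + e / 2) _ _ _ _ fg; [lra..|].
move=> y [/andP[y1 y2] fgy]; have [|_ h3 h4] := he y; first by rewrite ltr_norml; apply/andP; split; lra.
have : `|f x - g x| <= `|f x - f y| + `|g x - g y|.
  by rewrite (_ : f x - g x = (f x - f y) - (g x - g y)) ?ler_normB// fgy; ring.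
have := normr_ge0 (f x - g x); lra.
Unshelve. all: by end_near. Qed.

(** The one-sided limits in [Jclass] concern some C^1 representative. It agrees with U almost
    everywhere, hence everywhere inside by continuity, and so do the derivatives; the limits thereby
    become endpoint values of U and V. *)
Lemma Jclass_ends p w g1 g2 : 1 <= p -> Jclass p w -> W2p_with 0 1 p w g1 g2 ->
  exists U V, [/\ prim 0 1 V U, prim 0 1 g2 V, ae_on 0 1 (fun x => w x = U x),
    U 0 = -1 /\ U 1 = 1 & V 0 = 0 /\ V 1 = 0].
Proof.
move=> p1 [_ [wt [wtw [dwt [cwt [l1 [l2 [l3 l4]]]]]]]] hw.
have [U [V [pU pV wU _]]] := W2p_prim ler01 p1 hw.
have [cU U0 U1] := prim_ends ltr01 pU; have [cV V0 V1] := prim_ends ltr01 pV.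
have wtU x : 0 < x < 1 -> wt x = U x.
  apply: continuous_ae_eq => //.
    by move=> z zi; apply/differentiable_continuous/derivable1_diffP; exact: dwt.
  by apply: ae_onS (ae_onI wtw wU) => z _ [-> ->].
have wt'V x : 0 < x < 1 -> derive1 wt x = V x.
  move=> x01; have xi : x \in `]0, 1[ by rewrite in_itv.
  have [_ <-] := prim_derive pU x01 (cV x xi); rewrite !derive1E.
  apply: (near_eq_derive (1 : R)); near=> y; apply: wtU.
  have : y \in `]0, 1[ by near: y; exact: near_in_itvoo.
  by rewrite in_itv.
have r0 f h (l k : R) : (forall x, 0 < x < 1 -> f x = h x) ->
    f x @[x --> (0:R)^'+] --> l -> h x @[x --> (0:R)^'+] --> k -> k = l.
  move=> fh fl hk; apply: (cvg_unique _ hk); first exact: Rhausdorff.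
  apply: cvg_trans fl; apply: near_eq_cvg; near=> y; rewrite fh//; apply/andP; split; near: y.
  - exact: nbhs_right_gt.
  - exact: nbhs_right_lt.
have r1 f h (l k : R) : (forall x, 0 < x < 1 -> f x = h x) ->
    f x @[x --> (1:R)^'-] --> l -> h x @[x --> (1:R)^'-] --> k -> k = l.
  move=> fh fl hk; apply: (cvg_unique _ hk); first exact: Rhausdorff.
  apply: cvg_trans fl; apply: near_eq_cvg; near=> y; rewrite fh//; apply/andP; split; near: y.
  - exact: nbhs_left_gt.
  - exact: nbhs_left_lt.
exists U, V; split => //; split.
- exact: r0 wtU l1 U0.
- exact: r1 wtU l2 U1.
- exact: r0 wt'V l3 V0.
- exact: r1 wt'V l4 V1.
Unshelve. all: by end_near. Qed.

Lemma prim_zero x y U V : x <= y -> prim x y V U -> U x = -1 -> U y = 1 ->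
  exists2 z, x <= z <= y & U z = 0.
Proof.
move=> xy pU Ux Uy; have [|z] := @IVT R U x y 0 xy (prim_continuous xy pU).
  by rewrite Ux Uy ge_min le_max; apply/andP; split; apply/orP; [left|right]; lra.
by rewrite in_itv/= => zxy Uz; exists z.
Qed.

(** If y - x < eps, starting with slope 0 and climbing by 2 forces eps times the integral of |g| to
    be at least 2, and Young's inequality with tau = 1 gives energy at least 3. Otherwise take a
    cell around a zero of U: energy below 64^-2 would put U within 32 / 64 of a well there. *)
Lemma min_transition_cost eps x y U V g : 0 < eps -> x < y ->
  prim x y V U -> prim x y g V -> L1 x y (dens eps U g) ->
  U x = -1 -> U y = 1 -> V x = 0 -> 64^-1 ^+ 2 <= Int x y (dens eps U g).
Proof.
move=> e0 xy pU pV ld Ux Uy Vx; have [z /andP[xz zy] Uz] := prim_zero (ltW xy) pU Ux Uy.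
have [short|long] := ltP (y - x) eps.
  have lg := prim_L1 pV.
  have h := Int_norm_dens e0 ltr01 (ltW xy) lg ld; rewrite divr1 mul1r in h.
  have h1 : (y - x) / eps <= 1 by rewrite ler_pdivrMr// mul1r ltW.
  pose m := Int x y (fun t => `|g t|); rewrite -/m in h.
  have m0 : 0 <= m by exact: Int_ge0.
  have Vm t : x < t < y -> `|V t| <= m.
    move=> /andP[xt ty]; have := prim_Int pV (x := t); rewrite Vx add0r => ->; last by rewrite !ltW.
    have lt : L1 x t g by apply: L1_sub lg => //; exact: ltW.
    by rewrite (le_trans (normr_Int lt))//; apply: le_Int_sub => //; [exact: ltW|exact: L1_norm].
  have := @prim_osc _ x y m _ _ x y pU; rewrite !lexx (ltW xy) => /(_ isT isT Vm).
  rewrite Ux Uy opprK ger0_norm// ger0_norm ?subr_ge0 ?(ltW xy)// => h2.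
  have h3 : m * (y - x) <= m * eps by rewrite ler_wpM2l// ltW.
  have : 2 <= m * eps by rewrite (le_trans _ h3)// (le_trans _ h2)//; lra.
  have : (64^-1 : R) ^+ 2 <= 1 by rewrite expr_le1// ?invr_ge0// invf_le1// ler1n.
  lra.
rewrite leNgt; apply/negP => h.
have [c [xc cy cz zc]] : exists c, [/\ x <= c, c + eps <= y, c <= z & z <= c + eps].
  have [h1|h1] := leP (z + eps) y; first by exists z; split => //; lra.
  by exists (y - eps); split => //; lra.
have t0 : (0 : R) < 64^-1 by rewrite invr_gt0.
have [||||s s1] := @low_energy_cell _ eps 64^-1 c U V g e0 t0.
- exact: prim_sub pU.
- exact: prim_sub pV.
- exact: L1_sub ld.
- apply: le_trans (ltW h); apply: le_Int_sub => // t _; exact: dens_ge0.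
move=> /(_ z); rewrite cz zc Uz sub0r normrN => /(_ isT) [+ _].
have -> : `|s| = 1 by case: s1 => ->; rewrite ?normrN normr1.
lra.
Qed.

End AlphaPositive.

(** * Positivity of alpha and transitions between approximate wells *)

Section TransitionCost.
Context {R : realType}.
Notation mu := (@lebesgue_measure R).
Implicit Types (a b c d p x y z e s eps tau sigma : R) (f g F G U V w : R -> R).

Lemma well_Int_gt0 U V : prim 0 1 V U -> U 0 = -1 -> U 1 = 1 -> 0 < Int 0 1 (well U).
Proof.
move=> pU U0 U1; have [z /andP[z0 z1] Uz] := prim_zero ler01 pU U0 U1.
have [_ hU] := pU; have lV := prim_L1 pU.
have cU : {within `[0, 1], continuous U} := prim_continuous ler01 pU.
suff [c [d [c0 cd d1 hcd]]] : exists c d, [/\ 0 <= c, c < d, d <= 1 &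
    forall t, c < t < d -> `|U t| <= 1 / 2].
  apply: (@lt_le_trans _ _ (1 / 2 * (d - c))); first by rewrite mulr_gt0// subr_gt0.
  apply: (@le_trans _ _ (Int c d (well U))); last first.
    by apply: le_Int_sub => //; [exact: L1_well pU|move=> t _; exact: sqr_ge0].
  apply: Int_cst_le; [exact: ltW|by apply: L1_sub (L1_well pU)|].
  move=> t /hcd; rewrite ler_norml /well => /andP[h1 h2].
  have h3 : U t ^+ 2 <= 1 / 4 by rewrite expr2; nra.
  have h4 : 0 <= U t ^+ 2 by exact: sqr_ge0.
  rewrite expr2; nra.
have zi : z \in `]0, 1[.
  rewrite in_itv/= !lt_neqAle z0 z1 !andbT; apply/andP; split; apply/eqP => ze.
    by move: Uz; rewrite -ze U0; lra.
  by move: Uz; rewrite ze U1; lra.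
have [cin _ _] := prim_ends ltr01 pU.
have h0 : (0 : R) < 1 / 2 by lra.
have /cvgrPdist_lt/(_ _ h0) := cin z zi; rewrite Uz => hn.
have /nbhs_ballP[e /= e0 he] : \forall t \near z, 0 < t < 1 /\ `|0 - U t| < 1 / 2.
  near=> t; split; last by near: t.
  have : t \in `]0, 1[ by near: t; exact: near_in_itvoo.
  by rewrite in_itv.
have [|/andP[_ zz] _] := he (z + e / 2).
  by rewrite /ball/= opprD addrA subrr add0r normrN ger0_norm; lra.
exists z, (z + e / 2); split; [by []|lra|exact: ltW|].
move=> t /andP[zt te]; have [|_] := he t; first by rewrite /ball/= ltr_norml; apply/andP; split; lra.
by rewrite sub0r normrN => /ltW.
Unshelve. all: by end_near. Qed.

(** The second derivative need not be square integrable. Then the value is +oo and not 0 times +oo,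
    because a function that crosses 0 continuously has a positive well term. *)
Lemma Jclass_value p w g1 g2 : 1 <= p -> Jclass p w -> W2p_with 0 1 p w g1 g2 ->
  let v := (poweR (\int[mu]_(y in `]0%R, 1%R[) (((w y ^+ 2 - 1) ^+ 2)%:E)) (3 / 4) *
    poweR (\int[mu]_(y in `]0%R, 1%R[) ((`|g2 y| ^+ 2)%:E)) (1 / 4))%E in
  exists U V, [/\ prim 0 1 V U, prim 0 1 g2 V, U 0 = -1 /\ U 1 = 1, V 0 = 0 /\ V 1 = 0 &
    v = +oo%E \/ L1 0 1 (fun y => g2 y ^+ 2) /\
      v = (Int 0 1 (well U) `^ (3 / 4) * Int 0 1 (fun y => g2 y ^+ 2) `^ (1 / 4))%:E].
Proof.
move=> p1 Jw hw v.
have [U [V [pU pV wU [U0 U1] [V0 V1]]]] := Jclass_ends p1 Jw hw.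
exists U, V; split => //; rewrite {}/v.
have A0 := well_Int_gt0 pU U0 U1; set A := Int 0 1 (well U) in A0.
have mw : measurable_fun `](0 : R), (1 : R)[ w by case: hw => -[].
have mg := L1_meas (prim_L1 pV).
have lw : L1 0 1 (well w).
  apply: (L1_ae (f := well U)); last 2 first.
  - exact: L1_well pU.
  - by apply: ae_onS wU => x _; rewrite /well => ->.
  - by apply: measurable_funX; apply: measurable_funB => //; exact: measurable_funX.
have -> : (\int[mu]_(y in `]0%R, 1%R[) ((w y ^+ 2 - 1) ^+ 2)%:E = A%:E)%E.
  rewrite Int_EFin//; congr EFin; apply: Int_ae.
  - exact: L1_meas lw.
  - exact: L1_meas (L1_well pU).
  - by apply: ae_onS wU => x _; rewrite /well => ->.
rewrite poweR_EFin.
have [lg2|] := ltP (\int[mu]_(y in `]0%R, 1%R[) (`|g2 y| ^+ 2)%:E)%E +oo%E; last first.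
  by rewrite leye_eq => /eqP ->; left; rewrite poweRyr ?gt0_muley// lte_fin powR_gt0.
have l2 : L1 0 1 (fun y => g2 y ^+ 2).
  apply: (eq_L1 (f := fun y => `|g2 y| ^+ 2)); first by move=> y _; rewrite real_normK ?num_real.
  by apply: L1_ge0 => //; apply: measurable_funX; exact: measurableT_comp.
right; split => //.
have -> : (\int[mu]_(y in `]0%R, 1%R[) (`|g2 y| ^+ 2)%:E = (Int 0 1 (fun y => g2 y ^+ 2))%:E)%E.
  rewrite -Int_EFin//; apply: eq_integral => y _; by rewrite real_normK ?num_real.
by rewrite poweR_EFin EFinM.
Qed.

Lemma alpha_gt0 p : 1 <= p -> (0 < alpha p :> \bar R)%E.
Proof.
move=> p1; rewrite /alpha mule_gt0//.
pose c : R := 64^-1 ^+ 2 / 2; have c0 : 0 < c by rewrite divr_gt0// exprn_gt0// invr_gt0.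
apply: (@lt_le_trans _ _ c%:E); first by rewrite lte_fin.
apply: le_ereal_inf_tmp => _ [w Jw <-]; apply: le_ereal_inf_tmp => _ [g1 [g2 [hw ->]]].
have [U [V [pU pV [U0 U1] [V0 V1] [->|[l2 ->]]]]] := Jclass_value p1 Jw hw.
  exact: leey.
have A0 := well_Int_gt0 pU U0 U1; set A := Int 0 1 (well U) in A0 *.
set B := Int 0 1 (fun y => g2 y ^+ 2).
have [q [q0 qA _ ->]] := quarter_powers (ltW A0).
have qn : 0 < q by rewrite lt_neqAle q0 andbT; apply/eqP => q00; move: A0; rewrite -qA -q00 expr0n ltxx.
have B0 : 0 <= B by apply: Int_ge0 => y _; exact: sqr_ge0.
have [r [r0 rB -> _]] := quarter_powers B0.
rewrite lee_fin.
(* The crude bound on [0, 1] with eps = 1 / L holds for every L. The choice L = (B / A)^(1/4) makes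
   both summands equal to A^(3/4) B^(1/4), whence the constant c = 64^-2 / 2. *)
have key (L : R) : 0 < L -> 64^-1 ^+ 2 <= L * A + L ^- 3 * B.
  move=> L0; have L0' : 0 < L^-1 by rewrite invr_gt0.
  have [ld hd] := Int_dens L^-1 pU l2.
  have := min_transition_cost L0' ltr01 pU pV ld U0 U1 V0.
  by rewrite hd invrK (exprVn L 3).
have rn : 0 < r.
  rewrite lt_neqAle r0 andbT; apply/eqP => r00.
  (* B = 0 is impossible: for L = c / A the right-hand side of [key] would be c, half of the lower
     bound. *)
  have L0 : 0 < c / A by rewrite divr_gt0.
  have := key _ L0; rewrite -rB -r00 expr0n mulr0 addr0 divfK ?gt_eqF//.
  rewrite leNgt => /negP; apply; rewrite /c ltr_pdivrMr// ltr_pMr ?exprn_gt0 ?invr_gt0//; lra.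
have L0 : 0 < r / q by rewrite divr_gt0.
have := key _ L0; rewrite -qA -rB (_ : _ + _ = 2 * (q ^+ 3 * r)); last first.
  by field; rewrite !gt_eqF.
rewrite /c => h; lra.
Qed.

(** One Hermite piece of length eps on each side costs at most 164 sigma^2, hence 328. The extended
    function lives on [x - eps, y + eps], which may leave the original domain; this does no harm,
    since the exact bound holds on any interval. *)
Lemma transition_cost_up p eps x y sigma U V g : 1 <= p -> 0 < eps -> x < y ->
  prim x y V U -> prim x y g V -> inLp x y p g -> L1 x y (dens eps U g) -> sigma <= 1 ->
  `|U x + 1| <= sigma -> `|eps * V x| <= sigma ->
  `|U y - 1| <= sigma -> `|eps * V y| <= sigma ->
  (2%:E * alpha p <= (Int x y (dens eps U g) + 328 * sigma ^+ 2)%:E)%E.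
Proof.
move=> p1 e0 xy pU pV lg ld sg1 Ux Vx Uy Vy.
have [Q [Q1 [Q2 []]]] := hermite_in (x - eps) p1 e0 (or_intror erefl : -1 = 1 \/ -1 = -1 :> R) sg1 Ux Vx.
rewrite subrK => pQ pQ1 lQ [b1 b2 b3 b4] [ldQ hQ].
have [P [P1 [P2 [pP pP1 lP [c1 c2 c3 c4] [ldP hP]]]]] := hermite_out y p1 e0 (or_introl erefl : 1 = 1 \/ 1 = -1 :> R) sg1 Uy Vy.
have en : eps != 0 by rewrite gt_eqF.
have e1 : Q x = U x by rewrite b2; ring.
have e2 : Q1 x = V x by apply: (mulfI en).
have e3 : U y = P y by rewrite c1; ring.
have e4 : V y = P1 y by apply: (mulfI en).
have xe : x - eps < x by lra.
have ye : y < y + eps by lra.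
have pUP := prim_glue pU pP e3; have pVP := prim_glue pV pP1 e4.
have lgP := inLp_glue p1 lg lP.
have ldUP : L1 x (y + eps) (dens eps (glue y U P) (glue y g P2)) by rewrite dens_glue; exact: L1_glue.
have xye : x <= y + eps by rewrite (le_trans (ltW xy))// ltW.
have f1 : Q x = glue y U P x by rewrite glue_lt.
have f2 : Q1 x = glue y V P1 x by rewrite glue_lt.
have pW := prim_glue pQ pUP f1; have pW1 := prim_glue pQ1 pVP f2.
have lW := inLp_glue p1 lQ lgP.
have ldW : L1 (x - eps) (y + eps) (dens eps (glue x Q (glue y U P)) (glue x Q2 (glue y g P2))).
  by rewrite dens_glue; exact: L1_glue.
have lt2 : x - eps < y + eps by lra.
have := exact_transition_cost p1 e0 lt2 pW pW1 lW ldW.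
rewrite !(glue_lt _ _ xe) !glue_ge ?(ltW ye)// => /(_ b1 c2 b3 c4) /le_trans; apply.
rewrite lee_fin dens_glue Int_glue ?(ltW xe)// dens_glue Int_glue ?(ltW xy) ?(ltW ye)//.
have -> : 328 * sigma ^+ 2 = 164 * sigma ^+ 2 + 164 * sigma ^+ 2 by ring.
lra.
Qed.

Lemma transition_cost p eps x y sigma s U V g : 1 <= p -> 0 < eps -> x < y ->
  prim x y V U -> prim x y g V -> inLp x y p g -> L1 x y (dens eps U g) -> sigma <= 1 ->
  s = 1 \/ s = -1 ->
  `|U x - s| <= sigma -> eps * `|V x| <= sigma ->
  `|U y + s| <= sigma -> eps * `|V y| <= sigma ->
  (2%:E * alpha p <= (Int x y (dens eps U g) + 328 * sigma ^+ 2)%:E)%E.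
Proof.
move=> p1 e0 xy pU pV lg ld sg1 [->|->] Ux Vx Uy Vy.
  have e : dens eps (fun x => -1 * U x) (fun x => -1 * g x) = dens eps U g.
    by apply/funext => t; rewrite /dens; ring.
  rewrite -e; apply: (transition_cost_up p1 e0 xy (primZ (-1) pU) (primZ (-1) pV)).
  - exact: inLp_scale.
  - by rewrite e.
  - exact: sg1.
  - by rewrite mulN1r -normrN opprD opprK.
  - by rewrite mulN1r mulrN normrN normrM gtr0_norm.
  - by rewrite mulN1r -normrN opprD !opprK.
  - by rewrite mulN1r mulrN normrN normrM gtr0_norm.
rewrite opprK in Ux.
by apply: (transition_cost_up p1 e0 xy pU pV) => //; rewrite normrM gtr0_norm.
Qed.

End TransitionCost.

(** * Alternation of values, piecewise constancy and essential variation *)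

Section Structure.
Context {R : realType}.
Notation mu := (@lebesgue_measure R).
Implicit Types (a b c d x y z s t lo : R) (u v : R -> R) (ts : seq R).

Lemma ae_on_cat a b c (P : R -> Prop) : ae_on a c P -> ae_on c b P -> ae_on a b P.
Proof.
move=> h1 h2; have h3 : {ae mu, forall x, x <> c}.
  exists [set c]; split => //; first exact: lebesgue_measure_set1.
  by move=> x /= /contrapT.
move: h1 h2 h3; rewrite /ae_on => h1 h2; apply: filterS3 h1 h2; first exact: (ae_filter_ringOfSetsType mu).
move=> x /= h1 h2 xc; rewrite in_itv/= => /andP[ax xb].
have [lt|gt|//] := ltgtP x c; first by apply: h1; rewrite in_itv/= ax.
by apply: h2; rewrite in_itv/= gt.
Qed.

(* The last clause makes alternation of the values of u at good points an invariant of
   the almost everywhere class of u. *)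
Definition good u a b x := [/\ a < x < b, u x = 1 \/ u x = -1 &
  forall c d, c < x < d -> ~ ae_on c d (fun y => u y <> u x)].

(** It suffices to test intervals with rational endpoints: each one on which the value s is attained
    only on a null set contributes a null set of bad points, and there are countably many. [P s n]
    enumerates them through [unpickle]. *)
Lemma ae_good u a b : ae_on a b (fun x => u x = 1 \/ u x = -1) -> ae_on a b (good u a b).
Proof.
move=> hu.
pose P s n x := if unpickle n is Some (q, r) then
  ae_on (ratr q) (ratr r) (fun y => u y <> s) -> ratr q < x < (ratr r : R) -> u x <> s else True.
have aeP s : {ae mu, forall x, forall n, P s n x}.
  apply/ae_foralln => n; rewrite /P; case: unpickle => [[q r]|]; last exact: aeW.
  have [h|h] := pselect (ae_on (ratr q) (ratr r) (fun y => u y <> s)); last by apply: aeW.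
  move: (h); rewrite {1}/ae_on; apply: filterS; first exact: (ae_filter_ringOfSetsType mu).
  by move=> x /= hx _ xqr; apply: hx; rewrite in_itv.
move: hu (aeP 1) (aeP (-1)); rewrite /ae_on => h1 h2; apply: filterS3 h1 h2; first exact: (ae_filter_ringOfSetsType mu).
move=> x /= hx p1 pm1; rewrite in_itv/= => xab; have ux : u x = 1 \/ u x = -1 by apply: hx; rewrite in_itv.
split => // c d /andP[cx xd] h.
have [q] := rat_in_itvoo cx; rewrite in_itv/= => /andP[cq qx].
have [r] := rat_in_itvoo xd; rewrite in_itv/= => /andP[xr rd].
have hqr : ae_on (ratr q) (ratr r) (fun y => u y <> u x) by apply: ae_on_sub h; exact: ltW.
case: ux => ux; [have := p1 (pickle (q, r))|have := pm1 (pickle (q, r))];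
  by rewrite /P pickleK -ux => /(_ hqr); rewrite qx xr => /(_ isT).
Qed.

(** A combinatorial substitute for essential variation: n + 1 alternations force variation at least
    2 n, and the failure of some fixed length forces piecewise constancy. *)
Fixpoint alt u a b s n lo : Prop :=
  if n is m.+1 then exists x, [/\ lo < x, good u a b x, u x = s & alt u a b (- s) m x]
  else True.

Lemma alt_le u a b s n lo lo' : lo' <= lo -> alt u a b s n lo -> alt u a b s n lo'.
Proof.
by case: n => [//|n] le [x [lox gx ux ax]]; exists x; split => //; exact: le_lt_trans lox.
Qed.

(** L^p convergence sees only sets of positive measure, so the alternating points are fattened to
    separated intervals, each attaining its value on a non-null set by the last clause of [good]. *)
Lemma alt_intervals u a b s n lo : a <= lo -> alt u a b s n lo ->
  exists c d : nat -> R, [/\ forall i, (i < n)%N -> [/\ lo < c i, c i < d i & d i < b],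
    forall i, (i.+1 < n)%N -> d i < c i.+1 &
    forall i, (i < n)%N -> ~ ae_on (c i) (d i) (fun y => u y <> s * (-1) ^+ i)].
Proof.
elim: n s lo => [|n ih] s lo alo; first by exists (fun=> 0), (fun=> 0).
move=> /= [x [lox gx ux ax]]; have [/andP[xa xb] _ hx] := gx.
have [c [d [h1 h2 h3]]] := ih _ _ (ltW xa) ax.
(* m keeps the new interval, which ends halfway between x and m, strictly inside ]a, b[ and strictly
   before the next one, if there is a next one. *)
have [m [xm mb mc]] : exists m, [/\ x < m, m <= b & (0 < n)%N -> m <= c 0%N].
  case: n {ih ax h2 h3} h1 => [|n] h1; first by exists b.
  exists (Num.min b (c 0%N)); rewrite lt_min xb ge_min lexx ge_min lexx orbT.
  by split => //; case: (h1 0%N).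
exists (fun i => if i is j.+1 then c j else (lo + x) / 2).
exists (fun i => if i is j.+1 then d j else (x + m) / 2).
split.
- move=> [_|i]; first by split; lra.
  by rewrite ltnS => /h1[xc cd db]; split => //; exact: lt_trans xc.
- move=> [|i]; rewrite ltnS; last exact: h2.
  by move=> /mc => h; lra.
- move=> [_|i]; last first.
    by rewrite ltnS => /h3; rewrite exprS mulrA mulrN1.
  by rewrite mulr1 -ux; apply: hx; apply/andP; split; lra.
Qed.

Fixpoint pw s ts x : R := if ts is t :: ts' then (if x < t then s else pw (- s) ts' x) else s.

Lemma pw_lt s t ts x : path <%R t ts -> x <= t -> pw s ts x = s.
Proof. by case: ts => [//|t' ts] /= /andP[tt' _] xt; rewrite (le_lt_trans xt tt'). Qed.

Lemma pw_cons s t ts x : path <%R t ts -> pw s (t :: ts) x = pw (- s) ts x + (if x < t then 2 * s else 0).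
Proof.
move=> pt /=; case: ifP => xt; last by rewrite addr0.
by rewrite (pw_lt _ pt (ltW xt)); ring.
Qed.

(** Induction on the forbidden length n. The first jump is the infimum t of the good points with
    value -s: before t, u = s almost everywhere, and beyond t the forbidden length drops by one. *)
Lemma structure u a b s n lo : s = 1 \/ s = -1 -> a <= lo -> lo < b ->
  ae_on a b (good u a b) -> ~ alt u a b (- s) n lo ->
  exists s' ts, [/\ s' = 1 \/ s' = -1, path <%R lo ts, all (fun t => t < b) ts &
    ae_on lo b (fun x => u x = pw s' ts x)].
Proof.
move=> s1 alo lob hg; elim: n s lo s1 alo lob => [s lo _ _ _ /(_ I)//|n ih] s lo s1 alo lob nalt.
pose S := [set x | [/\ lo < x, good u a b x & u x = - s]].
have goodE x : good u a b x -> lo < x -> ~ S x -> u x = s.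
  move=> gx lox Sx; have [_ ux _] := gx; case: s1 => s1.
    by case: ux => ux; [rewrite ux s1|exfalso; apply: Sx; rewrite /S /= ux s1].
  by case: ux => ux; [exfalso; apply: Sx; rewrite /S /= ux s1 opprK|rewrite ux s1].
have [[x0 Sx0]|S0] := pselect (exists x, S x); last first.
  exists s, [::]; split => //; apply: (@ae_onS R lo b (good u a b)); last exact: ae_on_sub hg.
  by move=> x /andP[lox _] gx; apply: goodE => // Sx; apply: S0; exists x.
have hS : has_inf S by split; [exists x0|exists lo => x [/ltW]].
pose t := inf S.
have lot : lo <= t by apply: lb_le_inf; [exists x0|move=> x [/ltW]].
have tx0 : t <= x0 by apply: ge_inf => //; exact: hS.2.
have x0b : x0 < b by have [_ [/andP[]]] := Sx0.
have tb : t < b by exact: le_lt_trans x0b.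
have hlt : ae_on lo t (fun x => u x = s).
  apply: (@ae_onS R lo t (good u a b)); last by apply: ae_on_sub hg => //; exact: ltW.
  move=> x /andP[lox xt] gx; apply: goodE => // Sx.
  by have := ge_inf hS.2 Sx; rewrite leNgt xt.
(* An alternation beyond t that starts with s could be prolonged on the left by a point of S lying
   between t and its first point. For n = 0 the point x0 alone is already a forbidden
   alternation. *)
have nalt' : ~ alt u a b (- - s) n t.
  rewrite opprK => at'; apply: nalt; case: n ih at' => [_ _|n _ [y [ty gy uy ay]]] /=.
    by exists x0; have [? ? ?] := Sx0.
  have [x Sx xy] := @inf_lt _ S y (ex_intro _ x0 Sx0) ty.
  have [lox gx ux] := Sx; exists x; split => //; exists y.
  by split; rewrite ?opprK.
have ms1 : - s = 1 \/ - s = -1 by case: s1 => ->; [right|left; rewrite opprK].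
have [s' [ts [s1' pts tsb hts]]] := ih (- s) t ms1 (le_trans alo lot) tb nalt'.
move: lot hlt; rewrite le_eqVlt => /orP[/eqP -> _|lot hlt]; first by exists s', ts.
(* The case s' = s is accepted and not excluded: u is then equal to s on both sides of t and no jump
   is recorded there. *)
have [s's|s's] : s' = s \/ s' = - s.
  by case: s1 s1' => -> [->|->]; rewrite ?opprK; [left|right|right|left].
  exists s', ts; split => //; first by apply: path_le pts; [exact: lt_trans|exact: lot].
  apply: ae_on_cat hts; apply: ae_onS hlt => x /andP[_ xt] ->.
  by rewrite (pw_lt _ pts (ltW xt)).
exists s, (t :: ts); split => //=; [by rewrite lot|by rewrite tb|].
apply: (@ae_on_cat _ _ t).
  by apply: ae_onS hlt => x /andP[_ ->].
by apply: ae_onS hts => x /andP[tx _] ->; rewrite ltNge (ltW tx)/= s's.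
Qed.

Lemma pw_alt u a b s lo ts : a <= lo -> lo < b -> path <%R lo ts ->
  all (fun t => t < b) ts -> ae_on a b (good u a b) ->
  ae_on lo b (fun x => u x = pw s ts x) -> alt u a b s (size ts).+1 lo.
Proof.
move=> alo lob pts tsb hg; elim: ts s lo alo lob pts tsb => [|t ts ih] s lo alo lob pts tsb hu.
  have [y [/andP[loy yb] [gy uy]]] := ae_on_exists (lexx lo) lob (lexx b) (ae_onI (ae_on_sub alo (lexx b) hg) hu).
  by exists y.
move: pts tsb => /= /andP[lot pts] /andP[tb tsb].
have hg' := ae_on_sub alo (lexx b) hg.
have [y [/andP[loy yt] [gy uy]]] := ae_on_exists (lexx lo) lot (ltW tb) (ae_onI hg' hu).
exists y; split => //; first by rewrite uy /= yt.
have h : alt u a b (- s) (size ts).+1 t.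
  apply: (ih (- s) t (le_trans alo (ltW lot)) tb pts tsb).
  apply: ae_onS (ae_on_sub (ltW lot) (lexx b) hu).
  by move=> x /andP[tx _] ->; rewrite /= ltNge (ltW tx).
exact: alt_le (ltW yt) h.
Qed.

(** The first jump splits off as a monotone step of height 2, whose increments along increasing
    points telescope to at most 2; the other jumps follow by induction. *)
Lemma sum_pw s lo ts (x : nat -> R) n : s = 1 \/ s = -1 -> path <%R lo ts ->
  (forall i, (i < n)%N -> x i < x i.+1) ->
  \sum_(i < n) `|pw s ts (x i.+1) - pw s ts (x i)| <= 2 * (size ts)%:R.
Proof.
move=> s1 pts hx; elim: ts s lo s1 pts => [|t ts ih] s lo s1 pts.
  by rewrite mulr0 big1// => i _; rewrite subrr normr0.
move: pts => /= /andP[lot pts].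
have ms1 : - s = 1 \/ - s = -1 by case: s1 => ->; [right|left; rewrite opprK].
have h1 := ih (- s) t ms1 pts.
pose f y : R := if y < t then 1 else 0.
have tel : \sum_(i < n) (f (x i) - f (x i.+1)) <= 1.
  have -> : \sum_(i < n) (f (x i) - f (x i.+1)) = f (x 0%N) - f (x n).
    elim: (n) => [|k ihk]; first by rewrite big_ord0 subrr.
    by rewrite big_ord_recr/= ihk; ring.
  by rewrite /f; do 2 case: ifP => _; lra.
have : \sum_(i < n) `|pw s (t :: ts) (x i.+1) - pw s (t :: ts) (x i)| <=
    \sum_(i < n) (`|pw (- s) ts (x i.+1) - pw (- s) ts (x i)| + 2 * (f (x i) - f (x i.+1))).
  apply: ler_sum => i _; rewrite !(pw_cons _ _ pts).
  set A := pw _ _ _; set B := pw _ _ _.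
  have e : (if x i.+1 < t then 2 * s else 0) - (if x i < t then 2 * s else 0) = - (2 * s) * (f (x i) - f (x i.+1)).
    by rewrite /f; do 2 case: ifP => _; ring.
  have f0 : 0 <= f (x i) - f (x i.+1).
    rewrite /f; case: ifPn => h; case: ifPn => h'; rewrite ?subrr ?subr0//.
    by move: h; rewrite (lt_trans (hx i (ltn_ord i)) h').
  rewrite (_ : A + _ - _ = (A - B) + - (2 * s) * (f (x i) - f (x i.+1))); last by rewrite -e; ring.
  rewrite (le_trans (ler_normD _ _))// lerD2l normrM (ger0_norm f0) ler_wpM2r// normrN normrM.
  by case: s1 => ->; rewrite ?normrN normr1 mulr1 ger0_norm.
rewrite big_split/= -mulr_sumr => /le_trans; apply.
have -> : (size ts).+1%:R = (size ts)%:R + 1 :> R by rewrite -natr1.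
rewrite mulrDr mulr1; lra.
Qed.

Lemma essVar_pw_le u a b s ts : s = 1 \/ s = -1 -> path <%R a ts ->
  ae_on a b (fun x => u x = pw s ts x) -> (essVar a b u <= (2 * (size ts)%:R)%:E)%E.
Proof.
move=> s1 pts hu; apply: (@le_trans _ _ (Var a b (pw s ts))).
  by apply: ereal_inf_lbound; exists (pw s ts) => //=; apply: ae_onS hu => x _ ->.
by apply: ge_ereal_sup => _ [n [x [_ [hx ->]]]]; rewrite lee_fin; exact: sum_pw pts hx.
Qed.

(** A representative may change u at any chosen point but not on a non-null set, so every
    representative still takes the n + 1 alternating values, one in each of the separated
    intervals. *)
Lemma essVar_alt_ge u a b s n : s = 1 \/ s = -1 -> alt u a b s n.+1 a ->
  ((2 * n%:R)%:E <= essVar a b u)%E.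
Proof.
move=> s1 /(alt_intervals (lexx a))[c [d [h1 h2 h3]]].
apply: le_ereal_inf_tmp => _ [v vu <-].
have hy i : exists y, (i < n.+1)%N -> c i < y < d i /\ v y = s * (-1) ^+ i.
  have [i_n|i_n] := boolP (i < n.+1)%N; last by exists 0.
  have [ac cd db] := h1 i i_n; apply: contrapT => no; apply: (h3 i i_n).
  apply: (@ae_onS _ _ _ (fun x => v x = u x)); last first.
    by apply: (@ae_on_sub _ a b); [exact: ltW|exact: ltW|exact: vu].
  by move=> y ycd vy uy; apply: no; exists y => _; rewrite vy.
have [y hy'] := choice hy.
apply: ereal_sup_ubound; exists n, y; split; [|split].
- move=> i i_n; have [ac cd db] := h1 i i_n; have [/andP[cy yd] _] := hy' i i_n.
  by rewrite (lt_trans ac)//= (lt_trans yd).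
- move=> i i_n; have [/andP[_ yd] _] := hy' i (ltnW i_n).
  have [/andP[cy _] _] := hy' i.+1 i_n; exact: lt_trans yd (lt_trans (h2 i i_n) cy).
- congr EFin; rewrite (eq_bigr (fun=> 2)); last first.
    move=> i _; have [_ ->] := hy' i (ltnW (ltn_ord i)).
    have [_ ->] := hy' i.+1 (ltn_ord i); rewrite exprS mulN1r.
    have -> : s * - (-1) ^+ i - s * (-1) ^+ i = - (2 * (s * (-1) ^+ i)) by ring.
    rewrite normrN !normrM normrX normrN normr1 expr1n mulr1.
    by case: s1 => ->; rewrite ?normrN normr1 mulr1 ger0_norm.
  by rewrite sumr_const card_ord mulr_natr.
Qed.

End Structure.

(** * Consequences of bounded energy *)

Section LowerBound.
Context {R : realType}.
Notation mu := (@lebesgue_measure R).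
Implicit Types (a b c d x y z s t eps tau p M : R) (u v U V g : R -> R).

Lemma measurable_if a b (B : R -> bool) : measurable_fun `]a, b[ B ->
  measurable_fun `]a, b[ (fun x => if B x then 1 else 0 : R).
Proof.
move=> mB; apply: measurable_fun_if => //.
Qed.

Lemma L1_if a b (B : R -> bool) : measurable_fun `]a, b[ B ->
  L1 a b (fun x => if B x then 1 else 0 : R).
Proof.
move=> mB; apply: (@L1_bounded _ _ _ _ 1); first exact: measurable_if.
by move=> x _; case: ifP => _; rewrite ?normr1 ?normr0.
Qed.

Lemma Int_eq0_ae a b f : L1 a b f -> (forall x, a < x < b -> 0 <= f x) -> Int a b f = 0 ->
  ae_on a b (fun x => f x = 0).
Proof.
move=> lf f0 If; have mf := measurable_int mu lf.
have : (\int[mu]_(x in `]a, b[) `|(EFin \o f) x| = 0)%E.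
  transitivity (\int[mu]_(x in `]a, b[) (f x)%:E)%E.
    apply: eq_integral => x; rewrite inE/= in_itv/= => xab.
    by rewrite ger0_norm ?f0.
  by rewrite Int_EFin// If.
move=> /(ae_eq_integral_abs mu (measurable_itv _) mf).1 [A [mA A0 sub]].
exists A; split => // x /= nx; apply: sub => /= h; apply: nx; rewrite in_itv/= => xab.
by have := h; rewrite in_itv/= => /(_ xab) [].
Qed.

Lemma inLp_sub a b c d p u : a <= c -> d <= b -> inLp a b p u -> inLp c d p u.
Proof.
move=> ac db /inLpP[mu lu]; apply/inLpP; split; last exact: L1_sub lu.
apply: measurable_funS mu => //; apply: subset_itv; by rewrite bnd_simp.
Qed.

(** Suppose no cell of length eps is near s. A cell of energy above tau^2 pays for its share of the
    set u = s through eps / tau^2 times its energy; any other cell is near -s, where |U - u| >= 1 on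
    that set. The incomplete last cell accounts for the term eps. The sum contradicts the measure
    hypothesis. *)
Lemma select_point p eps tau s c d u U V g : 1 <= p -> 0 < eps -> 0 < tau ->
  32 * tau <= 1 / 2 -> s = 1 \/ s = -1 -> c < d ->
  prim c d V U -> prim c d g V -> L1 c d (dens eps U g) ->
  measurable_fun `]c, d[ u -> L1 c d (fun x => `|U x - u x| `^ p) ->
  eps / tau ^+ 2 * Int c d (dens eps U g) + Int c d (fun x => `|U x - u x| `^ p) + eps <
    Int c d (fun x => if u x == s then 1 else 0) ->
  exists2 z, c <= z <= d & `|U z - s| <= 32 * tau /\ eps * `|V z| <= 32 * tau.
Proof.
move=> p1 e0 t0 t1 s1 cd pU pV ld mu' lp; set S := (fun x => if u x == s then 1 else 0).
move=> hm; apply: contrapT => no.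
have lS : L1 c d S.
  by apply: L1_if; apply: measurable_fun_eqr => //; exact: measurable_cst.
have S1 x : 0 <= S x <= 1 by rewrite /S; case: ifP => _; rewrite lexx ler01.
pose N := Num.truncn ((d - c) / eps).
have dc0 : 0 <= (d - c) / eps by rewrite divr_ge0 ?ltW// subr_gt0.
have /andP[N1 N2] := truncn_itv dc0.
pose x (k : nat) := c + k%:R * eps.
have xS k : x k.+1 = x k + eps by rewrite /x -natr1 mulrDl mul1r addrA.
have xN : x N <= d by move: N1; rewrite /x ler_pdivlMr// -/N => h; lra.
have xN1 : d <= x N + eps by move: N2; rewrite -xS /x ltr_pdivrMr// -/N => h; lra.
have xc k : c <= x k by rewrite /x lerDl mulr_ge0// ltW.
have xd k : (k <= N)%N -> x k <= d.
  by move=> kN; apply: le_trans xN; rewrite /x lerD2l ler_wpM2r ?ler_nat// ltW.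
have cell k : (k < N)%N -> Int (x k) (x k + eps) S <=
    eps / tau ^+ 2 * Int (x k) (x k + eps) (dens eps U g) +
    Int (x k) (x k + eps) (fun x => `|U x - u x| `^ p).
  move=> kN; have xkd : x k + eps <= d by rewrite -xS; exact: xd.
  have xk : x k <= x k + eps by rewrite lerDl ltW.
  have sub f : L1 c d f -> L1 (x k) (x k + eps) f by apply: L1_sub.
  have P0 : 0 <= Int (x k) (x k + eps) (fun x => `|U x - u x| `^ p).
    by apply: Int_ge0 => z _; exact: powR_ge0.
  have D0 : 0 <= Int (x k) (x k + eps) (dens eps U g).
    by apply: Int_ge0 => z _; exact: dens_ge0.
  have [low|high] := leP (Int (x k) (x k + eps) (dens eps U g)) (tau ^+ 2); last first.
    apply: (@le_trans _ _ eps).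
      have := @Int_le_cst _ (x k) (x k + eps) 1 S xk (sub _ lS) (fun z _ => (andP (S1 z)).2).
      by move/le_trans; apply; rewrite mul1r; lra.
    rewrite ler_wpDr// -mulrA ler_peMr ?(ltW e0)// mulrC ler_pdivlMr ?exprn_gt0// mul1r.
    exact: ltW.
  have [s' s'1 hs'] := low_energy_cell e0 t0 (prim_sub (xc k) xkd pU) (prim_sub (xc k) xkd pV) (sub _ ld) low.
  have [ss|ss] : s' = s \/ s' = - s.
    by case: s1 s'1 => -> [->|->]; rewrite ?opprK; [left|right|right|left].
    exfalso; apply: no; exists (x k); first by rewrite xc xd// ltnW.
    by rewrite -ss; apply: hs'; rewrite lexx.
  apply: (@le_trans _ _ (Int (x k) (x k + eps) (fun x => `|U x - u x| `^ p))); last first.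
    by rewrite ler_wpDl// mulr_ge0// divr_ge0 ?exprn_ge0 ?ltW.
  apply: le_Int; [exact: sub|exact: sub|] => z /andP[xz ze].
  rewrite /S; case: ifP => [/eqP ->|_]; last exact: powR_ge0.
  have zk : x k <= z <= x k + eps by rewrite !ltW.
  have [+ _] := hs' z zk; rewrite ss opprK => h.
  have : 1 <= `|U z - s|.
    have : `|2 * s| <= `|U z - s| + `|U z + s|.
      by rewrite distrC (_ : 2 * s = (s - U z) + (U z + s)) ?ler_normD//; ring.
    have -> : `|2 * s| = 2 by case: s1 => ->; rewrite ?mulrN1 ?normrN ?mulr1 ger0_norm.
    lra.
  move=> h1; apply: (@le_trans _ _ (1 `^ p)); first by rewrite powR1.
  by rewrite ge0_ler_powR ?nnegrE// (le_trans ler01 p1).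
have sum k : (k <= N)%N -> Int c (x k) S <=
    eps / tau ^+ 2 * Int c (x k) (dens eps U g) + Int c (x k) (fun x => `|U x - u x| `^ p).
  elim: k => [_|k ih kN]; first by rewrite /x mul0r addr0 !Int_ge// mulr0 addr0.
  have kd := xd _ kN; have kk : x k <= x k.+1 by rewrite xS lerDl ltW.
  rewrite !(@Int_cat _ c (x k.+1) (x k)) ?xc//; try by [exact: (L1_sub (lexx c) kd)].
  by have := ih (ltnW kN); have := cell k kN; rewrite -xS; lra.
have h1 := sum N (leqnn N).
have h2 : Int (x N) d S <= eps.
  have lSN : L1 (x N) d S by apply: L1_sub lS.
  have := Int_le_cst xN lSN (fun z _ => (andP (S1 z)).2); rewrite mul1r; lra.
have h3 : Int c (x N) (dens eps U g) <= Int c d (dens eps U g).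
  by apply: le_Int_sub => // z _; exact: dens_ge0.
have h4 : Int c (x N) (fun x => `|U x - u x| `^ p) <= Int c d (fun x => `|U x - u x| `^ p).
  by apply: le_Int_sub => // z _; exact: powR_ge0.
have h5 : eps / tau ^+ 2 * Int c (x N) (dens eps U g) <= eps / tau ^+ 2 * Int c d (dens eps U g).
  by rewrite ler_wpM2l// divr_ge0 ?exprn_ge0 ?ltW.
move: hm; rewrite (@Int_cat _ c d (x N) S)//; lra.
Qed.

Lemma Feps_lt a b p eps u M : a <= b -> 1 <= p -> 0 < eps -> (Feps a b p eps u < M%:E)%E ->
  exists U V g, [/\ prim a b V U, prim a b g V, inLp a b p g, ae_on a b (fun x => u x = U x) &
    L1 a b (dens eps U g) /\ Int a b (dens eps U g) < M].
Proof.
move=> ab p1 e0 /ereal_inf_lt[_ [g1 [g2 [hu ->]]] hM].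
have [U [V [pU pV uU _]]] := W2p_prim ab p1 hu.
have [[mu' _] [_ [lg _]]] := hu.
have mg := L1_meas (prim_L1 pV).
have md f : measurable_fun `]a, b[ f -> measurable_fun `]a, b[ (dens eps f g2).
  move=> mf; rewrite /dens; apply: measurable_funD; apply: measurable_funM; try exact: measurable_cst.
    by apply: measurable_funX; apply: measurable_funB; [exact: measurable_funX|exact: measurable_cst].
  exact: measurable_funX.
have e : (\int[mu]_(x in `]a, b[) (eps^-1 * (u x ^+ 2 - 1) ^+ 2 + eps ^+ 3 * `|g2 x| ^+ 2)%:E =
    \int[mu]_(x in `]a, b[) (dens eps u g2 x)%:E)%E.
  by apply: eq_integral => x _; rewrite real_normK ?num_real.
have ldu : L1 a b (dens eps u g2).
  apply: L1_ge0; first exact: md.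
    by move=> x _; exact: dens_ge0.
  by rewrite -e (lt_le_trans hM) ?leey.
have uU' : ae_on a b (fun x => dens eps u g2 x = dens eps U g2 x).
  by apply: ae_onS uU => x _; rewrite /dens => ->.
have mU := md _ (prim_measurable pU).
have ldU := L1_ae mU ldu uU'.
exists U, V, g2; split => //; split => //.
by rewrite -(Int_ae (md _ mu') mU uU') -lte_fin -Int_EFin// -e.
Qed.

Lemma Feps_ge0 a b p eps u : 0 < eps -> (0 <= Feps a b p eps u)%E.
Proof.
move=> e0; apply: le_ereal_inf_tmp => _ [g1 [g2 [_ ->]]].
apply: integral_ge0 => x _; rewrite lee_fin.
by have := dens_ge0 u (fun x => `|g2 x|) x e0.
Qed.

Lemma Lpdist_small a b p (un : nat -> R -> R) u rho : 0 < p -> 0 < rho ->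
  Lpdist a b p (un n) u @[n --> \oo] --> 0%E ->
  exists N : nat, forall n, (N <= n)%N ->
    (\int[mu]_(x in `]a, b[) (`|un n x - u x| `^ p)%:E < rho%:E)%E.
Proof.
move=> p0 r0 h; have rp : 0 < rho `^ p^-1 by rewrite powR_gt0.
have : \forall n \near \oo, (Lpdist a b p (un n) u < (rho `^ p^-1)%:E)%E.
  have := h [set x | (x < (rho `^ p^-1)%:E)%E]; apply; apply: open_nbhs_nbhs; split.
    exact: open_ereal_lt_ereal.
  by rewrite /= lte_fin.
move=> [N _ hN]; exists N => n /hN /= hn; rewrite ltNge; apply/negP => h'.
move: hn; rewrite ltNge => /negP; apply; rewrite /Lpdist -poweR_EFin.
apply: gt0_ler_poweR => //.
- by rewrite invr_ge0 ltW.
- by rewrite in_itv/= lee_fin ltW// leey.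
- rewrite in_itv/= leey andbT; apply: integral_ge0 => x _; rewrite lee_fin; exact: powR_ge0.
Qed.

Lemma L1_powR_dist a b p u v : measurable_fun `]a, b[ u -> measurable_fun `]a, b[ v ->
  (\int[mu]_(x in `]a, b[) (`|u x - v x| `^ p)%:E < +oo)%E ->
  L1 a b (fun x => `|u x - v x| `^ p).
Proof.
move=> mu1 mv; apply: L1_ge0 => [|x _]; last exact: powR_ge0.
apply: (measurableT_comp (measurable_powR p)); apply: measurableT_comp => //.
exact: measurable_funB.
Qed.

Lemma Int_powR_dist a b p rho u v U V : ae_on a b (fun x => u x = U x) ->
  measurable_fun `]a, b[ u -> measurable_fun `]a, b[ v -> prim a b V U ->
  (\int[mu]_(x in `]a, b[) (`|u x - v x| `^ p)%:E < rho%:E)%E ->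
  L1 a b (fun x => `|U x - v x| `^ p) /\ Int a b (fun x => `|U x - v x| `^ p) < rho.
Proof.
move=> uU mu1 mv pU h.
have lu : L1 a b (fun x => `|u x - v x| `^ p).
  by apply: L1_powR_dist => //; exact: lt_le_trans h (leey _).
have mU : measurable_fun `]a, b[ (fun x => `|U x - v x| `^ p).
  apply: (measurableT_comp (measurable_powR p)); apply: measurableT_comp => //.
  by apply: measurable_funB => //; exact: prim_measurable pU.
have e : ae_on a b (fun x => `|u x - v x| `^ p = `|U x - v x| `^ p).
  by apply: ae_onS uU => x _ ->.
split; first exact: L1_ae mU lu e.
by rewrite -(Int_ae (L1_meas lu) mU e) -lte_fin -Int_EFin.
Qed.

(** Chebyshev: where | |u| - 1 | >= 2 tau, either |U - u| >= tau or | |U| - 1 | >= tau. The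
    indicator of this set is thus at most tau^-p |U - u|^p + tau^-2 eps times the energy density,
    whose integral is small for suitable indices; infinitely many of bounded energy suffice. *)
Lemma ae_pm1_of_bounded_energy a b p (eps : nat -> R) (un : nat -> R -> R) u M :
  a <= b -> 1 <= p -> (forall n, 0 < eps n) -> eps n @[n --> \oo] --> (0 : R) ->
  measurable_fun `]a, b[ u -> (forall n, inLp a b p (un n)) ->
  Lpdist a b p (un n) u @[n --> \oo] --> 0%E ->
  (forall N, exists2 n, (N <= n)%N & (Feps a b p (eps n) (un n) < M%:E)%E) ->
  ae_on a b (fun x => u x = 1 \/ u x = -1).
Proof.
move=> ab p1 e0 epscv mu1 lun dist hM.
have p0 : 0 < p by exact: lt_le_trans ltr01 p1.
pose B tau x := 2 * tau <= `| `|u x| - 1|.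
have mB tau : measurable_fun `]a, b[ (B tau).
  apply: measurable_fun_ler; first exact: measurable_cst.
  apply: measurableT_comp => //; apply: measurable_funB; last exact: measurable_cst.
  exact: measurableT_comp.
have null tau : 0 < tau -> ae_on a b (fun x => ~~ B tau x).
  move=> t0; have lB := L1_if (mB tau).
  have B0 x : 0 <= (if B tau x then 1 else 0) :> R by case: ifP => _; rewrite ?ler01 ?lexx.
  suff /(Int_eq0_ae lB (fun x _ => B0 x)) : Int a b (fun x => if B tau x then 1 else 0) = 0.
    by apply: ae_onS => x _; case: ifP => // _ /eqP; rewrite oner_eq0.
  apply/eqP; rewrite eq_le Int_ge0// andbT; apply/ler_addgt0Pl => e e_gt0; rewrite addr0.
  have tp : 0 < tau `^ p by exact: powR_gt0.
  have r0 : 0 < tau `^ p * (e / 2) by rewrite mulr_gt0// divr_gt0.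
  have [N1 hN1] := Lpdist_small p0 r0 dist.
  have M0 : 0 < `|M| + 1 by rewrite ltr_wpDl.
  have d0 : 0 < tau ^+ 2 * (e / 2) / (`|M| + 1).
    by rewrite divr_gt0// mulr_gt0 ?exprn_gt0// divr_gt0.
  have /cvgrPdist_lt/(_ _ d0)[N2 _ hN2] := epscv.
  have [n nN hn] := hM (maxn N1 N2); move: nN; rewrite geq_max => /andP[n1 n2].
  have := hN2 n n2; rewrite /= sub0r normrN gtr0_norm// => en.
  have [U [V [g [pU pV lg uU [ld hd]]]]] := Feps_lt ab p1 (e0 n) hn.
  have [lP hP] := Int_powR_dist uU (lun n).1 mu1 pU (hN1 n n1).
  have lG : L1 a b (fun x => (tau `^ p)^-1 * `|U x - u x| `^ p + (tau ^- 2 * eps n) * dens (eps n) U g x).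
    by apply: L1D; exact: L1Z.
  apply: (@le_trans _ _ (Int a b (fun x => (tau `^ p)^-1 * `|U x - u x| `^ p + (tau ^- 2 * eps n) * dens (eps n) U g x))).
    apply: le_Int => // x _.
    have P0 : 0 <= (tau `^ p)^-1 * `|U x - u x| `^ p by rewrite mulr_ge0 ?invr_ge0 ?powR_ge0.
    have D0 : 0 <= tau ^- 2 * eps n * dens (eps n) U g x.
      by rewrite mulr_ge0 ?dens_ge0// mulr_ge0 ?invr_ge0 ?sqr_ge0// ltW.
    case: ifP => [Bx|_]; last exact: addr_ge0.
    have [far|close] := leP tau `|U x - u x|.
      rewrite ler_wpDr// ler_pdivlMl// mulr1 ge0_ler_powR ?nnegrE//; exact: ltW.
    have Utau : tau <= `| `|U x| - 1|.
      have h1 : `| `|U x| - `|u x| | <= `|U x - u x| by exact: ler_dist_dist.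
      have h2 : `| `|u x| - 1| <= `| `|U x| - `|u x| | + `| `|U x| - 1|.
        rewrite [leRHS]addrC (_ : `|u x| - 1 = (`|U x| - 1) - (`|U x| - `|u x|)); last by ring.
        exact: ler_normB.
      by move: Bx; rewrite /B; lra.
    have h3 : tau ^+ 2 <= (U x ^+ 2 - 1) ^+ 2.
      rewrite -[leRHS]real_normK ?num_real// ler_pXn2r ?nnegrE// ?(ltW t0)//.
      apply: (le_trans Utau); rewrite -[U x ^+ 2]real_normK ?num_real//.
      rewrite (_ : `|U x| ^+ 2 - 1 = (`|U x| - 1) * (`|U x| + 1)); last by ring.
      by rewrite normrM ler_peMr// ger0_norm ?addr_ge0// lerDr.
    rewrite ler_wpDl// -mulrA ler_pdivlMl ?exprn_gt0// mulr1 (le_trans h3)//.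
    rewrite /dens mulrDr mulrA mulfV ?gt_eqF// mul1r lerDl mulr_ge0 ?(ltW (e0 n))//.
    by rewrite mulr_ge0 ?sqr_ge0// exprn_ge0// ltW.
  rewrite IntD; [|exact: L1Z|exact: L1Z]; rewrite !IntZ//.
  have i1 : (tau `^ p)^-1 * Int a b (fun x => `|U x - u x| `^ p) <= e / 2.
    by rewrite ler_pdivrMl//; exact: ltW.
  have i2 : tau ^- 2 * eps n * Int a b (dens (eps n) U g) <= e / 2.
    rewrite -mulrA ler_pdivrMl ?exprn_gt0//.
    apply: (@le_trans _ _ (eps n * (`|M| + 1))).
      by rewrite ler_wpM2l ?(ltW (e0 n))// (le_trans (ltW hd))// (le_trans (ler_norm M))// lerDl.
    by move: en; rewrite ltr_pdivlMr// => /ltW.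
  lra.
have aeN : {ae mu, forall x, forall n : nat, x \in `]a, b[ -> ~~ B (n.+1%:R^-1) x}.
  by apply/ae_foralln => n; apply: null; rewrite invr_gt0.
rewrite /ae_on; move: aeN; apply: filterS; first exact: (ae_filter_ringOfSetsType mu).
move=> x /= hx xab; have : `| `|u x| - 1| <= 0.
  apply/ler_addgt0Pl => e e_gt0; rewrite addr0.
  have [n hn] : exists n : nat, 2 * n.+1%:R^-1 <= e.
    exists (Num.truncn (2 / e)); rewrite ler_pdivrMr ?ltr0n// mulrC -ler_pdivrMr//.
    by rewrite ltW// truncnS_gt.
  by have := hx n xab; rewrite -ltNge => /ltW /le_trans; apply.
rewrite normr_le0 subr_eq0 => /eqP h.
by have [u0|u0] := leP 0 (u x); [left; rewrite -h ger0_norm|right; rewrite -h ltr0_norm// opprK].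
Qed.

End LowerBound.

(** * Every transition costs nearly 2 alpha *)

Section Liminf.
Context {R : realType}.
Notation mu := (@lebesgue_measure R).
Implicit Types (a b c d x y z s t tau p M : R) (u v U V g : R -> R).

Lemma not_ae_Int_gt0 c d u s : measurable_fun `]c, d[ u -> ~ ae_on c d (fun y => u y <> s) ->
  L1 c d (fun x => if u x == s then 1 else 0 : R) /\
  0 < Int c d (fun x => if u x == s then 1 else 0).
Proof.
move=> mu1 h; have lS : L1 c d (fun x => if u x == s then 1 else 0 : R).
  by apply: L1_if; apply: measurable_fun_eqr => //; exact: measurable_cst.
have S0 x : c < x < d -> 0 <= (if u x == s then 1 else 0 : R).
  by case: ifP => _ _; rewrite ?ler01 ?lexx.
split => //; rewrite lt_neqAle Int_ge0// andbT eq_sym; apply/negP => /eqP h0; apply: h.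
apply: ae_onS (Int_eq0_ae lS S0 h0) => x _; case: ifPn => [_ /eqP|+ _]; first by rewrite oner_eq0.
by move=> /eqP.
Qed.

(** Fixes the accuracy tau before eps is chosen: since 32 tau <= 1, the gluing error 328 (32 tau)^2
    is at most 328 * 32 * tau, which fits between c and some real c' <= 2 alpha. If alpha = +oo, c'
    = c + 1 serves. *)
Lemma margin p c : 1 <= p -> (c%:E < 2%:E * alpha p :> \bar R)%E ->
  exists2 tau, 0 < tau & 32 * tau <= 1 / 2 /\
    forall E : R, (2%:E * alpha p <= (E + 328 * (32 * tau) ^+ 2)%:E)%E -> c <= E.
Proof.
move=> p1 h; have [c' cc' hc'] : exists2 c', c < c' & (c'%:E <= 2%:E * alpha p)%E.
  move: h; case: (2%:E * alpha p)%E => [r|_|//]; last by exists (c + 1); [lra|rewrite leey].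
  by rewrite lte_fin => cr; exists r.
have [K K0 KE] : exists2 K : R, 0 < K & K = 328 * 32 by exists (328 * 32); [lra|].
pose tau := Num.min (1 / 64) ((c' - c) / K).
have t0 : 0 < tau by rewrite lt_min !divr_gt0// subr_gt0.
have t1 : tau <= 1 / 64 by rewrite ge_min lexx.
have t2 : tau <= (c' - c) / K by rewrite ge_min lexx orbT.
exists tau => //; split; first lra.
move=> E /(le_trans hc'); rewrite lee_fin => hE.
have h1 : (32 * tau) ^+ 2 <= 32 * tau.
  by rewrite expr2 ler_piMr//; [rewrite mulr_ge0// ltW|lra].
move: t2; rewrite ler_pdivlMr// KE => t2; lra.
Qed.

Lemma energy_lower a b p (eps : nat -> R) (un : nat -> R -> R) u s n c :
  a <= b -> 1 <= p -> (forall k, 0 < eps k) -> eps k @[k --> \oo] --> (0 : R) ->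
  measurable_fun `]a, b[ u -> (forall k, inLp a b p (un k)) ->
  Lpdist a b p (un k) u @[k --> \oo] --> 0%E ->
  s = 1 \/ s = -1 -> alt u a b s n.+1 a -> (c%:E < 2%:E * alpha p)%E ->
  exists N : nat, forall k, (N <= k)%N -> ((n%:R * c)%:E <= Feps a b p (eps k) (un k))%E.
Proof.
move=> ab p1 e0 epscv mu1 lun dist s1 hal hc.
have p0 : 0 < p by exact: lt_le_trans ltr01 p1.
have [tau t0 [t1 hE]] := margin p1 hc.
have [cc [dd [h1 h2 h3]]] := alt_intervals (lexx a) hal.
pose si (i : nat) := s * (-1) ^+ i.
have si1 i : si i = 1 \/ si i = -1.
  elim: i => [|i ih]; first by rewrite /si mulr1.
  rewrite /si exprS mulN1r mulrN -/(si i).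
  by case: ih => ->; [right|left; rewrite opprK].
have mcd i : (i < n.+1)%N -> measurable_fun `]cc i, dd i[ u.
  move=> /h1[ac cd db]; apply: measurable_funS mu1 => //.
  by apply: subset_itv; rewrite bnd_simp; exact: ltW.
pose m i := Int (cc i) (dd i) (fun x => if u x == si i then 1 else 0).
have m0 i : (i < n.+1)%N -> 0 < m i.
  by move=> hi; exact: (not_ae_Int_gt0 (mcd i hi) (h3 i hi)).2.
pose M := n%:R * c.
(* eps K gathers the two eps-terms of [select_point] under the energy bound |M| + 1; half of each
   mass m i is reserved for it, and half for the L^p error. *)
pose K := (`|M| + 1) / tau ^+ 2 + 1.
have K0 : 0 < K by rewrite /K ltr_wpDl// divr_ge0 ?addr_ge0 ?sqr_ge0.
have hN i : exists N : nat, (i < n.+1)%N -> forall k, (N <= k)%N ->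
    eps k * K < m i / 2 /\ (\int[mu]_(x in `]a, b[) (`|un k x - u x| `^ p)%:E < (m i / 2)%:E)%E.
  have [hi|hi] := boolP (i < n.+1)%N; last by exists 0%N.
  have mi2 : 0 < m i / 2 by rewrite divr_gt0// m0.
  have [N1 hN1] := Lpdist_small p0 mi2 dist.
  have d0 : 0 < m i / 2 / K by rewrite divr_gt0.
  have /cvgrPdist_lt/(_ _ d0)[N2 _ hN2] := epscv.
  exists (maxn N1 N2) => _ k; rewrite geq_max => /andP[k1 k2]; split; last exact: hN1.
  by have := hN2 k k2; rewrite /= sub0r normrN gtr0_norm// ltr_pdivlMr.
have [NN hNN] := choice hN.
exists (\max_(i < n.+1) NN i) => k hk.
(* Either the energy is at least n c, or it is below and this very bound makes [select_point]
   applicable; the n transitions it produces then contradict it. *)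
have [//|hlt] := leP (M%:E) (Feps a b p (eps k) (un k)).
have [U [V [g [pU pV lg uU [ld hd]]]]] := Feps_lt ab p1 (e0 k) hlt.
have dM : Int a b (dens (eps k) U g) <= `|M| + 1.
  by rewrite (le_trans (ltW hd))// (le_trans (ler_norm M))// lerDl.
have hz i : exists z, (i < n.+1)%N -> cc i <= z <= dd i /\
    (`|U z - si i| <= 32 * tau /\ eps k * `|V z| <= 32 * tau).
  have [hi|hi] := boolP (i < n.+1)%N; last by exists 0.
  have [ac cd db] := h1 i hi.
  have NNk : (NN i <= k)%N by apply: leq_trans hk; exact: (leq_bigmax (Ordinal hi)).
  have [hk1 hk2] := hNN i hi k NNk.
  have [lP hP] := Int_powR_dist uU (lun k).1 mu1 pU hk2.
  have sub f : L1 a b f -> L1 (cc i) (dd i) f by apply: L1_sub; exact: ltW.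
  have [] := @select_point _ p (eps k) tau (si i) (cc i) (dd i) u U V g p1 (e0 k) t0 t1 (si1 i) cd
    (prim_sub (ltW ac) (ltW db) pU) (prim_sub (ltW ac) (ltW db) pV) (sub _ ld) (mcd i hi) (sub _ lP).
    have i1 : Int (cc i) (dd i) (dens (eps k) U g) <= `|M| + 1.
      apply: le_trans dM; apply: le_Int_sub => //; try exact: ltW.
      by move=> z _; exact: dens_ge0.
    have i2 : Int (cc i) (dd i) (fun x => `|U x - u x| `^ p) < m i / 2.
      by apply: le_lt_trans hP; apply: le_Int_sub => [||//|z _]; [exact: ltW|exact: ltW|exact: powR_ge0].
    have i3 : eps k / tau ^+ 2 * Int (cc i) (dd i) (dens (eps k) U g) + eps k <= eps k * K.
      rewrite (_ : eps k * K = eps k / tau ^+ 2 * (`|M| + 1) + eps k); last by rewrite /K; ring.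
      by rewrite lerD2r ler_wpM2l// divr_ge0 ?sqr_ge0// ltW.
    rewrite -/(m i); lra.
  by move=> z zcd hz; exists z.
have [z hz'] := choice hz.
have zlt i : (i.+1 < n.+1)%N -> z i < z i.+1.
  move=> hi; have [/andP[_ z1] _] := hz' i (ltnW hi); have [/andP[z2 _] _] := hz' i.+1 hi.
  exact: le_lt_trans z1 (lt_le_trans (h2 i hi) z2).
have za i : (i < n.+1)%N -> a <= z i <= b.
  move=> hi; have [/andP[z1 z2] _] := hz' i hi; have [ac cd db] := h1 i hi.
  by rewrite (le_trans (ltW ac) z1) (le_trans z2 (ltW db)).
have step i : (i < n)%N -> c <= Int (z i) (z i.+1) (dens (eps k) U g).
  move=> hi; have hi' : (i < n.+1)%N by exact: ltnW.
  have [_ [u1 v1]] := hz' i hi'; have [_ [u2 v2]] := hz' i.+1 hi.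
  have /andP[az _] := za i hi'; have /andP[_ zb] := za i.+1 hi.
  apply: hE; apply: (@transition_cost _ p (eps k) _ _ _ (si i) U V g p1 (e0 k) (zlt i hi)) => //.
  - exact: prim_sub pU.
  - exact: prim_sub pV.
  - exact: inLp_sub lg.
  - exact: L1_sub ld.
  - lra.
  - by move: u2; rewrite /si exprS mulN1r mulrN opprK.
have sum j : (j <= n)%N -> j%:R * c <= Int (z 0%N) (z j) (dens (eps k) U g).
  elim: j => [_|j ih hj]; first by rewrite mul0r Int_ge.
  have zz i : (i <= n)%N -> z 0%N <= z i.
    elim: i => [//|i ihi hi]; apply: le_trans (ihi (ltnW hi)) _; apply: ltW; exact: zlt.
  have /andP[az _] := za 0%N isT; have /andP[_ zb] := za j.+1 hj.
  rewrite (@Int_cat _ _ _ (z j)) ?zz ?(ltnW hj)//; [|by apply: ltW; exact: zlt|exact: L1_sub ld].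
  by rewrite -natr1 mulrDl mul1r lerD ?ih ?step// ltnW.
have /andP[az _] := za 0%N isT; have /andP[_ zb] := za n (leqnn _).
have := sum n (leqnn n); rewrite -/M => hM.
have hle : Int (z 0%N) (z n) (dens (eps k) U g) <= Int a b (dens (eps k) U g).
  by apply: le_Int_sub => // t _; exact: dens_ge0.
by have := le_lt_trans (le_trans hM hle) hd; rewrite ltxx.
Qed.

End Liminf.

(** * Nearly optimal transition profiles *)

Section Profile.
Context {R : realType}.
Implicit Types (a b c d x y z s t tau p M L A B delta : R) (u v U V g : R -> R).

(** Equality in the weighted AM-GM inequality. The slack delta is for B = 0, where the infimum 0 is
    not attained and L = delta / A costs exactly delta. *)
Lemma optimal_scale A B delta : 0 < A -> 0 <= B -> 0 < delta -> exists2 L, 0 < L &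
  L * A + L ^- 3 * B <= 4 / 3 `^ (3 / 4) * (A `^ (3 / 4) * B `^ (1 / 4)) + delta.
Proof.
move=> A0 B0 d0; have [q [q0 qA _ ->]] := quarter_powers (ltW A0).
have [r [r0 rB -> _]] := quarter_powers B0.
have [t [t0 t4 _ ->]] := quarter_powers (ler0n R 3).
have nz (y k : R) : 0 <= y -> y ^+ 4 = k -> 0 < k -> 0 < y.
  move=> y0 yk k0; rewrite lt_neqAle y0 andbT; apply/eqP => y00.
  by move: k0; rewrite -yk -y00 expr0n ltxx.
have qp := nz _ _ q0 qA A0; have tp := nz _ _ t0 t4 (ltr0n R 3).
move: B0; rewrite le_eqVlt => /orP[/eqP B00|Bp].
  exists (delta / A); first by rewrite divr_gt0.
  rewrite -B00 mulr0 addr0 divfK ?gt_eqF// lerDr mulr_ge0//.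
    by rewrite divr_ge0// exprn_ge0.
  by rewrite mulr_ge0// exprn_ge0.
have rp := nz _ _ r0 rB Bp.
(* t r / q is (3 B / A)^(1/4), the minimiser of L A + B / L^3. *)
exists (t * r / q); first by rewrite divr_gt0// mulr_gt0.
rewrite ler_wpDr ?(ltW d0)//.
rewrite (_ : _ + _ = (t ^+ 4 + 1) / t ^+ 3 * (q ^+ 3 * r)).
  by rewrite t4 (_ : 3 + 1 = 4 :> R)//; ring.
by rewrite -qA -rB; field; rewrite !gt_eqF.
Qed.

(** The boundary conditions of J allow a near-minimiser to be continued by -1 and 1 without breaking
    W^{2,p}. Being defined on the whole line, the profile can be rescaled and restricted to any
    interval. *)
Lemma profile_exists p delta : 1 <= p -> (alpha p < +oo :> \bar R)%E -> 0 < delta ->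
  exists L U V g, [/\ 0 < L, forall lo hi, [/\ prim lo hi V U, prim lo hi g V,
      inLp lo hi p g & L1 lo hi (fun x => g x ^+ 2)],
    forall x, (x <= 0 -> U x = -1 /\ V x = 0) /\ (1 <= x -> U x = 1 /\ V x = 0),
    forall x, ~~ (0 < x < 1) -> g x = 0 &
    ((L * Int 0 1 (well U) + L ^- 3 * Int 0 1 (fun x => g x ^+ 2))%:E <=
      2%:E * alpha p + delta%:E)%E].
Proof.
move=> p1 ay d0; have k0 : 0 < 4 / 3 `^ (3 / 4) :> R by rewrite divr_gt0// powR_gt0.
pose I : \bar R := ereal_inf [set Phi p w | w in Jclass p].
have I0 : (0 <= I)%E.
  apply: le_ereal_inf_tmp => _ [w _ <-]; apply: le_ereal_inf_tmp => _ [g1 [g2 [_ ->]]].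
  by rewrite mule_ge0// poweR_ge0.
have aE : (2%:E * alpha p = (4 / 3 `^ (3 / 4))%:E * I)%E.
  rewrite /alpha muleA -EFinM -/I; congr (_%:E * _)%E.
  by rewrite mulrA; congr (_ / _); rewrite -natrM.
have [r Ir] : exists r : R, I = r%:E.
  move: I0 aE; case: I => [r||]//; first by exists r.
  move=> _ h; exfalso; move: ay; rewrite -(@lte_pmul2l _ 2%:E)// h.
  by rewrite gt0_muley ?lte_fin// gt0_muley ?lte_fin// ltxx.
(* Half of delta goes to the choice of w, after multiplication by the constant in front of the
   infimum; the other half goes to the choice of L. *)
pose e := delta / 2 / (4 / 3 `^ (3 / 4)).
have e0 : 0 < e by rewrite !divr_gt0.
have : (I < (r + e)%:E)%E by rewrite Ir lte_fin ltrDl.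
move=> /ereal_inf_lt[_ [w Jw <-]] /ereal_inf_lt[_ [g1 [g2 [hw ->]]]].
have [U [V [pU pV [U0 U1] [V0 V1] [->//|[l2 ->]]]]] := Jclass_value p1 Jw hw.
rewrite lte_fin => hv.
have A0 := well_Int_gt0 pU U0 U1; set A := Int 0 1 (well U) in A0 hv.
set B := Int 0 1 (fun y => g2 y ^+ 2) in hv.
have B0 : 0 <= B by apply: Int_ge0 => y _; exact: sqr_ge0.
have lg : inLp 0 1 p g2 by case: hw => _ [_ []].
have d2 : 0 < delta / 2 by rewrite divr_gt0.
have [L L0 hL] := optimal_scale A0 B0 d2.
pose g x := if 0 < x < 1 then g2 x else 0.
have geq x : 0 < x < 1 -> g2 x = g x by rewrite /g => ->.
pose UE := glue 0 (fun=> -1) (glue 1 U (fun=> 1)).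
pose VE := glue 0 (fun=> 0) (glue 1 V (fun=> 0)).
have UE01 x : 0 < x < 1 -> UE x = U x.
  by move=> /andP[x0 x1]; rewrite /UE glue_ge ?glue_lt// ltW.
have geE : glue 0 (fun=> 0) (glue 1 g (fun=> 0)) = g.
  apply/funext => x; rewrite /glue /g; have [x0|x0] := ltP x 0.
    by rewrite ifF//; apply/negbTE; rewrite negb_and -leNgt (ltW x0).
  have [x1|x1] := ltP x 1; first by [].
  by rewrite andbF.
have pg : prim 0 1 g V by apply: eq_prim pV.
have lg' : inLp 0 1 p g.
  move: lg => /inLpP[mg lg]; apply/inLpP; split; first exact: L1_meas (prim_L1 pg).
  by apply: eq_L1 lg => x /geq ->.
have l2' : L1 0 1 (fun y => g y ^+ 2) by apply: eq_L1 l2 => x /geq ->.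
have pVg lo hi : prim lo hi g VE.
  rewrite -geE; apply: prim_glue; first exact: prim_cst.
    by apply: prim_glue; [exact: pg|exact: prim_cst|].
  by rewrite glue_lt.
exists L, UE, VE, g; split; [exact: L0| | | |].
- move=> lo hi; split; [|exact: pVg| |].
  + apply: prim_glue; first exact: prim_cst.
      by apply: prim_glue; [exact: pU|exact: prim_cst|].
    by rewrite glue_lt.
  + rewrite -geE; have z lo' hi' : inLp lo' hi' p (fun=> (0 : R)).
      apply: (inLp_bounded (K := 0) p1); first exact: measurable_cst.
      by move=> x _; rewrite normr0.
    exact: (inLp_glue p1 (z _ _) (inLp_glue p1 lg' (z _ _))).
  + rewrite -geE.
    apply: (eq_L1 (f := glue 0 (fun=> 0) (glue 1 (fun x => g x ^+ 2) (fun=> 0)))).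
      by move=> x _; rewrite /glue; do 2?case: ifP => _; rewrite ?expr0n.
    by apply: L1_glue; [exact: L1_cst|apply: L1_glue => //; exact: L1_cst].
- move=> x; split => [x0|x1]; rewrite /UE /VE; last first.
    by rewrite !glue_ge// (le_trans ler01).
  have [x0'|x0'] := ltP x 0; first by rewrite !glue_lt.
  have -> : x = 0 by apply: le_anti; rewrite x0.
  by rewrite !(glue_ge _ _ (lexx 0)) !glue_lt.
- by move=> x /negbTE h; rewrite /g h.
rewrite aE Ir -EFinM -EFinD lee_fin.
have -> : Int 0 1 (well UE) = A by apply: eq_Int => x /UE01; rewrite /well => ->.
have -> : Int 0 1 (fun x => g x ^+ 2) = B by apply: eq_Int => x /geq ->.
apply: (le_trans hL).
have : 4 / 3 `^ (3 / 4) * (A `^ (3 / 4) * B `^ (1 / 4)) <= 4 / 3 `^ (3 / 4) * (r + e).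
  by rewrite ler_pM2l// ltW.
have he : 4 / 3 `^ (3 / 4) * e = delta / 2 by rewrite /e mulrC divfK ?gt_eqF.
by rewrite mulrDr he => h; apply: (le_trans (lerD h (lexx _))); rewrite -addrA -splitr.
Qed.

End Profile.

(** * Recovery functions on one interval *)

Section Recovery.
Context {R : realType}.
Implicit Types (a b c d x y z s t k l p eps L C lo hi : R) (u v U V g : R -> R) (ts : seq R).

Definition profile p U V g := [/\ forall lo hi, [/\ prim lo hi V U, prim lo hi g V,
      inLp lo hi p g & L1 lo hi (fun x => g x ^+ 2)],
    forall x, (x <= 0 -> U x = -1 /\ V x = 0) /\ (1 <= x -> U x = 1 /\ V x = 0) &
    forall x, ~~ (0 < x < 1) -> g x = 0].

Lemma profile_bounded p U V g : profile p U V g -> exists2 C, 0 <= C & forall x, `|U x| <= C.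
Proof.
move=> [h U1 _]; have [pU _ _ _] := h 0 1.
exists (1 + (`|U 0| + Int 0 1 (fun x => `|V x|))).
  by rewrite !addr_ge0// Int_ge0.
move=> x; have I0 : 0 <= Int 0 1 (fun x => `|V x|) by apply: Int_ge0.
have [x0|x0] := leP x 0.
  by have [/(_ x0)[-> _] _] := U1 x; rewrite normrN normr1 lerDl addr_ge0.
have [x1|x1] := leP 1 x.
  by have [_ /(_ x1)[-> _]] := U1 x; rewrite normr1 lerDl addr_ge0.
rewrite (le_trans (prim_bounded pU (x := x) _)) ?lerDr//.
by rewrite (ltW x0) ltW.
Qed.

(** The transition is T x = U ((x - t) / (eps L)). The powers of eps in the energy are those for
    which its cost depends on L and the profile but not on eps. *)
Lemma scaled_profile p eps L t U V g : 1 <= p -> 0 < eps -> 0 < L -> profile p U V g ->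
  exists T Y G, [/\ forall lo hi, [/\ prim lo hi Y T, prim lo hi G Y, inLp lo hi p G &
      L1 lo hi (dens eps T G)],
    forall x, (exists z, T x = U z) /\ (x <= t -> T x = -1 /\ Y x = 0) /\
      (t + eps * L <= x -> T x = 1 /\ Y x = 0),
    forall lo, lo <= t -> Int lo t (dens eps T G) = 0 &
    Int t (t + eps * L) (dens eps T G) =
      L * Int 0 1 (well U) + L ^- 3 * Int 0 1 (fun x => g x ^+ 2)].
Proof.
move=> p1 e0 L0 [h hU hg]; pose k := (eps * L)^-1; pose c := - (k * t).
have k0 : 0 < k by rewrite invr_gt0 mulr_gt0.
have kl : k * (eps * L) = 1 by rewrite mulVf// gt_eqF// mulr_gt0.
have c0 : k * t + c = 0 by rewrite subrr.
have c1 : k * (t + eps * L) + c = 1 by rewrite mulrDr kl addrAC c0 add0r.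
pose T x := U (k * x + c); pose Y x := k * V (k * x + c); pose G x := k * (k * g (k * x + c)).
have aff lo hi : [/\ prim lo hi Y T, prim lo hi G Y, inLp lo hi p G & L1 lo hi (fun x => G x ^+ 2)].
  have [pU pV lg l2] := h (k * lo + c) (k * hi + c); split.
  - exact: prim_affine pU.
  - exact: primZ (prim_affine _ pV).
  - by apply: inLp_scale; apply: inLp_scale; exact: inLp_affine lg.
  - apply: eq_L1 (L1Z (k ^+ 4) (L1_affine k0 l2)) => x _; rewrite /G; ring.
exists T, Y, G; split.
- move=> lo hi; have [pT pY lG l2] := aff lo hi.
  by have [] := Int_dens eps pT l2.
- move=> x; split; first by exists (k * x + c).
  have [h0 h1] := hU (k * x + c); split=> hx; rewrite /T /Y.
    have [] := h0; first by rewrite -c0 lerD2r ler_pM2l.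
    by move=> -> ->; rewrite mulr0.
  have [] := h1; first by rewrite -c1 lerD2r ler_pM2l.
  by move=> -> ->; rewrite mulr0.
- move=> lo lot; rewrite (@eq_Int _ _ _ _ (fun=> 0)) ?Int_cst ?mul0r// => x /andP[_ xt].
  have kx : k * x + c <= 0 by rewrite -c0 lerD2r ler_pM2l// ltW.
  have [/(_ kx)[Ux _] _] := hU (k * x + c).
  by rewrite /dens /T /G Ux hg ?ltNge ?kx// sqrrN expr1n subrr !mulr0 !expr0n /= !mulr0 addr0.
have [pT pY lG l2] := aff t (t + eps * L); have [_ ->] := Int_dens eps pT l2.
have [pU pV lg lg2] := h 0 1.
have -> : Int 0 1 (well U) = k * Int t (t + eps * L) (well T).
  by have := @Int_affine _ k c t (t + eps * L) (well U) k0; rewrite c0 c1; apply; exact: L1_well pU.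
have -> : Int 0 1 (fun x => g x ^+ 2) = k * (k ^- 4 * Int t (t + eps * L) (fun x => G x ^+ 2)).
  rewrite -IntZ//; have := @Int_affine _ k c t (t + eps * L) (fun y => g y ^+ 2) k0.
  rewrite c0 c1 => /(_ lg2) ->; congr (k * _); apply: eq_Int => x _.
  by rewrite /G; field; rewrite gt_eqF.
by rewrite /k; field; rewrite !gt_eqF.
Qed.

(** Each jump t becomes a transition on [t, t + eps L]; starting the path at lo - eps L encodes lo
    <= t for the first jump and lets the induction restart at t + eps L. Outside these layers W
    equals the step function, inside the error is at most C + 1. *)
Lemma recovery_cells p eps L C s lo hi ts U V g : 1 <= p -> 0 < eps -> 0 < L ->
  profile p U V g -> (forall x, `|U x| <= C) -> s = 1 \/ s = -1 -> lo <= hi ->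
  path (fun x y => x + eps * L <= y) (lo - eps * L) ts ->
  all (fun t => t + eps * L <= hi) ts ->
  exists W Y G, [/\ prim lo hi Y W, prim lo hi G Y, inLp lo hi p G, W lo = s /\ Y lo = 0 &
   [/\ L1 lo hi (dens eps W G),
     Int lo hi (dens eps W G) =
       (size ts)%:R * (L * Int 0 1 (well U) + L ^- 3 * Int 0 1 (fun x => g x ^+ 2)),
     L1 lo hi (fun x => `|W x - pw s ts x| `^ p) &
     Int lo hi (fun x => `|W x - pw s ts x| `^ p) <= (size ts)%:R * ((C + 1) `^ p * (eps * L))]].
Proof.
move=> p1 e0 L0 hP hC; set E := L * _ + _; set l := eps * L.
have l0 : 0 < l by rewrite mulr_gt0.
have p0 : p != 0 by rewrite gt_eqF// (lt_le_trans ltr01).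
elim: ts s lo => [|t ts ih] s lo s1 lohi.
  move=> _ _; exists (fun=> s), (fun=> 0), (fun=> 0).
  have ds x : dens eps (fun=> s) (fun=> 0) x = 0.
    by rewrite /dens; case: s1 => ->; rewrite ?sqrrN expr1n subrr expr0n !mulr0 addr0.
  have dp x : `|s - pw s [::] x| `^ p = 0 by rewrite subrr normr0 powR0.
  split; [exact: prim_cst|exact: prim_cst| |by []|split].
  - apply: (inLp_bounded (K := 0) p1); first exact: measurable_cst.
    by move=> x _; rewrite normr0.
  - by apply: eq_L1 (L1_cst _ _ 0).
  - by rewrite (@eq_Int _ _ _ _ (fun=> 0)) ?Int_cst ?mul0r.
  - by apply: eq_L1 (L1_cst _ _ 0) => x _; rewrite dp.
  - by rewrite (@eq_Int _ _ _ _ (fun=> 0)) ?Int_cst ?mul0r// => x _; rewrite dp.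
rewrite /= subrK => /andP[lot pts] /andP[thi ahi].
have s1' : - s = 1 \/ - s = -1 by case: s1 => ->; [right|left]; rewrite ?opprK.
have [|W [Y [G [pW pY lG [W0 Y0] [lD ID lP IP]]]]] := ih (- s) (t + l) s1' thi _ ahi.
  by rewrite addrK.
have [T [T' [T'' [hT vT z1 I1]]]] := scaled_profile t p1 e0 L0 hP.
have [pT pT' lT lDT] := hT lo (t + l).
have lotl : lo <= t + l by rewrite (le_trans lot)// lerDl ltW.
have dE : dens eps (fun x => - s * T x) (fun x => - s * T'' x) = dens eps T T''.
  by apply/funext => x; rewrite /dens !exprMn; case: s1 => ->; rewrite ?opprK ?sqrrN expr1n !mul1r.
have [_ [_ /(_ (lexx _))[T1 T'1]]] := vT (t + l).
exists (glue (t + l) (fun x => - s * T x) W), (glue (t + l) (fun x => - s * T' x) Y),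
  (glue (t + l) (fun x => - s * T'' x) G).
have lt_lo : lo < t + l by rewrite (le_lt_trans lot)// ltrDl.
pose f1 := glue t (fun=> 0) (fun x => `|- s * T x + s| `^ p).
have inT : inLp t (t + l) p (fun x => - s * T x + s).
  have [pT1 _ _ _] := hT t (t + l).
  apply: (inLp_bounded (K := C + 1) p1).
    exact: prim_measurable (primD (primZ (- s) pT1) (prim_cst _ _ s)).
  move=> x _; have [[z ->] _] := vT x; rewrite (le_trans (ler_normD _ _))// lerD//.
    by rewrite normrM normrN; case: s1 => ->; rewrite ?normrN normr1 mul1r.
  by case: s1 => ->; rewrite ?normrN normr1.
have [_ lf1'] := (inLpP _ _ _ _).1 inT.
have lf1 : L1 lo (t + l) f1 by apply: L1_glue lf1'; exact: L1_cst.
have pwE x : x < t + l -> pw (- s) ts x = - s.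
  by case: (ts) pts => //= t' ts' /andP[tt _] xl; rewrite (lt_le_trans xl tt).
have gE : (fun x => `|glue (t + l) (fun x => - s * T x) W x - pw s (t :: ts) x| `^ p) =
    glue (t + l) f1 (fun x => `|W x - pw (- s) ts x| `^ p).
  apply/funext => x; have [xl|xl] := ltP x (t + l); last first.
    by rewrite !(glue_ge _ _ xl) /= ltNge (le_trans _ xl)// lerDl ltW.
  rewrite !(glue_lt _ _ xl) /= /f1 /glue; have [xt|tx] := ltP x t.
    have [_ [/(_ (ltW xt))[-> _] _]] := vT x.
    by rewrite mulrN1 opprK subrr normr0 powR0.
  by rewrite pwE// opprK.
rewrite gE dens_glue dE; split.
- by apply: prim_glue => //; [exact: primZ|rewrite T1 mulr1 W0].
- by apply: prim_glue => //; [exact: primZ|rewrite T'1 mulr0 Y0].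
- exact: (inLp_glue p1 (inLp_scale _ lT) lG).
- have [_ [/(_ lot)[Tl T'l] _]] := vT lo.
  by rewrite !glue_lt// Tl T'l mulr0 mulrN1 opprK.
split.
- exact: L1_glue.
- rewrite Int_glue// ID (@Int_cat _ lo (t + l) t)// ?lerDl ?(ltW l0)// z1// add0r I1 -/E.
  by rewrite -natr1 mulrDl mul1r addrC.
- exact: L1_glue.
rewrite Int_glue// -natr1 mulrDl mul1r addrC lerD//.
rewrite Int_glue ?lerDl ?(ltW l0)//; last exact: L1_cst.
rewrite Int_cst// mul0r add0r (le_trans (Int_le_cst (k := (C + 1) `^ p) _ lf1' _)) ?lerDl ?(ltW l0)//.
  move=> x _; rewrite ge0_ler_powR ?nnegrE// ?(le_trans ler01 p1)//.
    by rewrite addr_ge0// (le_trans _ (hC 0)).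
  have [[z ->] _] := vT x; rewrite (le_trans (ler_normD _ _))// lerD//.
    by rewrite normrM normrN; case: s1 => ->; rewrite ?normrN normr1 mul1r.
  by case: s1 => ->; rewrite ?normrN normr1.
by rewrite addrAC subrr add0r.
Qed.
End Recovery.

(** * Recovery with prescribed accuracy *)

Section RecoveryLimit.
Context {R : realType}.
Notation mu := (@lebesgue_measure R).
Implicit Types (a b c d x y z s t k l p eps L C delta gamma : R) (u v U V g : R -> R) (ts : seq R).

Lemma path_gap a b ts : path <%R a ts -> all (fun t => t < b) ts ->
  exists2 gamma, 0 < gamma & forall l, l <= gamma ->
    path (fun x y => x + l <= y) a ts /\ all (fun t => t + l <= b) ts.
Proof.
elim: ts a => [|t ts ih] a /=; first by move=> _ _; exists 1.
move=> /andP[at_ pts] /andP[tb ats]; have [gamma g0 h] := ih t pts ats.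
exists (Num.min gamma (Num.min (t - a) (b - t))).
  by rewrite !lt_min g0 !subr_gt0 at_.
move=> l; rewrite !le_min => /andP[lg /andP[lt lb]]; have [-> ->] := h l lg.
by rewrite andbT; split; [|apply/andP; split => //]; lra.
Qed.

Lemma Feps_le a b p eps U V g : a <= b -> 1 <= p -> prim a b V U -> prim a b g V -> inLp a b p g ->
  L1 a b (dens eps U g) -> (Feps a b p eps U <= (Int a b (dens eps U g))%:E)%E.
Proof.
move=> ab p1 pU pV lg lD; apply: ereal_inf_lbound; exists V, g; split; first exact: prim_W2p.
rewrite -Int_EFin//; apply: eq_integral => x _; congr (_ + _ * _)%:E.
by rewrite real_normK ?num_real.
Qed.

Lemma Lpdist_le a b p u v w delta : 1 <= p -> 0 <= delta -> measurable_fun `]a, b[ u ->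
  measurable_fun `]a, b[ v -> ae_on a b (fun x => u x = w x) ->
  L1 a b (fun x => `|v x - w x| `^ p) -> Int a b (fun x => `|v x - w x| `^ p) <= delta `^ p ->
  (Lpdist a b p v u <= delta%:E)%E.
Proof.
move=> p1 d0 mu' mv uw lw Iw; have p0 : 0 < p by rewrite (lt_le_trans ltr01).
have m : measurable_fun `]a, b[ (fun x => `|v x - u x| `^ p).
  apply: (@measurableT_comp _ _ _ _ _ _ (fun x => x `^ p)); first exact: measurable_powR.
  by apply: measurableT_comp => //; exact: measurable_funB.
have ae : ae_on a b (fun x => `|v x - w x| `^ p = `|v x - u x| `^ p).
  by apply: ae_onS uw => x _ ->.
rewrite /Lpdist Int_EFin; last exact: L1_ae lw ae.
rewrite -(Int_ae (L1_meas lw) m ae) poweR_EFin lee_fin.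
rewrite -[leRHS](powRr1 d0) -(@mulfV _ p) ?gt_eqF// powRrM ge0_ler_powR ?nnegrE ?powR_ge0 ?invr_ge0 ?(ltW p0)//.
by apply: Int_ge0 => x _; exact: powR_ge0.
Qed.

Lemma recovery a b p u s ts delta : a < b -> 1 <= p -> (alpha p < +oo :> \bar R)%E ->
  s = 1 \/ s = -1 -> path <%R a ts -> all (fun t => t < b) ts -> measurable_fun `]a, b[ u ->
  ae_on a b (fun x => u x = pw s ts x) -> 0 < delta ->
  exists2 eps0, 0 < eps0 & forall eps, 0 < eps -> eps < eps0 ->
    exists v, [/\ inLp a b p v, (Lpdist a b p v u <= delta%:E)%E &
      (Feps a b p eps v <= (size ts)%:R%:E * (2%:E * alpha p) + delta%:E)%E].
Proof.
move=> ab p1 ay s1 pts ats mu' uE d0; set N : R := (size ts)%:R.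
have N1 : 0 < N + 1 by rewrite ltr_wpDl.
have N0 : 0 <= N by [].
have dN : 0 < delta / (N + 1) by rewrite divr_gt0.
have [L [U [V [g [L0 h hU hg hE]]]]] := profile_exists p1 ay dN.
have hP : profile p U V g by split.
have [C C0 hC] := profile_bounded hP; have [gamma g0 hgap] := path_gap pts ats.
have C1 : 0 < (C + 1) `^ p by rewrite powR_gt0// ltr_wpDl.
have dp : 0 < delta `^ p by rewrite powR_gt0.
pose B := (N + 1) * ((C + 1) `^ p * L); have B0 : 0 < B by rewrite !mulr_gt0.
(* The first bound makes the layers of length eps L fit between the jumps and before b, the second
   makes the L^p error small. N + 1 in place of N avoids division by zero when there is no jump. *)
exists (Num.min (gamma / L) (delta `^ p / B)).
  by rewrite lt_min !divr_gt0.
move=> eps e0; rewrite lt_min !ltr_pdivlMr// => /andP[eg eB].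
have [gp gb] := hgap _ (ltW eg).
have gp' : path (fun x y => x + eps * L <= y) (a - eps * L) ts.
  case: (ts) gp => //= t ts' /andP[at_ ->]; rewrite andbT subrK (le_trans _ at_)//.
  by rewrite lerDl ltW// mulr_gt0.
have [W [Y [G [pW pY lG _ [lD ID lP IP]]]]] := recovery_cells p1 e0 L0 hP hC s1 (ltW ab) gp' gb.
have lW : inLp a b p W by have [] := prim_W2p (ltW ab) p1 pW pY lG.
exists W; split => //.
  apply: (Lpdist_le (w := pw s ts) p1 (ltW d0)) => //; first by case: lW.
  rewrite (le_trans IP)// (le_trans _ (ltW eB))// -/N.
  rewrite (_ : eps * B = (N + 1) * ((C + 1) `^ p * (eps * L))); last by rewrite /B; ring.
  by rewrite ler_pM2r ?lerDl// !mulr_gt0.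
apply: (le_trans (Feps_le (ltW ab) p1 pW pY lG lD)); rewrite ID -/N.
move: hE; have := alpha_gt0 p1; move: ay; case: (alpha p) => [r||]// _ _.
rewrite -!EFinM -!EFinD !lee_fin => hE; rewrite (le_trans (ler_wpM2l N0 hE))// mulrDr lerD2l.
by rewrite mulrCA ger_pMr// ler_pdivrMr// mul1r lerDl.
Qed.

End RecoveryLimit.

(** * Lower and upper limits, and diagonal sequences *)

Section Limits.
Context {R : realType}.
Implicit Types (a b c p s M delta : R) (u v : R -> R) (ts : seq R).

Lemma limn_einf_ge (f : nat -> \bar R) l N : (forall n, (N <= n)%N -> (l <= f n)%E) ->
  (l <= limn_einf f)%E.
Proof.
move=> h; rewrite (_ : limn_einf f = limf_einf f \oo)// limf_einfE.
apply: le_trans (ereal_sup_ubound _); last first.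
  by exists [set n | (N <= n)%N] => //; exists N.
by apply: le_ereal_inf_tmp => _ [n /h hn <-].
Qed.

Lemma limn_esup_le (f : nat -> \bar R) l N : (forall n, (N <= n)%N -> (f n <= l)%E) ->
  (limn_esup f <= l)%E.
Proof.
move=> h; rewrite /limn_esup limf_esupE.
apply: (le_trans (ereal_inf_lbound _)).
  by exists [set n | (N <= n)%N] => //; exists N.
by apply: ge_ereal_sup => _ [n /h hn <-].
Qed.

Lemma limn_einf_bounded (f : nat -> \bar R) : limn_einf f <> +oo%E ->
  exists M, forall N, exists2 n, (N <= n)%N & (f n < M%:E)%E.
Proof.
move=> h; apply: contrapT => hM; apply: h; apply: eq_infty => M.
have [N hN] : exists N, forall n, (N <= n)%N -> (M%:E <= f n)%E.
  apply: contrapT => h; apply: hM; exists M => N; apply: contrapT => h'.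
  apply: h; exists N => n Nn; rewrite leNgt; apply/negP => fM; apply: h'.
  by exists n.
exact: limn_einf_ge hN.
Qed.

(** Passes from all real c < 2 alpha to 2 alpha itself. If x = +oo and n > 0, arbitrarily large c
    contradict the finiteness of l; for n = 0 the product is 0 even when x = +oo. *)
Lemma ereal_mul_le (x l : \bar R) n : (0 < x)%E -> (0 <= l)%E -> l <> +oo%E ->
  (forall c, (c%:E < x)%E -> ((n%:R * c)%:E <= l)%E) -> (n%:R%:E * x <= l)%E.
Proof.
case: n => [|n]; first by rewrite mul0e.
case: l => [r||]//; case: x => [y||]// y0 r0 _ h; have n0 : 0 < (n.+1%:R : R) by [].
  rewrite -EFinM lee_fin leNgt; apply/negP => h'.
  have hr : r / n.+1%:R < y by rewrite ltr_pdivrMr// mulrC.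
  have := h ((r / n.+1%:R + y) / 2); rewrite lte_fin lee_fin midf_lt// => /(_ isT).
  by rewrite leNgt -ltr_pdivrMl// (mulrC _ r) midf_lt.
have := h (r / n.+1%:R + 1) (ltry _); rewrite lee_fin mulrDr mulrCA divff ?gt_eqF//.
by rewrite !mulr1 gerDl leNgt n0.
Qed.

(** At index n choose a w that meets every requirement j <= n that can be met at all; this is
    possible because the requirements are nested. No increasing sequence of thresholds has to be
    built. *)
Lemma diagonal (V : Type) (Q : V -> Prop) (P : nat -> nat -> V -> Prop) (v0 : V) :
  Q v0 -> (forall j n (w : V), P j n w -> Q w) -> (forall j n (w : V), P j.+1 n w -> P j n w) ->
  (forall j, exists N, forall n, (N <= n)%N -> exists w : V, P j n w) ->
  exists f : nat -> V, forall j, (forall n, Q (f n)) /\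
    exists N, forall n, (N <= n)%N -> P j n (f n).
Proof.
move=> Q0 PQ Pm hP.
have Pm' i j n (v : V) : (i <= j)%N -> P j n v -> P i n v.
  by move/subnK <-; elim: (j - i)%N => [//|m ih] /Pm.
have best n J : exists w : V, Q w /\ forall j, (j <= J)%N -> (exists v' : V, P j n v') -> P j n w.
  elim: J => [|J [v [Qv hv]]].
    have [[v hv]|h] := pselect (exists w : V, P 0%N n w).
      by exists v; split; [exact: PQ hv|move=> j; rewrite leqn0 => /eqP ->].
    by exists v0; split => // j; rewrite leqn0 => /eqP -> /h.
  have [[w hw]|h] := pselect (exists w : V, P J.+1 n w).
    by exists w; split; [exact: PQ hw|move=> j jJ _; exact: Pm' hw].
  by exists v; split => // j; rewrite leq_eqVlt => /orP[/eqP -> /h//|]; exact: hv.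
have [f hf] := choice (fun n => best n n); exists f => j; split => [n|].
  by have [] := hf n.
have [N hN] := hP j; exists (maxn j N) => n; rewrite geq_max => /andP[jn /hN].
by have [_] := hf n; apply.
Qed.

Lemma Lpdist_ge0 a b p u v : (0 <= Lpdist a b p u v)%E.
Proof. exact: poweR_ge0. Qed.

Lemma recovery_diagonal a b p (eps : nat -> R) u B : (forall n, 0 < eps n) ->
  eps n @[n --> \oo] --> (0 : R) -> inLp a b p u ->
  (forall delta, 0 < delta -> exists2 eps0, 0 < eps0 & forall e, 0 < e -> e < eps0 ->
    exists v, [/\ inLp a b p v, (Lpdist a b p v u <= delta%:E)%E &
      (Feps a b p e v <= B + delta%:E)%E]) ->
  exists un : nat -> R -> R, (forall n, inLp a b p (un n)) /\
    Lpdist a b p (un n) u @[n --> \oo] --> 0%E /\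
    (limn_esup (fun n => Feps a b p (eps n) (un n)) <= B)%E.
Proof.
move=> e0 ecv lu h.
pose P j n v := [/\ inLp a b p v, (Lpdist a b p v u <= (j.+1%:R^-1)%:E)%E &
      (Feps a b p (eps n) v <= B + (j.+1%:R^-1)%:E)%E].
have Pm j n v : P j.+1 n v -> P j n v.
  have jj : ((j.+2%:R^-1)%:E <= (j.+1%:R^-1)%:E :> \bar R)%E.
    by rewrite lee_fin lef_pV2 ?posrE// ler_nat.
  move=> [l1 l2 l3]; split => //; first exact: le_trans l2 jj.
  by rewrite (le_trans l3)// leeD2l.
have [||f hf] := @diagonal _ (inLp a b p) P u lu _ Pm.
- by move=> j n v [].
- move=> j; have [|eps0 eps00 heps] := h (j.+1%:R^-1); first by rewrite invr_gt0.
  have /cvgrPdist_lt/(_ _ eps00)[N _ hN] := ecv.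
  by exists N => n /hN /=; rewrite sub0r normrN gtr0_norm// => /(heps _ (e0 n)).
have small delta : 0 < delta -> exists j : nat, (j.+1%:R^-1 : R) < delta.
  move=> d0; exists (Num.truncn delta^-1).
  by rewrite invf_plt ?posrE//; exact: truncnS_gt.
exists f; split; first by have [] := hf 0%N.
split.
  apply/fine_cvgP; split.
    have [_ [N hN]] := hf 0%N; exists N => // n /hN[_ hL _].
    by rewrite ge0_fin_numE ?Lpdist_ge0// (le_lt_trans hL) ?ltry//.
  apply/cvgrPdist_lt => d d0; have [j hj] := small _ d0.
  have [_ [N hN]] := hf j; exists N => // n /hN[_ hL _] /=.
  rewrite sub0r normrN ger0_norm ?fine_ge0 ?Lpdist_ge0// (le_lt_trans _ hj)//.
  rewrite -lee_fin fineK// ge0_fin_numE ?Lpdist_ge0// (le_lt_trans hL) ?ltry//.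
apply/lee_addgt0Pr => d d0; have [j hj] := small _ d0.
have [_ [N hN]] := hf j; apply: (@limn_esup_le _ _ N) => n /hN[_ _ hF].
by rewrite (le_trans hF)// leeD2l// lee_fin ltW.
Qed.

End Limits.

(** * The two halves of Gamma-convergence *)

Section GammaLimit.
Context {R : realType}.
Notation mu := (@lebesgue_measure R).
Implicit Types (a b c p s M delta : R) (u v : R -> R) (ts : seq R).

Lemma gamma_liminf a b p (eps : nat -> R) (un : nat -> R -> R) u :
  a < b -> 1 <= p -> (forall n, 0 < eps n) -> eps n @[n --> \oo] --> (0 : R) ->
  inLp a b p u -> (forall n, inLp a b p (un n)) ->
  Lpdist a b p (un n) u @[n --> \oo] --> 0%E ->
  (Flim a b p u <= limn_einf (fun n => Feps a b p (eps n) (un n)))%E.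
Proof.
move=> ab p1 e0 ecv lu lun cv; set l := limn_einf _.
have [->|/eqP lfin] := eqVneq l +oo%E; first exact: leey.
have mu' : measurable_fun `]a, b[ u by case: lu.
have [M hM] := limn_einf_bounded lfin.
have pm1 := ae_pm1_of_bounded_energy (ltW ab) p1 e0 ecv mu' lun cv hM.
have hg := ae_good pm1.
have l0 : (0 <= l)%E by apply: (@limn_einf_ge _ _ _ 0) => n _; exact: Feps_ge0.
have low s n c : s = 1 \/ s = -1 -> alt u a b s n.+1 a -> (c%:E < 2%:E * alpha p)%E ->
    ((n%:R * c)%:E <= l)%E.
  move=> s1 hs hc.
  have [N hN] := energy_lower (ltW ab) p1 e0 ecv mu' lun cv s1 hs hc.
  exact: limn_einf_ge hN.
have a0 : (0 < 2%:E * alpha p)%E by rewrite mule_gt0// alpha_gt0.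
(* Unbounded alternation would make l exceed every multiple of a fixed c with 0 < c < 2 alpha. The
   double sign matches the form in which [structure], started with s = -1, expects the
   hypothesis. *)
have [n hn] : exists n, ~ alt u a b (- -1) n a.
  apply: contrapT => h.
  have hall n : alt u a b 1 n a.
    by apply: contrapT => hn; apply: h; exists n; rewrite opprK.
  have [c c0 hc] : exists2 c, 0 < c & (c%:E < 2%:E * alpha p)%E.
    move: a0; case: (2%:E * alpha p)%E => [r||]// => [r0|_].
      by exists (r / 2); rewrite ?lte_fin ?divr_gt0// ltr_pdivrMr// ltr_pMr// ltr1n.
    by exists 1; rewrite ?ltry.
  have [r lr] : exists r, l = r%:E.
    by move: lfin l0; case: (l) => [r||]// _ _; exists r.
  have := low 1 (Num.truncn (r / c)).+1 c (or_introl erefl) (hall _) hc; rewrite lr lee_fin leNgt => /negP; apply.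
  by rewrite -ltr_pdivrMr//; exact: truncnS_gt.
have [s [ts [s1 pts ats uE]]] := structure (or_intror erefl) (lexx a) ab hg hn.
have hE := essVar_pw_le s1 pts uE.
have hB : BPV a b p u by split => //; split => //; exact: le_lt_trans hE (ltry _).
rewrite /Flim asboolT//.
(* The variation is at most 2 per jump, and by [pw_alt] the jumps of ts give that many transitions,
   each worth 2 alpha in the limit. *)
apply: (le_trans (lee_wpmul2l (ltW (alpha_gt0 p1)) hE)).
rewrite EFinM muleA (muleC (alpha p)) muleC.
apply: ereal_mul_le => // c; apply: low s1 _.
exact: pw_alt ats hg uE.
Qed.

Lemma essVar_ge0 a b u : a < b -> (0 <= essVar a b u)%E.
Proof.
move=> ab; apply: le_ereal_inf_tmp => _ [v _ <-]; apply: ereal_sup_ubound.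
exists 0%N, (fun=> (a + b) / 2); split=> [i _|]; first by rewrite !midf_lt.
by split => //; rewrite big_ord0.
Qed.

Lemma gamma_limsup a b p (eps : nat -> R) u :
  a < b -> 1 <= p -> (forall n, 0 < eps n) -> eps n @[n --> \oo] --> (0 : R) ->
  inLp a b p u -> exists un : nat -> R -> R, (forall n, inLp a b p (un n)) /\
    Lpdist a b p (un n) u @[n --> \oo] --> 0%E /\
    (limn_esup (fun n => Feps a b p (eps n) (un n)) <= Flim a b p u)%E.
Proof.
move=> ab p1 e0 ecv lu; have p0 : p != 0 by rewrite gt_eqF// (lt_le_trans ltr01).
have mu' : measurable_fun `]a, b[ u by case: lu.
have infty : Flim a b p u = +oo%E -> exists un : nat -> R -> R, (forall n, inLp a b p (un n)) /\
    Lpdist a b p (un n) u @[n --> \oo] --> 0%E /\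
    (limn_esup (fun n => Feps a b p (eps n) (un n)) <= Flim a b p u)%E.
  move=> ->; exists (fun=> u); split => //; split; last exact: leey.
  have z x : `|u x - u x| `^ p = 0 by rewrite subrr normr0 powR0.
  suff -> : Lpdist a b p u u = 0%E by exact: cvg_cst.
  apply/eqP; rewrite eq_le Lpdist_ge0 andbT; apply: (Lpdist_le (w := u)) => //.
  - by apply: ae_on_all.
  - by apply: eq_L1 (L1_cst _ _ 0) => x _; rewrite z.
  - by rewrite (@eq_Int _ _ _ _ (fun=> 0)) ?Int_cst ?mul0r ?powR0 ?(ltW ab)// => x _; rewrite z.
have [hB|hB] := pselect (BPV a b p u); last by apply: infty; rewrite /Flim asboolF.
have FE : Flim a b p u = (alpha p * essVar a b u)%E by rewrite /Flim asboolT.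
have [_ [pm1 vfin]] := hB; have hg := ae_good pm1.
(* Here the alternation is bounded because every alternation adds 2 to the finite essential
   variation. *)
have [n hn] : exists n, ~ alt u a b (- -1) n a.
  apply: contrapT => h; move: vfin; rewrite ltNge => /negP; apply.
  rewrite (@eq_infty _ (essVar a b u))// => t.
  apply: le_trans (essVar_alt_ge (or_introl erefl) (n := (Num.truncn t).+1) _).
    by rewrite lee_fin; have := truncnS_gt t; have := ler0n R (Num.truncn t).+1; lra.
  by apply: contrapT => hn; apply: h; eexists; rewrite opprK; exact: hn.
have [s [ts [s1 pts ats uE]]] := structure (or_intror erefl) (lexx a) ab hg hn.
have hE := essVar_alt_ge s1 (pw_alt (lexx a) ab pts ats hg uE).
have diag := recovery_diagonal e0 ecv lu.
have alpha0 := alpha_gt0 p1.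
(* Without jumps the constant s has energy 0, whatever the value of alpha. The case is kept apart
   because [recovery] asks for a finite alpha. *)
have [ts0|tsn] := posnP (size ts).
  have [|un [h1 [h2 h3]]] := diag 0%E.
    move=> delta d0; exists 1 => // e e00 _; exists (fun=> s).
    have [ps pz] := (prim_cst a b s, prim_cst a b (0 : R)).
    have lz : inLp a b p (fun=> (0 : R)).
      by apply: (inLp_bounded (K := 0) p1) => // x _; rewrite normr0.
    have ds x : dens e (fun=> s) (fun=> 0) x = 0.
      by rewrite /dens; case: s1 => ->; rewrite ?sqrrN expr1n subrr expr0n !mulr0 addr0.
    have dp x : `|s - pw s ts x| `^ p = 0 by rewrite (size0nil ts0) subrr normr0 powR0.
    split.
    - by have [] := prim_W2p (ltW ab) p1 ps pz lz.
    - apply: (Lpdist_le (w := pw s ts) p1 (ltW d0)) => //.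
        by apply: eq_L1 (L1_cst _ _ 0) => x _; rewrite dp.
      by rewrite (@eq_Int _ _ _ _ (fun=> 0)) ?Int_cst ?mul0r ?powR_ge0 ?(ltW ab).
    apply: (le_trans (Feps_le (ltW ab) p1 ps pz lz _)).
      by apply: eq_L1 (L1_cst _ _ 0).
    by rewrite (@eq_Int _ _ _ _ (fun=> 0)) ?Int_cst ?mul0r ?add0e ?lee_fin ?(ltW d0) ?(ltW ab).
  exists un; split => //; split => //; rewrite (le_trans h3)// FE.
  by rewrite mule_ge0 ?(ltW alpha0)// essVar_ge0.
(* With at least one jump the essential variation is positive, so an infinite alpha makes F u
   infinite and any sequence converging to u will do. *)
have [ay|ay] := ltP (alpha p) +oo%E; last first.
  have {}ay : alpha p = +oo%E by apply/eqP; rewrite -leye_eq.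
  apply: infty; rewrite FE ay gt0_mulye//; apply: lt_le_trans hE.
  by rewrite lte_fin mulr_gt0// ltr0n.
have [|un [h1 [h2 h3]]] := diag ((size ts)%:R%:E * (2%:E * alpha p))%E.
  by move=> delta d0; exact: (recovery ab p1 ay s1 pts ats mu' uE d0).
exists un; split => //; split => //; rewrite (le_trans h3)// FE.
rewrite muleA -EFinM muleC lee_wpmul2l ?(ltW alpha0)//.
by rewrite mulrC.
Qed.

End GammaLimit.

Theorem theorem3p5 (R : realType) (a b p : R) (eps : nat -> R) :
  a < b -> 1 <= p ->
  (forall n, 0 < eps n) -> eps n @[n --> \oo] --> (0 : R) ->
  Gamma_conv_Lp a b p (fun n => Feps a b p (eps n)) (Flim a b p).
Proof.
move=> ab p1 e0 ecv u lu; split => [un lun cv|]; first exact: gamma_liminf.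
exact: gamma_limsup.
Qed.
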